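(* Let $A$ be a finite abelian group of order $n$ with $\gcd(n,6)=1$, and let $\Gamma_p=\Gamma_p(A,S)$ be the random Cayley graph with $$\frac{25(\log n)^2}{n}\le p\le 1-\left(\frac{10\log n}{n}\right)^{2/3}.$$ Then with high probability $\chi_D(\Gamma_p)\le \chi(\Gamma_p)+1$; that is, there is a constant $c>0$ such that for all sufficiently large $n$ (uniformly over such $A$ and $p$), $\mathbb{P}\bigl(\chi_D(\Gamma_p)\le\chi(\Gamma_p)+1\bigr)\ge 1-n^{-c\log n}$.
   Context: For an inverse-closed $S\subseteq A\setminus\{0\}$, the Cayley graph $\Gamma(A,S)$ has vertex set $A$, with $x,y$ adjacent iff $y-x\in S$. The random Cayley graph $\Gamma_p(A,S)$ is $\Gamma(A,S)$ where $S$ is random: each element of $A$ of order exactly $2$ is put into $S$ independently with probability $p$, and for each pair $\{x,-x\}$ with $x\ne -x$, both $x,-x$ are put into $S$ with probability $p$ (and neither otherwise), all choices independent. $\chi(G)$ is the chromatic number. The distinguishing chromatic number $\chi_D(G)$ is the least $r$ such that $V(G)$ can be partitioned into independent sets $V_1,\dots,V_r$ such that for every non-identity automorphism $\pi$ of $G$ there is some $j$ with $\pi(V_j)\ne V_j$. $\log$ denotes $\log_2$. *)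

(* Defs.v *)
From Stdlib Require Import Reals.
From HB Require Import structures.
From mathcomp Require Import all_boot all_order all_algebra all_fingroup.

Set Implicit Arguments.
Unset Strict Implicit.
Unset Printing Implicit Defensive.

Definition cay_adj (A : finZmodType) (S : {set A}) (x y : A) : bool :=
  GRing.add y (GRing.opp x) \in S.

Definition inv_closed (A : finZmodType) (S : {set A}) : bool :=
  (GRing.zero \notin S) && [forall x : A, (x \in S) == (GRing.opp x \in S)].

Definition colour_class (A : finZmodType) (r : nat) (f : {ffun A -> 'I_r})
  (j : 'I_r) : {set A} := [set x | f x == j].

Definition proper_col (A : finZmodType) (S : {set A}) (r : nat)
  (f : {ffun A -> 'I_r}) : bool :=
  [forall j : 'I_r, forall x in colour_class f j, forall y in colour_class f j,
     ~~ cay_adj S x y].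

Definition is_aut (A : finZmodType) (S : {set A}) (g : {perm A}) : bool :=
  [forall x : A, forall y : A, cay_adj S (g x) (g y) == cay_adj S x y].

Definition distinguishing (A : finZmodType) (S : {set A}) (r : nat)
  (f : {ffun A -> 'I_r}) : bool :=
  [forall g : {perm A}, (is_aut S g && (g != 1%g)) ==>
     [exists j : 'I_r, (g @: colour_class f j) != colour_class f j]].

Definition colorableb (A : finZmodType) (S : {set A}) (r : nat) : bool :=
  [exists f : {ffun A -> 'I_r}, proper_col S f].

Definition dcolorableb (A : finZmodType) (S : {set A}) (r : nat) : bool :=
  [exists f : {ffun A -> 'I_r}, proper_col S f && distinguishing S f].

(* Least r with the property; r = #|A| always works (injective colouring,
   since Cayley graphs with 0 \notin S are loopless), so searching in
   0..#|A| yields the true minimum. *)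
Definition chromatic (A : finZmodType) (S : {set A}) : nat :=
  find (colorableb S) (iota 0 #|A|.+1).

Definition dchromatic (A : finZmodType) (S : {set A}) : nat :=
  find (dcolorableb S) (iota 0 #|A|.+1).

(* The pairs {x,-x}, x <> 0 (singletons for elements of order 2). *)
Definition pair_orbits (A : finZmodType) : {set {set A}} :=
  [set [set x; GRing.opp x] | x in [set x : A | x != GRing.zero]].

Definition n_in (A : finZmodType) (S : {set A}) : nat :=
  #|[set O in pair_orbits A | O \subset S]|.

Definition cay_weight (A : finZmodType) (p : R) (S : {set A}) : R :=
  Rmult (pow p (n_in S)) (pow (Rminus 1 p) (#|pair_orbits A| - n_in S)).

Definition cay_prob (A : finZmodType) (p : R) (E : {set A} -> bool) : R :=
  \big[Rplus/R0]_(S : {set A} | inv_closed S && E S) cay_weight p S.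

Definition log2 (x : R) : R := Rdiv (ln x) (ln 2).

(* Main.v *)
(** If every automorphism of the graph has the form x |-> c + x or x |-> c - x,
    recolouring a single well-chosen vertex of an optimal colouring with a new
    colour destroys all of them.  So it suffices that a random Cayley graph has
    only these automorphisms.  Complementation reduces this to p <= 1/2, and
    three ranges of p are treated, with n the order of A.

    For p <= n^(-0.51) most sums s + t of two elements of S have no
    representation besides s + t and t + s, so an automorphism g maps most
    parallelograms x, x+s, x+t, x+s+t to parallelograms.  As the exceptional t
    cannot cover the complement of a proper subgroup in S, g is a translate of
    a group automorphism, and the at most n^(log n) group automorphisms are
    handled by a union bound.

    For larger p one uses a function W on differences that every automorphism
    g preserves: the codegree if p <= n^(-0.05), the indicator of S otherwise.
    Sampling pairs of points of A, a union bound over their images under g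
    shows that g x - g y = +-(x - y) for almost all pairs, hence g agrees with an
    affine map up to few points.  Sampling points z for fixed x <> y shows that
    W (z - x) <> W (z - y) for many z, hence g agrees with it everywhere.  The
    independence needed for codegrees comes from exposing S in two rounds. *)

From Stdlib Require Import Reals ZArith Lra Lia Psatz.

(** * Explicit real inequalities that fix the parameters *)

Section RealEstimates.
Local Open Scope R_scope.

(** The sampling argument pays n^(4k) for 2k sampled points and their images, but it gains the k^2
    differences between k left and k right points. If each difference separates its two values of
    [W] with probability at least c, a k of order log n / c^2 suffices. Coincidences among the
    labels must stay rare, so k^6, of order c^(-12) up to logarithms, has to be small against c n;
    this is ensured for c >= n^(-0.05), and the ranges of p follow. The indicator of S gives c = p.
    The codegree gives c of order min(1, n p^2), about n^(-0.02) or more while p >= n^(-0.51): it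
    changes when the second round adds one element of a prepared block, and the blocks are large
    because p <= n^(-0.05) keeps codegrees far below n p. Below n^(-0.51) codegrees carry too little
    information, but then most sums are unique.

    Coprimality with 6 enters in several ways: any two points have a midpoint, proper subgroups have
    index at least 5, and 2t = c or 3t = c has at most one solution. *)

Lemma exp_INR (m : nat) (y : R) : exp y ^ m = exp (INR m * y).
Proof.
induction m as [|m IH]; [simpl; rewrite Rmult_0_l, exp_0; reflexivity|].
rewrite S_INR; simpl; rewrite IH, <- exp_plus; f_equal; ring.
Qed.

Lemma one_minus_pow (m : nat) (y : R) : y <= 1 -> (1 - y) ^ m <= exp (- (INR m * y)).
Proof.
intros hy; replace (- (INR m * y)) with (INR m * - y) by ring.
rewrite <- exp_INR; apply pow_incr; split; [lra|].
generalize (exp_ineq1_le (- y)); lra.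
Qed.

Lemma exp_le (x y : R) : x <= y -> exp x <= exp y.
Proof. intros [h|h]; [left; apply exp_increasing; exact h | rewrite h; lra]. Qed.

(** With a = eps / (j + 1), raising a l <= exp (a l) to the power j + 1 leaves one spare factor l,
    which absorbs the constant [C]. *)
Lemma poly_exp (C : R) (j : nat) (eps : R) : 0 < eps ->
  exists l0, 1 <= l0 /\ forall l, l0 <= l -> C * l ^ j <= exp (eps * l).
Proof.
intros he; set (a := eps / INR (S j)).
assert (hj : 0 < INR (S j)) by (apply lt_0_INR; lia).
assert (ha : 0 < a) by (unfold a; apply Rdiv_lt_0_compat; lra).
exists (1 + Rabs C / a ^ S j); split.
  assert (0 <= Rabs C / a ^ S j); [|lra].
  apply Rmult_le_pos; [apply Rabs_pos | left; apply Rinv_0_lt_compat, pow_lt, ha].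
intros l hl.
assert (hq : 0 < a ^ S j) by (apply pow_lt; exact ha).
assert (h0 : 0 <= Rabs C / a ^ S j).
  apply Rmult_le_pos; [apply Rabs_pos | left; apply Rinv_0_lt_compat, hq].
assert (hl1 : 1 <= l) by lra.
replace (eps * l) with (INR (S j) * (a * l)) by (unfold a; field; lra).
rewrite <- exp_INR.
apply Rle_trans with ((a * l) ^ S j).
- rewrite Rpow_mult_distr; simpl (l ^ S j); rewrite <- Rmult_assoc.
  apply Rmult_le_compat_r; [left; apply pow_lt; lra|].
  apply Rle_trans with (Rabs C); [apply RRle_abs|].
  assert (Rabs C = a ^ S j * (Rabs C / a ^ S j)) by (field; lra).
  rewrite H; apply Rmult_le_compat_l; lra.
- apply pow_incr; split; [nra|]; generalize (exp_ineq1_le (a * l)); lra.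
Qed.

Lemma nat_floor (x : R) : 0 <= x -> exists k : nat, INR k <= x < INR k + 1.
Proof.
intros hx; destruct (archimed x) as [h1 h2].
exists (Z.to_nat (up x - 1)).
assert (hz : (0 <= up x - 1)%Z).
  assert (0 < up x)%Z by (apply lt_IZR; lra); lia.
rewrite INR_IZR_INZ, Z2Nat.id by exact hz; rewrite minus_IZR; lra.
Qed.

Lemma nat_between (x : R) : 1 <= x -> exists k : nat, x <= INR k <= 2 * x.
Proof.
intros hx; destruct (nat_floor x) as [k hk]; [lra|].
exists (S k); rewrite S_INR; lra.
Qed.

(** The sharpness matters: 25 / (3/4)^2 > 44 is what the lower bound on p becomes in natural
    logarithms, see [density_lower_bound]. *)
Lemma ln2_lt : ln 2 < 3 / 4.
Proof.
rewrite <- (ln_exp (3 / 4)); apply ln_increasing; [lra|].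
replace (3 / 4) with (INR 16 * (3 / 64)) by (simpl; field).
rewrite <- exp_INR; apply Rlt_le_trans with ((1 + 3 / 64) ^ 16); [lra|].
apply pow_incr; split; [lra|apply exp_ineq1_le].
Qed.

(* [exp l] plays the role of the order of the group. *)
Lemma rigid_sizes : exists l0, 2 <= l0 /\ forall l c k M : R, l0 <= l -> exp (- (l / 20)) <= c <= 1 ->
  0 <= k <= 8000 * l / c ^ 2 -> 0 <= M <= 20 * l ^ 2 / c ->
  2600 * k ^ 6 <= c * exp l /\ 52 * M ^ 3 <= exp l /\ 200 <= exp l.
Proof.
destruct (poly_exp (2600 * 8000 ^ 6) 6 (7 / 20)) as [a [ha Ha]]; [lra|].
destruct (poly_exp (52 * 20 ^ 3) 6 (17 / 20)) as [b [hb Hb]]; [lra|].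
exists (200 + a + b); split; [lra|]; intros l c k M hl [hc1 hc2] [hk0 hk] [hM0 hM].
assert (hc : 0 < c) by (generalize (exp_pos (- (l / 20))); lra).
assert (hci : / c <= exp (l / 20)).
  replace (l / 20) with (- - (l / 20)) by ring; rewrite exp_Ropp.
  apply Rinv_le_contravar; [apply exp_pos | exact hc1].
assert (hci0 : 0 < / c) by (apply Rinv_0_lt_compat; exact hc).
assert (E6 : exp (l / 20) ^ 12 = exp (6 / 10 * l)) by (rewrite exp_INR; f_equal; simpl; field).
assert (E3 : exp (l / 20) ^ 3 = exp (3 / 20 * l)) by (rewrite exp_INR; f_equal; simpl; field).
split; [|split].
- assert (k ^ 6 <= 8000 ^ 6 * l ^ 6 * exp (6 / 10 * l)).
    apply Rle_trans with ((8000 * l / c ^ 2) ^ 6); [apply pow_incr; lra|].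
    replace ((8000 * l / c ^ 2) ^ 6) with (8000 ^ 6 * l ^ 6 * (/ c) ^ 12) by (field; lra).
    rewrite <- E6; apply Rmult_le_compat_l.
      apply Rmult_le_pos; [lra | apply pow_le; lra].
    apply pow_incr; lra.
  apply Rle_trans with (exp (- (l / 20)) * exp l).
    2: { apply Rmult_le_compat_r; [left; apply exp_pos | exact hc1]. }
  rewrite <- exp_plus.
  replace (- (l / 20) + l) with (7 / 20 * l + 6 / 10 * l) by field.
  rewrite exp_plus.
  assert (h := Ha l); assert (h' : 2600 * 8000 ^ 6 * l ^ 6 <= exp (7 / 20 * l)) by (apply h; lra).
  apply Rle_trans with (2600 * 8000 ^ 6 * l ^ 6 * exp (6 / 10 * l)); [lra|].
  apply Rmult_le_compat_r; [left; apply exp_pos | exact h'].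
- assert (M ^ 3 <= 20 ^ 3 * l ^ 6 * exp (3 / 20 * l)).
    apply Rle_trans with ((20 * l ^ 2 / c) ^ 3); [apply pow_incr; lra|].
    replace ((20 * l ^ 2 / c) ^ 3) with (20 ^ 3 * l ^ 6 * (/ c) ^ 3) by (field; lra).
    rewrite <- E3; apply Rmult_le_compat_l.
      apply Rmult_le_pos; [lra | apply pow_le; lra].
    apply pow_incr; lra.
  replace (exp l) with (exp (17 / 20 * l + 3 / 20 * l)) by (f_equal; field).
  rewrite exp_plus.
  assert (h' : 52 * 20 ^ 3 * l ^ 6 <= exp (17 / 20 * l)) by (apply Hb; lra).
  apply Rle_trans with (52 * 20 ^ 3 * l ^ 6 * exp (3 / 20 * l)); [lra|].
  apply Rmult_le_compat_r; [left; apply exp_pos | exact h'].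
- generalize (exp_ineq1_le l); lra.
Qed.

Lemma exp_ge1 (x : R) : 0 <= x -> 1 <= exp x.
Proof. intros h; generalize (exp_ineq1_le x); lra. Qed.

Lemma Rle_div (a b x : R) : 0 < b -> a * b <= x -> a <= x / b.
Proof.
intros hb h; replace a with (a * b / b) by (field; lra).
apply Rmult_le_compat_r; [left; apply Rinv_0_lt_compat; exact hb | exact h].
Qed.

(** Parameters of the sampling argument: [c] is the probability that a label separates [W], [k] the
    number of points on each side of the bipartite sample, [m] the number of its pairs required to
    be nontrivial, [N0] the threshold for nontrivial pairs, [N1] the size of the exceptional set,
    and [M], [v] the sample size and the tolerated number of separations for two fixed points. The
    last clause is the final union bound; [err] is the additive error of one test and is multiplied
    by the number of tests. *)
Lemma rigid_choice : exists l0, 2 <= l0 /\ forall (n : nat) (l c : R),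
  INR n = exp l -> l0 <= l -> exp (- (l / 20)) <= c <= 1 ->
  exists k M v m N0 N1 : nat, (0 < k)%nat /\
   (INR m * INR n ^ 2 + 12 * INR k ^ 8 * INR n <= INR k ^ 2 * INR N0 /\
    2 * (INR M * INR N1 + 13 * INR M ^ 3 * (INR v + 1)) <= INR n * (INR v + 1) /\
    (forall a : nat, INR a <= INR n -> INR n * INR n <= INR N0 + 2 * INR n * INR a ->
       (INR a - 1) * (INR n - INR a) <= INR N0 -> INR n - INR a <= INR N1)) /\
   INR k <= 8000 * l / c ^ 2 /\ INR M <= (8000 * l / c ^ 2) ^ 2 /\
   forall err, 0 <= err ->
     exp l ^ (4 * k) * (1 * (1 - c / 2) ^ m + err) +
     exp l * exp l * (2 * (2 ^ v * (1 - c / 2) ^ M + err))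
     <= exp (- l ^ 2) + 3 * exp (32000 * l ^ 2 / c ^ 2) * err.
Proof.
destruct rigid_sizes as [l0 [hl0 Hl0]]; exists l0; split; [exact hl0|].
intros n l c hn hl hc.
assert (hc0 : 0 < c) by (generalize (exp_pos (- (l / 20))); lra).
assert (hc2 : 0 < c ^ 2) by (apply pow_lt; exact hc0).
assert (hc21 : c ^ 2 <= 1) by (simpl; nra).
assert (q1 : 1 <= 4000 * l / c ^ 2).
  apply Rle_div; lra.
assert (q2 : 10 * l ^ 2 <= 10 * l ^ 2 / c).
  apply Rle_div; [exact hc0|]; generalize (pow2_ge_0 l); nra.
(* This k makes m c / 2, about c^2 k^2 / 400 >= 10 l k, beat the 4 k l of the union bound.
   Similarly, with v about c M / 8, the decay c M / 2 exceeds v by more than 2 l^2 + 2 l + 1. *)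
destruct (nat_between (4000 * l / c ^ 2)) as [k [hk1 hk2]]; [exact q1|].
destruct (nat_between (10 * l ^ 2 / c)) as [M [hM1 hM2]]; [simpl in *; nra|].
destruct (nat_floor (c * INR M / 8)) as [v [hv1 hv2]]; [generalize (pos_INR M); nra|].
destruct (nat_floor (c * INR k ^ 2 / 200)) as [m [hm1 hm2]]; [generalize (pow2_ge_0 (INR k)); nra|].
destruct (nat_floor (c * INR n ^ 2 / 100)) as [N0 [hN01 hN02]]; [generalize (pow2_ge_0 (INR n)); nra|].
destruct (nat_floor (3 * c * INR n / 100)) as [N1 [hN11 hN12]]; [generalize (pos_INR n); nra|].
assert (hk2' : INR k <= 8000 * l / c ^ 2) by (replace (8000 * l / c ^ 2) with (2 * (4000 * l / c ^ 2)) by (field; lra); exact hk2).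
assert (hM2' : INR M <= 20 * l ^ 2 / c) by (replace (20 * l ^ 2 / c) with (2 * (10 * l ^ 2 / c)) by (field; lra); exact hM2).
destruct (Hl0 l c (INR k) (INR M)) as [S1 [S2 S3]]; [exact hl | exact hc | split; [apply pos_INR | exact hk2'] | split; [apply pos_INR | exact hM2'] |].
rewrite <- hn in S1, S2, S3.
assert (hk0 : 1 <= INR k) by lra.
assert (hkl : 4000 * l <= c ^ 2 * INR k).
  apply Rmult_le_compat_l with (r := c ^ 2) in hk1; [|lra].
  replace (c ^ 2 * (4000 * l / c ^ 2)) with (4000 * l) in hk1 by (field; lra); exact hk1.
assert (hMl : 10 * l ^ 2 <= c * INR M).
  apply Rmult_le_compat_l with (r := c) in hM1; [|lra].
  replace (c * (10 * l ^ 2 / c)) with (10 * l ^ 2) in hM1 by (field; lra); exact hM1.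
set (N := INR n) in *; set (K := INR k) in *; set (MM := INR M) in *.
assert (hMM : 0 <= MM) by apply pos_INR.
assert (hK4 : 4000 * l <= K) by (assert (c ^ 2 * K <= 1 * K) by (apply Rmult_le_compat_r; lra); lra).
exists k, M, v, m, N0, N1; fold K N MM; split; [apply INR_lt; simpl; fold K; lra|]; split; [split; [|split]|split; [|split]].
- apply Rle_trans with (K ^ 2 * (c * N ^ 2 / 100 - 1)); [|apply Rmult_le_compat_l; [apply pow2_ge_0|lra]].
  assert (h0 : INR m * N ^ 2 <= c * K ^ 2 / 200 * N ^ 2) by (apply Rmult_le_compat_r; [apply pow2_ge_0|lra]).
  assert (h1 : 1 <= K ^ 6) by (apply pow_R1_Rle; lra).
  assert (h2 : 12 * K ^ 6 * N + 1 <= c * N ^ 2 / 200).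
    assert (13 * K ^ 6 * N <= c * N / 200 * N) by (apply Rmult_le_compat_r; lra).
    assert (1 <= K ^ 6 * N) by nra.
    replace (c * N ^ 2 / 200) with (c * N / 200 * N) by field; lra.
  assert (h3 : K ^ 2 * (12 * K ^ 6 * N + 1) <= K ^ 2 * (c * N ^ 2 / 200)) by (apply Rmult_le_compat_l; [apply pow2_ge_0|exact h2]).
  replace (12 * K ^ 8 * N) with (K ^ 2 * (12 * K ^ 6 * N)) by ring.
  replace (K ^ 2 * (c * N ^ 2 / 100 - 1)) with (c * K ^ 2 / 200 * N ^ 2 + K ^ 2 * (c * N ^ 2 / 200) - K ^ 2) by field.
  replace (K ^ 2 * (12 * K ^ 6 * N + 1)) with (K ^ 2 * (12 * K ^ 6 * N) + K ^ 2) in h3 by ring.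
  clear - h0 h3; lra.
- assert (MM * INR N1 <= MM * (3 * c * N / 100)) by (apply Rmult_le_compat_l; lra).
  assert (MM * (3 * c * N / 100) <= 24 / 100 * (N * (INR v + 1))).
    replace (MM * (3 * c * N / 100)) with (24 / 100 * (N * (c * MM / 8))) by field.
    apply Rmult_le_compat_l; [lra|]; apply Rmult_le_compat_l; lra.
  assert (0 <= INR v) by apply pos_INR.
  assert (52 * MM ^ 3 * (INR v + 1) <= N * (INR v + 1)) by (apply Rmult_le_compat_r; lra).
  assert (0 <= N * (INR v + 1)) by (apply Rmult_le_pos; lra).
  lra.
(* The product bound alone would also allow a near 0; the first bound forces a >= 0.49 n, and then n
   - a <= N0 / (0.49 n). *)
- intros a ha h1 h2.
  set (x := INR a) in *.
  assert (hx : 49 / 100 * N <= x - 1).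
    assert (N * N <= c * N ^ 2 / 100 + 2 * N * x) by lra.
    assert (c * N ^ 2 / 100 <= N ^ 2 / 100) by (assert (0 <= N ^ 2) by apply pow2_ge_0; nra).
    assert (N * (99 / 100 * N) <= N * (2 * x)) by (simpl in *; lra).
    assert (99 / 100 * N <= 2 * x) by (apply Rmult_le_reg_l with N; lra).
    lra.
  assert (49 / 100 * N * (N - x) <= c * N ^ 2 / 100).
    apply Rle_trans with ((x - 1) * (N - x)); [apply Rmult_le_compat_r; lra | lra].
  assert (N - x <= 3 * c * N / 100 - 1 + 1).
    apply Rmult_le_reg_l with (49 / 100 * N); [lra|].
    apply Rle_trans with (c * N ^ 2 / 100); [exact H|].
    replace (49 / 100 * N * (3 * c * N / 100 - 1 + 1)) with (147 / 100 * (c * N ^ 2 / 100)) by field.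
    assert (0 <= c * N ^ 2) by (apply Rmult_le_pos; [lra | apply pow2_ge_0]); lra.
  assert (hlt : INR n - INR a < INR N1 + 1) by (fold N x; lra).
  assert (a <= n)%nat by (apply INR_le; exact ha).
  rewrite <- minus_INR in hlt by assumption.
  unfold x, N; rewrite <- minus_INR by assumption.
  rewrite <- S_INR in hlt; apply INR_lt in hlt; apply le_INR; lia.
- exact hk2'.
- fold MM; apply Rle_trans with (20 * l ^ 2 / c); [exact hM2'|].
  replace ((8000 * l / c ^ 2) ^ 2) with (8000 ^ 2 * l ^ 2 * / c ^ 4) by (field; lra).
  replace (20 * l ^ 2 / c) with (20 * l ^ 2 * / c) by reflexivity.
  assert (/ c <= / c ^ 4).
    apply Rinv_le_contravar; [apply pow_lt; exact hc0|].
    replace (c ^ 4) with (c * (c * c ^ 2)) by ring; assert (c * c ^ 2 <= 1) by nra; nra.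
  assert (0 < / c) by (apply Rinv_0_lt_compat; exact hc0).
  assert (0 <= l ^ 2) by apply pow2_ge_0.
  apply Rmult_le_compat; lra.
- intros err he.
  assert (A1 : exp l ^ (4 * k) <= exp (32000 * l ^ 2 / c ^ 2)).
    rewrite exp_INR; apply exp_le; rewrite mult_INR; fold K; simpl (INR 4).
    replace (32000 * l ^ 2 / c ^ 2) with (4 * (8000 * l / c ^ 2) * l) by (field; lra).
    apply Rmult_le_compat_r; lra.
  assert (A2 : exp l * exp l <= exp (32000 * l ^ 2 / c ^ 2)).
    rewrite <- exp_plus; apply exp_le.
    assert (1 <= / c ^ 2) by (rewrite <- Rinv_1 at 1; apply Rinv_le_contravar; lra).
    unfold Rdiv; assert (32000 * l ^ 2 * 1 <= 32000 * l ^ 2 * / c ^ 2).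
      apply Rmult_le_compat_l; [generalize (pow2_ge_0 l)|]; lra.
    simpl in *; nra.
  assert (B1 : exp l ^ (4 * k) * (1 - c / 2) ^ m <= exp (- (2 * l ^ 2))).
    rewrite exp_INR; apply Rle_trans with (exp (INR (4 * k) * l) * exp (- (INR m * (c / 2)))).
      apply Rmult_le_compat_l; [left; apply exp_pos | apply one_minus_pow; lra].
    rewrite <- exp_plus; apply exp_le; rewrite mult_INR; fold K; simpl (INR 4).
    assert (c * K ^ 2 / 200 * (c / 2) - 1 * (c / 2) <= INR m * (c / 2)).
      rewrite <- Rmult_minus_distr_r; apply Rmult_le_compat_r; lra.
    assert (10 * l * K <= c * K ^ 2 / 200 * (c / 2)).
      replace (c * K ^ 2 / 200 * (c / 2)) with (c ^ 2 * K * K / 400) by field.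
      assert (4000 * l * K <= c ^ 2 * K * K) by (apply Rmult_le_compat_r; lra); lra.
    assert (4000 * l * l <= K * l) by (apply Rmult_le_compat_r; lra).
    simpl; nra.
  assert (B2 : exp l * exp l * (2 * (2 ^ v * (1 - c / 2) ^ M)) <= exp (- (2 * l ^ 2))).
    apply Rle_trans with (exp l * exp l * (exp 1 * (exp (INR v * 1) * exp (- (MM * (c / 2)))))).
      apply Rmult_le_compat_l; [left; apply Rmult_lt_0_compat; apply exp_pos|].
      assert (e2 : 2 <= exp 1) by (generalize (exp_ineq1_le 1); lra).
      assert (hp : 0 <= (1 - c / 2) ^ M) by (apply pow_le; lra).
      assert (hp2 : 0 <= 2 ^ v) by (apply pow_le; lra).
      apply Rmult_le_compat; [lra | apply Rmult_le_pos; assumption | exact e2 |].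
      apply Rmult_le_compat; [assumption | assumption | | apply one_minus_pow; lra].
      rewrite <- exp_INR; apply pow_incr; lra.
    rewrite <- !exp_plus; apply exp_le.
    simpl in *; nra.
  assert (C1 : exp (- (2 * l ^ 2)) * 2 <= exp (- l ^ 2)).
    replace (- l ^ 2) with (- (2 * l ^ 2) + l ^ 2) by ring; rewrite exp_plus.
    apply Rmult_le_compat_l; [left; apply exp_pos|]; generalize (exp_ineq1_le (l ^ 2)); simpl; nra.
  assert (D1 := Rmult_le_compat_r err _ _ he A1).
  assert (D2 := Rmult_le_compat_r err _ _ he A2).
  lra.
Qed.

Lemma INR_num1 (m n k N0 : nat) :
  INR m * INR n ^ 2 + 12 * INR k ^ 8 * INR n <= INR k ^ 2 * INR N0 ->
  (m * Nat.pow n 2 + 12 * Nat.pow k 8 * n <= Nat.pow k 2 * N0)%nat.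
Proof.
intros h; apply INR_le; rewrite plus_INR, !mult_INR, !pow_INR.
replace (INR 12) with 12 by (simpl; lra); exact h.
Qed.

Lemma INR_num2 (M N1 v n : nat) :
  2 * (INR M * INR N1 + 13 * INR M ^ 3 * (INR v + 1)) <= INR n * (INR v + 1) ->
  (2 * (M * N1 + 13 * Nat.pow M 3 * S v) <= n * S v)%nat.
Proof.
intros h; apply INR_le; rewrite !mult_INR, plus_INR, !mult_INR, !pow_INR, (S_INR v).
replace (INR 13) with 13 by (simpl; lra); replace (INR 2) with 2 by (simpl; lra); exact h.
Qed.

Lemma INR_num3 (n N0 N1 a : nat) :
  (INR a <= INR n -> INR n * INR n <= INR N0 + 2 * INR n * INR a ->
     (INR a - 1) * (INR n - INR a) <= INR N0 -> INR n - INR a <= INR N1) ->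
  (a <= n)%nat -> (n * n <= N0 + 2 * n * a)%nat -> ((a - 1) * (n - a) <= N0)%nat -> (n - a <= N1)%nat.
Proof.
intros H h1 h2 h3; apply INR_le; rewrite minus_INR by exact h1; apply H.
- apply le_INR; exact h1.
- apply le_INR in h2; rewrite plus_INR, !mult_INR in h2.
  replace (INR 2) with 2 in h2 by (simpl; lra); exact h2.
- assert (hn : 0 <= INR n - INR a) by (apply le_INR in h1; lra).
  apply le_INR in h3; rewrite mult_INR, (minus_INR n a) in h3 by exact h1.
  destruct a as [|a].
    simpl INR at 1; generalize (pos_INR N0); nra.
  replace (S a - 1)%nat with a in h3 by lia; rewrite S_INR at 1.
  replace (INR a + 1 - 1) with (INR a) by ring; exact h3.
Qed.

Lemma one_minus_pow_ge (m : nat) (y : R) : 0 <= y <= 1 -> 1 - INR m * y <= (1 - y) ^ m.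
Proof.
intros hy; induction m as [|m IH]; [simpl; lra|].
rewrite S_INR; simpl; generalize (pos_INR m); intros hm.
assert ((1 - y) * (1 - INR m * y) <= (1 - y) * (1 - y) ^ m) by (apply Rmult_le_compat_l; lra).
assert (0 <= INR m * (y * y)) by (apply Rmult_le_pos; nra).
nra.
Qed.

(* [F] stands for [m!], which satisfies the hypothesis (see [fact_lower_bound]). *)
Lemma div_fact_le (x F : R) (m : nat) : 0 <= x -> (INR m / exp 1) ^ m <= F -> (0 < m)%nat ->
  x ^ m / F <= (3 * x / INR m) ^ m.
Proof.
intros hx hF hm.
assert (h1 : 0 < INR m) by (apply lt_0_INR; exact hm).
assert (h2 : 0 < (INR m / exp 1) ^ m) by (apply pow_lt, Rdiv_lt_0_compat; [exact h1 | apply exp_pos]).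
apply Rle_trans with (x ^ m / (INR m / exp 1) ^ m).
  apply Rmult_le_compat_l; [apply pow_le; exact hx | apply Rinv_le_contravar; assumption].
replace (x ^ m / (INR m / exp 1) ^ m) with ((exp 1 * x / INR m) ^ m).
  apply pow_incr; split.
    apply Rmult_le_pos; [apply Rmult_le_pos; [left; apply exp_pos | exact hx] | left; apply Rinv_0_lt_compat; exact h1].
  apply Rmult_le_compat_r; [left; apply Rinv_0_lt_compat; exact h1|].
  apply Rmult_le_compat_r; [exact hx | apply exp_le_3].
assert (he := exp_pos 1).
unfold Rdiv; rewrite !Rpow_mult_distr, !pow_inv.
assert (exp 1 ^ m <> 0) by (apply pow_nonzero; lra).
assert (INR m ^ m <> 0) by (apply pow_nonzero; lra).
field; auto.
Qed.

(** As m! >= (m/e)^m and m >= 8 n p^2, each of the m factors 3 n p^2 / m is below 1/2; the summand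
    l^2 in m pays for the union over n elements. *)
Lemma codeg_error (l n p F : R) (m : nat) : 4 <= l -> n = exp l -> 0 <= p ->
  8 * (n * p ^ 2) + l ^ 2 <= INR m -> (INR m / exp 1) ^ m <= F ->
  n * ((n * p ^ 2) ^ m / F) <= exp (- (l ^ 2 / 4)).
Proof.
intros hl hn hp hm hF.
assert (hx : 0 <= n * p ^ 2) by (rewrite hn; apply Rmult_le_pos; [left; apply exp_pos | apply pow2_ge_0]).
assert (h16 : 16 <= l ^ 2) by (simpl; nra).
assert (hm0 : 0 < INR m) by lra.
apply Rle_trans with (exp l * exp (- (INR m / 2))).
  rewrite hn at 1; apply Rmult_le_compat_l; [left; apply exp_pos|].
  apply Rle_trans with ((3 * (n * p ^ 2) / INR m) ^ m).
    apply div_fact_le; [exact hx | exact hF | apply INR_lt; simpl; exact hm0].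
  replace (- (INR m / 2)) with (INR m * - (1 / 2)) by field; rewrite <- exp_INR.
  apply pow_incr; split.
    apply Rmult_le_pos; [lra | left; apply Rinv_0_lt_compat; exact hm0].
  apply Rle_trans with (1 / 2).
    apply Rmult_le_reg_r with (INR m); [exact hm0|].
    replace (3 * (n * p ^ 2) / INR m * INR m) with (3 * (n * p ^ 2)) by (field; lra); lra.
  generalize (exp_ineq1_le (- (1 / 2))); lra.
rewrite <- exp_plus; apply exp_le; nra.
Qed.

Lemma middle_numerics : exists l0, 4 <= l0 /\ forall (n : nat) (l p : R),
  INR n = exp l -> l0 <= l -> exp (- (51 / 100 * l)) <= p <= exp (- (l / 20)) ->
  exists (p1 p2 c : R) (a m : nat), let kap := (8 * m + 2)%nat in
   (0 <= p1 <= 1 /\ 0 <= p2 <= 1 /\ 1 - p = (1 - p1) * (1 - p2)) /\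
   (exp (- (l / 20)) <= c <= 1) /\
   (c <= (1 - p2) ^ a /\ c <= INR a * (p2 * (1 - p2) ^ pred a)) /\
   8 * (INR n * p ^ 2) + l ^ 2 <= INR m /\
   (forall i m0 h : nat, INR i <= (8000 * l / c ^ 2) ^ 2 -> (m0 = 2 * a + 14 * Nat.pow i 2 * kap)%nat ->
      n = S (h + h) -> (1 - p1 + p1 * / 2) ^ h * 2 ^ m0 <= exp (- (INR n * p / 20))) /\
   3 * exp (32000 * l ^ 2 / c ^ 2) * exp (- (INR n * p / 20)) <= exp (- l ^ 2).
Proof.
set (C1 := 100 * (14 * 8000 ^ 4 * 500 ^ 8 * 146)).
set (C2 := 32000 * 500 ^ 2).
destruct (poly_exp C1 6 (1 / 20)) as [x1 [hx1 H1]]; [lra|].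
destruct (poly_exp ((C2 + 3) * 20) 2 (45 / 100)) as [x2 [hx2 H2]]; [lra|].
destruct (poly_exp 500 0 (3 / 100)) as [x3 [hx3 H3]]; [lra|].
destruct (poly_exp 1000 0 (49 / 100)) as [x4 [hx4 H4]]; [lra|].
exists (200 + x1 + x2 + x3 + x4); split; [lra|].
intros n l p hn hl [hp1 hp2].
assert (hl1 : 200 <= l) by lra.
set (N := INR n) in *; set (D := N * p).
assert (hN : 0 < N) by (rewrite hn; apply exp_pos).
assert (hN200 : 200 <= N) by (rewrite hn; generalize (exp_ineq1_le l); lra).
assert (hp0 : 0 < p) by (generalize (exp_pos (- (51 / 100 * l))); lra).
assert (hpd : p <= 1 / 10).
  apply Rle_trans with (exp (- (l / 20))); [exact hp2|].
  rewrite exp_Ropp; apply Rle_trans with (/ 10); [|lra].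
  apply Rinv_le_contravar; [lra|]; generalize (exp_ineq1_le (l / 20)); lra.
assert (hD : exp (49 / 100 * l) <= D).
  unfold D; rewrite hn; replace (49 / 100 * l) with (l + - (51 / 100 * l)) by field; rewrite exp_plus.
  apply Rmult_le_compat_l; [left; apply exp_pos | exact hp1].
assert (hD1 : 1000 <= D).
  apply Rle_trans with (exp (49 / 100 * l)); [|exact hD].
  assert (h := H4 l); simpl in h; rewrite Rmult_1_r in h; apply h; lra.
set (lam := N * p ^ 2).
assert (hlam : lam = D * p) by (unfold lam, D; ring).
assert (hlam0 : 0 < lam) by (rewrite hlam; apply Rmult_lt_0_compat; lra).
assert (hlam1 : exp (- (2 / 100 * l)) <= lam).
  rewrite hlam; replace (- (2 / 100 * l)) with (49 / 100 * l + - (51 / 100 * l)) by field; rewrite exp_plus.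
  apply Rmult_le_compat; [left; apply exp_pos | left; apply exp_pos | exact hD | exact hp1].
set (tau := Rmin 1 lam).
assert (ht1 : tau <= 1) by apply Rmin_l.
assert (htl : tau <= lam) by apply Rmin_r.
assert (ht0 : exp (- (2 / 100 * l)) <= tau).
  apply Rmin_glb; [|exact hlam1].
  rewrite <- exp_0; apply exp_le; lra.
assert (ht : 0 < tau) by (generalize (exp_pos (- (2 / 100 * l))); lra).
assert (hti : / tau <= exp (2 / 100 * l)).
  replace (2 / 100 * l) with (- - (2 / 100 * l)) by ring; rewrite exp_Ropp.
  apply Rinv_le_contravar; [apply exp_pos | exact ht0].
assert (hti0 : 0 < / tau) by (apply Rinv_0_lt_compat; exact ht).
set (p2 := tau / (2 * D)).
assert (hp2D : p2 * D = tau / 2) by (unfold p2; field; lra).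
assert (hp20 : 0 < p2) by (unfold p2; apply Rdiv_lt_0_compat; lra).
assert (hp2p : p2 <= p / 2).
  apply Rmult_le_reg_r with D; [lra|]; rewrite hp2D.
  replace (p / 2 * D) with (lam / 2) by (rewrite hlam; field); lra.
set (p1 := (p - p2) / (1 - p2)).
assert (hpE : 1 - p = (1 - p1) * (1 - p2)) by (unfold p1; field; lra).
assert (hp1p : p / 2 <= p1).
  unfold p1; apply Rle_div; [lra|].
  assert (p / 2 * (1 - p2) <= p / 2 * 1) by (apply Rmult_le_compat_l; lra); lra.
assert (hp11 : p1 <= 1).
  apply Rmult_le_reg_r with (1 - p2); [lra|]; unfold p1.
  replace ((p - p2) / (1 - p2) * (1 - p2)) with (p - p2) by (field; lra); lra.
set (c := tau / 500).
assert (hc0 : 0 < c) by (unfold c; lra).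
destruct (nat_floor (D / 100)) as [a [ha1 ha2]]; [lra|].
destruct (nat_between (8 * lam + l ^ 2)) as [m [hm1 hm2]]; [simpl; nra|].
exists p1, p2, c, a, m; cbv zeta.
assert (ha0 : D / 200 <= INR a) by lra.
assert (hap : INR a * p2 <= 1 / 200).
  apply Rle_trans with (D / 100 * p2); [apply Rmult_le_compat_r; lra|].
  replace (D / 100 * p2) with (p2 * D / 100) by field; lra.
assert (hpw : forall b : nat, (b <= a)%nat -> 9 / 10 <= (1 - p2) ^ b).
  intros b hb; apply Rle_trans with (1 - INR b * p2); [|apply one_minus_pow_ge; lra].
  assert (INR b * p2 <= INR a * p2) by (apply Rmult_le_compat_r; [lra | apply le_INR; exact hb]); lra.
split; [split; [lra|split; [lra|exact hpE]]|].
split; [split; [|unfold c; lra]|].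
  unfold c; apply Rle_div; [lra|]; apply Rle_trans with (exp (- (2 / 100 * l))); [|exact ht0].
  replace (- (2 / 100 * l)) with (- (l / 20) + 3 / 100 * l) by field; rewrite exp_plus.
  apply Rmult_le_compat_l; [left; apply exp_pos|].
  assert (h := H3 l); simpl in h; rewrite Rmult_1_r in h; apply h; lra.
split; [split|].
- apply Rle_trans with (9 / 10); [unfold c; lra | apply hpw; lia].
- rewrite <- Rmult_assoc.
  apply Rle_trans with (tau / 400 * (9 / 10)); [unfold c; lra|].
  apply Rmult_le_compat; [lra | lra | | apply hpw; lia].
  apply Rle_trans with (D / 200 * p2); [|apply Rmult_le_compat_r; lra].
  replace (D / 200 * p2) with (p2 * D / 200) by field; lra.
- split; [exact hm1|]; split.
  + intros i m0 h hi hm0 hnh.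
    assert (hl2 : 0 < l ^ 2) by (apply pow_lt; lra).
    set (kap := INR (8 * m + 2)).
    assert (hkap : kap <= 146 * l ^ 2 * (1 + lam)).
      unfold kap; rewrite plus_INR, mult_INR.
      replace (INR 8) with 8 by (simpl; lra); replace (INR 2) with 2 by (simpl; lra).
      assert (1 <= l ^ 2) by (simpl; nra).
      assert (lam <= l ^ 2 * lam) by nra.
      fold lam in hm2; lra.
    assert (hkap0 : 0 <= kap) by apply pos_INR.
    assert (hi2 : INR i ^ 2 <= 8000 ^ 4 * 500 ^ 8 * (l ^ 4 * (/ tau) ^ 8)).
      apply Rle_trans with (((8000 * l / c ^ 2) ^ 2) ^ 2); [apply pow_incr; split; [apply pos_INR | exact hi]|].
      apply Req_le; unfold c; field; lra.
    (* The factor tau^(-8) comes from [i ^ 2]. If n p^2 >= 1, this is where p <= n^(-0.05) is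
       needed; otherwise 1 / tau <= n^(0.02), which is small against D >= n^(0.49). *)
    assert (key : (1 + lam) * (/ tau) ^ 8 <= 2 * D * exp (- (l / 20))).
    { destruct (Rle_dec 1 lam) as [h1|h1].
      * assert (et : tau = 1) by (unfold tau; apply Rmin_left; exact h1).
        rewrite et, Rinv_1, pow1; rewrite hlam in *.
        assert (D * p <= D * exp (- (l / 20))) by (apply Rmult_le_compat_l; lra); lra.
      * apply Rle_trans with (2 * exp (16 / 100 * l)).
          apply Rmult_le_compat; [lra | apply pow_le; lra | lra |].
          replace (exp (16 / 100 * l)) with (exp (2 / 100 * l) ^ 8) by (rewrite exp_INR; f_equal; simpl; field).
          apply pow_incr; lra.
        rewrite Rmult_assoc; apply Rmult_le_compat_l; [lra|].
        apply Rle_trans with (exp (49 / 100 * l) * exp (- (l / 20))).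
          rewrite <- exp_plus; apply exp_le; lra.
        apply Rmult_le_compat_r; [left; apply exp_pos | exact hD]. }
    assert (hm0' : INR m0 <= D / 25).
      rewrite hm0, plus_INR, !mult_INR, pow_INR; fold kap.
      replace (INR 14) with 14 by (simpl; lra); replace (INR 2) with 2 by (simpl; lra).
      assert (14 * INR i ^ 2 * kap <= D / 50); [|lra].
      apply Rle_trans with (14 * (8000 ^ 4 * 500 ^ 8 * (l ^ 4 * (/ tau) ^ 8)) * (146 * l ^ 2 * (1 + lam))).
        apply Rmult_le_compat; [|exact hkap0| |exact hkap].
          apply Rmult_le_pos; [lra | apply pow2_ge_0].
        apply Rmult_le_compat_l; [lra | exact hi2].
      replace (14 * (8000 ^ 4 * 500 ^ 8 * (l ^ 4 * (/ tau) ^ 8)) * (146 * l ^ 2 * (1 + lam)))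
        with (C1 / 100 * l ^ 6 * ((1 + lam) * (/ tau) ^ 8)) by (unfold C1; field; lra).
      apply Rle_trans with (C1 / 100 * l ^ 6 * (2 * D * exp (- (l / 20)))).
        apply Rmult_le_compat_l; [|exact key].
        apply Rmult_le_pos; [unfold C1; lra | apply pow_le; lra].
      assert (h1 : C1 * l ^ 6 <= exp (1 / 20 * l)) by (apply H1; lra).
      replace (C1 / 100 * l ^ 6 * (2 * D * exp (- (l / 20))))
        with (D / 50 * (C1 * l ^ 6 * exp (- (l / 20)))) by field.
      replace (D / 50) with (D / 50 * 1) at 2 by ring.
      apply Rmult_le_compat_l; [lra|].
      apply Rle_trans with (exp (1 / 20 * l) * exp (- (l / 20))).
        apply Rmult_le_compat_r; [left; apply exp_pos | exact h1].
      rewrite <- exp_plus; replace (1 / 20 * l + - (l / 20)) with 0 by field; rewrite exp_0; lra.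
    apply Rle_trans with (exp (- (INR h * (p1 / 2))) * exp (INR m0 * (3 / 4))).
      apply Rmult_le_compat; [apply pow_le; lra | apply pow_le; lra | |].
        replace (1 - p1 + p1 * / 2) with (1 - p1 / 2) by field; apply one_minus_pow; lra.
      rewrite <- exp_INR; apply pow_incr; split; [lra|].
      left; rewrite <- (exp_ln 2) by lra; apply exp_increasing, ln2_lt.
    rewrite <- exp_plus; apply exp_le.
    assert (hh : 49 / 100 * N <= INR h).
      assert (e : N = INR h + INR h + 1) by (unfold N; rewrite hnh, S_INR, plus_INR; ring); lra.
    assert (49 / 100 * N * (p / 4) <= INR h * (p1 / 2)).
      apply Rmult_le_compat; lra.
    replace (49 / 100 * N * (p / 4)) with (49 / 400 * D) in H by (unfold D; field).
    fold D; lra.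
  + apply Rle_trans with (exp 2 * exp (32000 * l ^ 2 / c ^ 2) * exp (- (D / 20))).
      apply Rmult_le_compat_r; [left; apply exp_pos|]; apply Rmult_le_compat_r; [left; apply exp_pos|].
      generalize (exp_ineq1_le 2); lra.
    rewrite <- !exp_plus; apply exp_le.
    assert (h1 : 32000 * l ^ 2 / c ^ 2 <= C2 * l ^ 2 * exp (4 / 100 * l)).
      replace (32000 * l ^ 2 / c ^ 2) with (C2 * l ^ 2 * (/ tau) ^ 2) by (unfold C2, c; field; lra).
      apply Rmult_le_compat_l; [apply Rmult_le_pos; [unfold C2; lra | apply pow2_ge_0]|].
      replace (exp (4 / 100 * l)) with (exp (2 / 100 * l) ^ 2) by (rewrite exp_INR; f_equal; simpl; field).
      apply pow_incr; lra.
    assert (h2 : (C2 + 3) * 20 * l ^ 2 <= exp (45 / 100 * l)) by (apply H2; lra).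
    assert (h3 : (C2 + 3) * 20 * l ^ 2 * exp (4 / 100 * l) <= D).
      apply Rle_trans with (exp (45 / 100 * l) * exp (4 / 100 * l)).
        apply Rmult_le_compat_r; [left; apply exp_pos | exact h2].
      rewrite <- exp_plus; replace (45 / 100 * l + 4 / 100 * l) with (49 / 100 * l) by field; exact hD.
    assert (h4 : 1 <= exp (4 / 100 * l)) by (apply exp_ge1; lra).
    assert (h5 : 1 <= l ^ 2) by (simpl; nra).
    assert (h6 : l ^ 2 <= l ^ 2 * exp (4 / 100 * l)) by nra.
    replace ((C2 + 3) * 20 * l ^ 2 * exp (4 / 100 * l))
      with (20 * (C2 * l ^ 2 * exp (4 / 100 * l)) + 60 * (l ^ 2 * exp (4 / 100 * l))) in h3 by ring.
    lra.
Qed.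

(** The four terms bound the failure of low codegrees, an excess of additive collisions, the union
    over subgroups and the union over group automorphisms. The last two cost n^L <= exp (2 l^2 + l),
    which n p >= 44 l^2 pays for: up to lower order the gains are 3/20 n p and 297/4000 n p. *)
Lemma sparse_numerics : exists l0, 4 <= l0 /\ forall (n : nat) (l p : R),
  INR n = exp l -> l0 <= l -> 44 * l ^ 2 <= INR n * p -> 0 <= p <= exp (- (51 / 100 * l)) ->
  exists m1 m2 : nat, let kap := (8 * m1 + 2)%nat in
   forall (F1 F2 : R) (L h2 h3 a : nat),
   a = (m2 * (3 * (6 * kap)) + 2 * kap + 2)%nat ->
   1 <= F1 -> (INR m2 / exp 1) ^ m2 <= F2 -> INR L <= 2 * l + 1 ->
   2 * INR n <= 5 * (INR h2 + 1) -> 3 * INR n <= 40 * (INR h3 + 1) ->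
   2 * (INR n * ((INR n * p ^ 2) ^ m1 / F1)) + INR n * ((INR n ^ 2 * p ^ 3) ^ m2 / F2) +
   INR n ^ L * ((1 - p + p * / 2) ^ h2 / (/ 2) ^ a) + INR n ^ L * (1 - p * (1 - p)) ^ h3
   <= exp (- (l ^ 2 / 40000)).
Proof.
destruct (poly_exp 240 1 (1 / 100)) as [x1 [hx1 H1]]; [lra|].
exists (1000000 + x1); split; [lra|].
intros n l p hn hl hD [hp0 hp].
assert (hl1 : 1000000 <= l) by lra.
set (N := INR n) in *; set (D := N * p) in *.
assert (hN : 0 < N) by (rewrite hn; apply exp_pos).
assert (hll : 1000000 * l <= l ^ 2) by (simpl; nra).
assert (hp3 : p <= 1 / 100).
  apply Rle_trans with (1 := hp); rewrite exp_Ropp; apply Rle_trans with (/ 100); [|lra].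
  apply Rinv_le_contravar; [lra|]; generalize (exp_ineq1_le (51 / 100 * l)); lra.
assert (hpp : 0 < p).
  destruct hp0 as [h|h]; [exact h|]; exfalso; unfold D in hD; rewrite <- h in hD; lra.
assert (hlam : N * p ^ 2 <= exp (- (2 / 100 * l))).
  replace (- (2 / 100 * l)) with (l + - (51 / 100 * l) + - (51 / 100 * l)) by field.
  rewrite !exp_plus, <- hn; replace (N * p ^ 2) with (N * p * p) by ring.
  apply Rmult_le_compat; [apply Rmult_le_pos; lra | lra | | exact hp].
  apply Rmult_le_compat_l; lra.
assert (hlam0 : 0 < N * p ^ 2) by (apply Rmult_lt_0_compat; [exact hN | apply pow_lt; exact hpp]).
(* A multiple of l suffices for m1, since (n p^2)^m1 <= n^(-0.02 m1), and it keeps kap below l / 10.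
   Then m2 is chosen so that 18 m2 kap, the main part of a, stays below n p / 20. *)
destruct (nat_floor (l / 100)) as [m1 [hm1 hm1']]; [lra|].
set (K := INR (8 * m1 + 2)).
assert (hK : K = 8 * INR m1 + 2).
  unfold K; rewrite plus_INR, mult_INR; simpl INR; ring.
assert (hK1 : 2 <= K <= l / 10) by (generalize (pos_INR m1); lra).
destruct (nat_floor (D / (400 * K))) as [m2 [hm2 hm2']].
  apply Rmult_le_pos; [lra | left; apply Rinv_0_lt_compat; lra].
exists m1, m2; cbv zeta; intros F1 F2 L h2 h3 a ea hF1 hF2 hL hh2 hh3.
assert (hm2K : INR m2 * K <= D / 400).
  apply Rmult_le_compat_r with (r := K) in hm2; [|lra].
  replace (D / (400 * K) * K) with (D / 400) in hm2 by (field; lra); exact hm2.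
assert (hm2K' : D / 400 < (INR m2 + 1) * K).
  apply Rmult_lt_compat_r with (r := K) in hm2'; [|lra].
  replace (D / (400 * K) * K) with (D / 400) in hm2' by (field; lra); exact hm2'.
assert (hm2l : l <= INR m2).
  assert (44 * l ^ 2 / 400 < (INR m2 + 1) * (l / 10)).
    apply Rlt_le_trans with ((INR m2 + 1) * K); [lra|].
    apply Rmult_le_compat_l; [generalize (pos_INR m2); lra | lra].
  assert (11 / 10 * l * (l / 10) < (INR m2 + 1) * (l / 10)) by (simpl in *; lra).
  assert (11 / 10 * l < INR m2 + 1) by (apply Rmult_lt_reg_r with (l / 10); lra).
  lra.
assert (hm2D : D / 800 <= INR m2 * K).
  assert (1 * K <= INR m2 * K) by (apply Rmult_le_compat_r; lra); lra.
assert (ha : INR a <= D / 20).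
  rewrite ea, !plus_INR, !mult_INR; fold K; simpl (INR 3); simpl (INR 6); simpl (INR 2); lra.
assert (hNL : N ^ L <= exp (2 * l ^ 2 + l)).
  rewrite hn, exp_INR; apply exp_le.
  assert (INR L * l <= (2 * l + 1) * l) by (apply Rmult_le_compat_r; lra); simpl; lra.
assert (hNL0 : 0 <= N ^ L) by (apply pow_le; lra).
assert (E0 : forall x y, x <= - (2 * y) -> 200 <= y -> exp x <= exp (- y) / 8).
  intros x y h1 h2'; apply Rle_trans with (exp (- y) * exp (- y)).
    rewrite <- exp_plus; apply exp_le; lra.
  unfold Rdiv; apply Rmult_le_compat_l; [left; apply exp_pos|].
  rewrite exp_Ropp; apply Rinv_le_contravar; [lra|]; generalize (exp_ineq1_le y); lra.
assert (hy : 200 <= l ^ 2 / 40000) by lra.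
assert (T1 : N * ((N * p ^ 2) ^ m1 / F1) <= exp (- (l ^ 2 / 40000)) / 8).
  apply Rle_trans with (exp (l + INR m1 * - (2 / 100 * l))).
    rewrite exp_plus, <- hn, <- exp_INR; apply Rmult_le_compat_l; [lra|].
    apply Rle_trans with ((N * p ^ 2) ^ m1 / 1).
      apply Rmult_le_compat_l; [apply pow_le; lra | apply Rinv_le_contravar; lra].
    unfold Rdiv; rewrite Rinv_1, Rmult_1_r; apply pow_incr; lra.
  apply E0; [|exact hy].
  assert ((l / 100 - 1) * l <= INR m1 * l) by (apply Rmult_le_compat_r; lra).
  replace ((l / 100 - 1) * l) with (l ^ 2 / 100 - l) in H by (simpl; field); lra.
assert (T2 : N * ((N ^ 2 * p ^ 3) ^ m2 / F2) <= exp (- (l ^ 2 / 40000)) / 8).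
  apply Rle_trans with (exp (l + INR m2 * - (1 / 100 * l))).
    rewrite exp_plus, <- hn, <- exp_INR; apply Rmult_le_compat_l; [lra|].
    assert (hx0 : 0 <= N ^ 2 * p ^ 3) by (apply Rmult_le_pos; apply pow_le; lra).
    apply Rle_trans with ((3 * (N ^ 2 * p ^ 3) / INR m2) ^ m2).
      apply div_fact_le; [exact hx0 | exact hF2 | apply INR_lt; simpl; lra].
    apply pow_incr; split.
      apply Rmult_le_pos; [lra | left; apply Rinv_0_lt_compat; lra].
    apply Rle_trans with (240 * l * exp (- (2 / 100 * l))).
      apply Rmult_le_reg_r with (INR m2); [lra|].
      replace (3 * (N ^ 2 * p ^ 3) / INR m2 * INR m2) with (3 * (N * p ^ 2) * D) by (unfold D; field; lra).
      apply Rle_trans with (3 * exp (- (2 / 100 * l)) * (80 * l * INR m2)); [|right; ring].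
      apply Rmult_le_compat; [lra | lra | lra |].
      assert (INR m2 * K <= INR m2 * (l / 10)) by (apply Rmult_le_compat_l; lra); lra.
    apply Rle_trans with (exp (1 / 100 * l) * exp (- (2 / 100 * l))).
      apply Rmult_le_compat_r; [left; apply exp_pos|].
      assert (h := H1 l); simpl in h; rewrite Rmult_1_r in h; apply h; lra.
    rewrite <- exp_plus; apply exp_le; lra.
  apply E0; [|exact hy].
  assert (l * l <= INR m2 * l) by (apply Rmult_le_compat_r; lra).
  simpl in *; lra.
assert (T3 : N ^ L * ((1 - p + p * / 2) ^ h2 / (/ 2) ^ a) <= exp (- (l ^ 2 / 40000)) / 8).
  apply Rle_trans with (exp (2 * l ^ 2 + l) * (exp (- (INR h2 * (p / 2))) * exp (INR a * 1))).
    apply Rmult_le_compat; [exact hNL0 | | exact hNL |].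
      apply Rmult_le_pos; [apply pow_le; lra | left; apply Rinv_0_lt_compat, pow_lt; lra].
    apply Rmult_le_compat; [apply pow_le; lra | left; apply Rinv_0_lt_compat, pow_lt; lra | |].
      replace (1 - p + p * / 2) with (1 - p / 2) by field; apply one_minus_pow; lra.
    rewrite pow_inv, Rinv_inv, <- exp_INR; apply pow_incr; split; [lra|].
    generalize (exp_ineq1_le 1); lra.
  rewrite <- !exp_plus; apply E0; [|exact hy].
  assert ((2 / 5 * N - 1) * (p / 2) <= INR h2 * (p / 2)) by (apply Rmult_le_compat_r; lra).
  replace ((2 / 5 * N - 1) * (p / 2)) with (D / 5 - p / 2) in H by (unfold D; field).
  lra.
assert (T4 : N ^ L * (1 - p * (1 - p)) ^ h3 <= exp (- (l ^ 2 / 40000)) / 8).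
  apply Rle_trans with (exp (2 * l ^ 2 + l) * exp (- (INR h3 * (p * (1 - p))))).
    apply Rmult_le_compat; [exact hNL0 | apply pow_le; nra | exact hNL | apply one_minus_pow; nra].
  rewrite <- !exp_plus; apply E0; [|exact hy].
  assert ((3 / 40 * N - 1) * (99 / 100 * p) <= INR h3 * (p * (1 - p))).
    apply Rmult_le_compat; [| lra | lra | nra].
    assert (N >= 100); [|lra]; rewrite hn; generalize (exp_ineq1_le l); lra.
  replace ((3 / 40 * N - 1) * (99 / 100 * p)) with (297 / 4000 * D - 99 / 100 * p) in H by (unfold D; field).
  lra.
generalize (exp_pos (- (l ^ 2 / 40000))); lra.
Qed.

Lemma fact_lower_bound (m : nat) : (INR m / exp 1) ^ m <= INR (fact m).
Proof.
assert (he : 0 < exp 1) by apply exp_pos.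
assert (H : INR m ^ m <= INR (fact m) * exp 1 ^ m).
  induction m as [|m IH]; [simpl; lra|].
  change (fact (S m)) with (S m * fact m)%nat; rewrite mult_INR.
  assert (hs : 0 < INR (S m)) by (apply lt_0_INR; lia).
  replace (INR (S m) ^ S m) with (INR (S m) * INR (S m) ^ m) by (simpl; ring).
  replace (INR (S m) * INR (fact m) * exp 1 ^ S m)
    with (INR (S m) * (INR (fact m) * exp 1 ^ m * exp 1)) by (simpl; ring).
  apply Rmult_le_compat_l; [lra|].
  apply Rle_trans with (INR m ^ m * exp 1); [|apply Rmult_le_compat_r; lra].
  destruct (Nat.eq_dec m 0) as [h0|h0].
    subst m; simpl; generalize (exp_ineq1_le 1); lra.
  assert (hm : 0 < INR m) by (apply lt_0_INR; lia).
  replace (exp 1) with (exp (/ INR m) ^ m) by (rewrite exp_INR; f_equal; field; lra).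
  rewrite <- Rpow_mult_distr; apply pow_incr; split; [lra|].
  rewrite S_INR; replace (INR m + 1) with (INR m * (1 + / INR m)) by (field; lra).
  apply Rmult_le_compat_l; [lra|]; apply exp_ineq1_le.
unfold Rdiv; rewrite Rpow_mult_distr, pow_inv.
apply Rmult_le_reg_r with (exp 1 ^ m); [apply pow_lt; exact he|].
rewrite Rmult_assoc, Rinv_l, Rmult_1_r; [exact H|apply pow_nonzero; lra].
Qed.

Lemma density_lower_bound (l p : R) :
  25 * (l / ln 2) ^ 2 / exp l <= p -> 44 * l ^ 2 <= exp l * p.
Proof.
intros h; assert (he := exp_pos l); assert (h2 := ln2_lt); assert (h3 := ln_lt_2).
assert (h4 : 25 * (l / ln 2) ^ 2 <= exp l * p).
  apply Rmult_le_compat_l with (r := exp l) in h; [|lra].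
  replace (exp l * (25 * (l / ln 2) ^ 2 / exp l)) with (25 * (l / ln 2) ^ 2) in h by (field; lra).
  exact h.
apply Rle_trans with (2 := h4).
assert (h5 : l = l / ln 2 * ln 2) by (field; lra).
set (x := l / ln 2) in *; rewrite h5.
replace ((x * ln 2) ^ 2) with (x ^ 2 * ln 2 ^ 2) by ring.
assert (h6 : ln 2 ^ 2 <= 9 / 16) by (simpl; nra).
assert (h7 : 0 <= x ^ 2) by (simpl; nra).
nra.
Qed.

(** After complementation 1 - p takes the place of p. The hypothesis gives 1 - p >= n^(-2/3), and
    n^(1/3) exceeds any power of log n. *)
Lemma codensity_lower_bound : exists l0, forall l q : R, l0 <= l ->
  Rpower (10 * (l / ln 2) / exp l) (2 / 3) <= q -> 44 * l ^ 2 <= exp l * q.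
Proof.
destruct (poly_exp 44 2 (1 / 3)) as [l0 [h0 H]]; [lra|].
exists l0; intros l q hl hq; assert (he := exp_pos l); assert (h2 := ln2_lt); assert (h3 := ln_lt_2).
assert (hx : 1 <= 10 * (l / ln 2)).
  assert (h4 : 0 < / ln 2) by (apply Rinv_0_lt_compat; lra).
  assert (h5 : 1 <= / ln 2) by (rewrite <- Rinv_1; apply Rinv_le_contravar; lra).
  unfold Rdiv; nra.
assert (hy : exp (- l) <= 10 * (l / ln 2) / exp l).
  rewrite exp_Ropp; unfold Rdiv at 1; rewrite <- (Rmult_1_l (/ exp l)) at 1.
  apply Rmult_le_compat_r; [left; apply Rinv_0_lt_compat; lra|exact hx].
assert (hz : exp (- (2 / 3 * l)) <= q).
  apply Rle_trans with (2 := hq).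
  apply Rle_trans with (Rpower (exp (- l)) (2 / 3)).
    unfold Rpower; rewrite ln_exp; apply exp_le; lra.
  apply Rle_Rpower_l; [lra|]; split; [apply exp_pos|exact hy].
apply Rle_trans with (1 := H l hl).
replace (1 / 3 * l) with (l + - (2 / 3 * l)) by field; rewrite exp_plus.
apply Rmult_le_compat_l; lra.
Qed.

Lemma empty_bound (l p : R) (n h : nat) : 1 <= l -> INR n = exp l -> 0 <= p <= 1 ->
  44 * l ^ 2 <= INR n * p -> n = S (h + h) -> (1 - p) ^ h <= exp (- l ^ 2).
Proof.
intros hl hn hp hD hh; apply Rle_trans with (1 := one_minus_pow h p ltac:(lra)); apply exp_le.
rewrite hh, S_INR, plus_INR in hD; assert (h1 : 1 <= l ^ 2) by (simpl; nra); lra.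
Qed.

Lemma middle_total (l : R) : 4 <= l ->
  exp (- (l ^ 2 / 4)) + (exp (- l ^ 2) + exp (- l ^ 2)) <= 3 * exp (- (l ^ 2 / 40000)).
Proof.
intros hl; assert (h : 16 <= l ^ 2) by (simpl; nra).
assert (h1 : exp (- (l ^ 2 / 4)) <= exp (- (l ^ 2 / 40000))) by (apply exp_le; lra).
assert (h2 : exp (- l ^ 2) <= exp (- (l ^ 2 / 40000))) by (apply exp_le; lra).
lra.
Qed.

(** Since 1 / ln 2 <= 2, the right side is at least exp (- l^2 / 100000); for l >= 400 the gap to
    l^2 / 40000 exceeds 2, which covers the factor 4. *)
Lemma final_total (l : R) : 400 <= l ->
  3 * exp (- (l ^ 2 / 40000)) + exp (- l ^ 2) <= Rpower (exp l) (- (1 / 200000 * (l / ln 2))).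
Proof.
intros hl; assert (h : 160000 <= l ^ 2) by (simpl; nra).
assert (h3 := ln_lt_2).
assert (h2 : exp (- l ^ 2) <= exp (- (l ^ 2 / 40000))) by (apply exp_le; lra).
apply Rle_trans with (4 * exp (- (l ^ 2 / 40000))); [lra|].
apply Rle_trans with (exp 2 * exp (- (l ^ 2 / 40000))).
  apply Rmult_le_compat_r; [left; apply exp_pos|].
  replace 2 with (1 + 1) by ring; rewrite exp_plus; generalize (exp_ineq1_le 1); nra.
unfold Rpower; rewrite <- exp_plus, ln_exp; apply exp_le.
assert (h4 : / ln 2 <= 2) by (replace 2 with (/ / 2) at 2 by field; apply Rinv_le_contravar; lra).
replace (- (1 / 200000 * (l / ln 2)) * l) with (- (1 / 200000 * (l ^ 2 * / ln 2))) by (field; lra).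
assert (h5 : l ^ 2 * / ln 2 <= l ^ 2 * 2) by (apply Rmult_le_compat_l; lra).
lra.
Qed.

End RealEstimates.

Require Import Defs.
From HB Require Import structures.
From mathcomp Require Import all_boot all_order all_algebra all_fingroup.
From mathcomp Require Import cyclic Rstruct ring lra zify.

Set Implicit Arguments.
Unset Strict Implicit.
Unset Printing Implicit Defensive.

Import Order.TTheory GRing.Theory Num.Theory.
Local Open Scope ring_scope.

(* Reflexive decision of linear identities over an arbitrary zmodType: an
   expression is compared through its integer coefficients. *)
Inductive zexpr := ZxO | ZxV of nat | ZxA of zexpr & zexpr | ZxN of zexpr.

Fixpoint zx_eval (V : zmodType) (env : seq V) e : V :=
  match e with
  | ZxO => 0 | ZxV i => env`_i
  | ZxA a b => zx_eval env a + zx_eval env b | ZxN a => - zx_eval env a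
  end.

Fixpoint zx_coef e (i : nat) : int :=
  match e with
  | ZxO => 0 | ZxV j => (i == j)%:Z
  | ZxA a b => zx_coef a i + zx_coef b i | ZxN a => - zx_coef a i
  end.

Fixpoint zx_bound e (m : nat) : bool :=
  match e with
  | ZxO => true | ZxV j => (j < m)%N
  | ZxA a b => zx_bound a m && zx_bound b m | ZxN a => zx_bound a m
  end.

Lemma zx_evalE (V : zmodType) (env : seq V) e : zx_bound e (size env) ->
  zx_eval env e = \sum_(i < size env) env`_i *~ zx_coef e i.
Proof.
elim: e => [_|j /= hj|a IHa b IHb /= /andP[/IHa-> /IHb->]|a IHa /= /IHa->].
- by rewrite big1.
- rewrite (bigD1 (Ordinal hj)) //= eqxx mulr1z big1 ?addr0 // => i /negbTE.
  by rewrite -val_eqE /= => ->.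
- by rewrite -big_split; apply: eq_bigr => i _; rewrite mulrzDr.
- by rewrite -sumrN; apply: eq_bigr => i _; rewrite mulrNz.
Qed.

Lemma zx_correct (V : zmodType) (env : seq V) a b :
  [&& zx_bound a (size env), zx_bound b (size env)
    & all (fun i => zx_coef a i == zx_coef b i) (iota 0 (size env))] ->
  zx_eval env a = zx_eval env b.
Proof.
case/and3P=> ba bb /allP h; rewrite !zx_evalE //; apply: eq_bigr => i _.
by rewrite (eqP (h _ _)) // mem_iota add0n /=.
Qed.

Ltac zx_find x l :=
  match l with
  | x :: _ => constr:(O)
  | _ :: ?t => let k := zx_find x t in constr:(S k)
  end.
Ltac zx_mem x l :=
  match l with
  | nil => constr:(false) | x :: _ => constr:(true) | _ :: ?t => zx_mem x t
  end.
Ltac zx_vars e l :=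
  lazymatch e with
  | 0%R => l
  | (?a + ?b)%R => let l' := zx_vars a l in zx_vars b l'
  | (- ?a)%R => zx_vars a l
  | _ => lazymatch zx_mem e l with true => l | false => constr:(e :: l) end
  end.
Ltac zx_reify e l :=
  lazymatch e with
  | 0%R => constr:(ZxO)
  | (?a + ?b)%R => let a' := zx_reify a l in let b' := zx_reify b l in constr:(ZxA a' b')
  | (- ?a)%R => let a' := zx_reify a l in constr:(ZxN a')
  | _ => let k := zx_find e l in constr:(ZxV k)
  end.
Ltac zmod :=
  cbv beta;
  lazymatch goal with
  | |- @eq ?T ?a ?b =>
    let l0 := constr:(@nil T) in
    let l1 := zx_vars a l0 in let l := zx_vars b l1 in
    let a' := zx_reify a l in let b' := zx_reify b l in
    exact (@zx_correct _ l a' b' isT)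
  end.

(* Closes [a = b] from [H : c = d] when [a - b] is [c - d] or its opposite. *)
Ltac zmod_from H :=
  apply/eqP; rewrite -subr_eq0; apply/eqP;
  match type of H with
  | ?c = ?d =>
    let H0 := fresh in
    assert (H0 : c - d = 0); [ by apply/eqP; rewrite subr_eq0; apply/eqP | ];
    first [ transitivity (c - d); [zmod | exact H0]
            | transitivity (- (c - d)); [zmod | by rewrite H0 oppr0] ]
  end.

(** * Bernoulli random subsets *)

Section Bernoulli.
Variables (F : realFieldType) (T : finType).
Implicit Types (p : F) (J X Y : {set T}) (h : {set T} -> F).

(** Expectation at the random subset of [J] that contains each element independently with
    probability [p]. Its Fubini theorem [bexp_split] allows exposing [J] piece by piece. *)
Definition bexp p J h : F :=
  \sum_(X : {set T} | X \subset J) p ^+ #|X| * (1 - p) ^+ #|J :\: X| * h X.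

Definition bprob p J (E : pred {set T}) : F := bexp p J (fun X => (E X)%:R).

Lemma bexp0 p h : bexp p set0 h = h set0.
Proof.
rewrite /bexp (big_pred1 set0) => [|X /=]; last by rewrite subset0.
by rewrite setDv cards0 !expr0 !mul1r.
Qed.

Lemma eq_bexp p J h h' : (forall X, X \subset J -> h X = h' X) ->
  bexp p J h = bexp p J h'.
Proof. by move=> hh'; apply: eq_bigr => X /hh' ->. Qed.

Lemma bexp_split p J1 J2 h : [disjoint J1 & J2] ->
  bexp p (J1 :|: J2) h =
  bexp p J1 (fun Y => bexp p J2 (fun Z => h (Y :|: Z))).
Proof.
move=> dis; rewrite /bexp.
under [RHS]eq_bigr do rewrite big_distrr /=.
rewrite pair_big /=.
rewrite (reindex_onto (fun YZ : {set T} * {set T} => YZ.1 :|: YZ.2)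
  (fun X => (X :&: J1, X :&: J2))) /=; last first.
  by move=> X sX; rewrite -setIUr; apply/setIidPl.
apply: eq_big => [[Y Z]|[Y Z]] /=.
  apply/andP/andP => [[sYZ /eqP[<- <-]]|[sY sZ]]; first by rewrite !subsetIr.
  split; first exact: setUSS.
  apply/eqP; congr (_, _); rewrite setIUl.
    rewrite (setIidPl sY); apply/setUidPl/subsetP => x; rewrite inE => /andP[xZ xJ1].
    by case/negP: (negbT (disjointFr dis xJ1)); apply: (subsetP sZ).
  rewrite (setIidPl sZ); apply/setUidPr/subsetP => x; rewrite inE => /andP[xY xJ2].
  by case/negP: (negbT (disjointFl dis xJ2)); apply: (subsetP sY).
move=> /andP[sYZ /eqP[eY eZ]].
have sY : Y \subset J1 by rewrite -eY subsetIr.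
have sZ : Z \subset J2 by rewrite -eZ subsetIr.
have dYZ : [disjoint Y & Z].
  by apply: disjointWl sY _; apply: disjointWr sZ _.
have -> : #|Y :|: Z| = (#|Y| + #|Z|)%N.
  by rewrite cardsU disjoint_setI0 // cards0 subn0.
have -> : (J1 :|: J2) :\: (Y :|: Z) = (J1 :\: Y) :|: (J2 :\: Z).
  apply/setP=> x; rewrite !inE.
  case: (boolP (x \in J1)) => x1 /=.
    have x2 : x \in J2 = false by apply: disjointFr dis x1.
    rewrite x2 andbF orbF andbT negb_or.
    by rewrite (contraFN (subsetP sZ x) x2) andbT.
  by rewrite andbF (negbTE (contra (subsetP sY x) x1)).
have -> : #|(J1 :\: Y) :|: (J2 :\: Z)| = (#|J1 :\: Y| + #|J2 :\: Z|)%N.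
  rewrite cardsU [_ :&: _]disjoint_setI0 ?cards0 ?subn0 //.
  by apply: disjointWl (subsetDl _ _) _; apply: disjointWr (subsetDl _ _) _.
by rewrite !exprD; ring.
Qed.

Lemma bexp1 p x h : bexp p [set x] h = (1 - p) * h set0 + p * h [set x].
Proof.
rewrite /bexp (bigD1 set0) ?sub0set //= (bigD1 [set x]) /=; last first.
  by rewrite subxx; apply/set0Pn; exists x; rewrite set11.
rewrite big1 => [|X]; last first.
  by rewrite subset1 => /andP[/andP[/orP[->|->]]] //; rewrite andbF.
by rewrite cards0 setD0 cards1 setDv cards0 !expr0 !expr1 mul1r mulr1 addr0.
Qed.

Lemma bexp_cons p x J h : x \notin J ->
  bexp p (x |: J) h =
  (1 - p) * bexp p J h + p * bexp p J (fun X => h (x |: X)).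
Proof.
move=> xJ; rewrite bexp_split ?disjoints1 // bexp1.
by congr (_ * _ + _); apply: eq_bexp => X _; rewrite set0U.
Qed.

Lemma set_cons_ind (P : {set T} -> Prop) :
  P set0 -> (forall x J, x \notin J -> P J -> P (x |: J)) -> forall J, P J.
Proof.
move=> P0 PS J; move: {2}#|J| (erefl #|J|) => m; elim: m J => [|m IH] J.
  by move/eqP; rewrite cards_eq0 => /eqP->.
move=> cJ; have /set0Pn[x xJ] : J != set0 by rewrite -cards_eq0 cJ.
rewrite -(setD1K xJ); apply: PS; first by rewrite !inE eqxx.
by apply: IH; move: cJ; rewrite (cardsD1 x) xJ => -[].
Qed.

Lemma bexp_const p J (a : F) : bexp p J (fun=> a) = a.
Proof.
elim/set_cons_ind: J => [|x J xJ IH]; first by rewrite bexp0.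
by rewrite bexp_cons // IH; ring.
Qed.

Lemma bexpD p J h h' : bexp p J (fun X => h X + h' X) = bexp p J h + bexp p J h'.
Proof. by rewrite /bexp -big_split; apply: eq_bigr => X _; rewrite mulrDr. Qed.

Lemma bexpZ p J (a : F) h : bexp p J (fun X => a * h X) = a * bexp p J h.
Proof. by rewrite /bexp big_distrr; apply: eq_bigr => X _ /=; ring. Qed.

Lemma bexp_sum p J (I : finType) (Q : pred I) (h : I -> {set T} -> F) :
  bexp p J (fun X => \sum_(i | Q i) h i X) = \sum_(i | Q i) bexp p J (h i).
Proof.
rewrite /bexp; under eq_bigr do rewrite big_distrr /=.
by rewrite exchange_big.
Qed.

Section Prob.
Variable p : F.
Hypotheses (p0 : 0 <= p) (p1 : p <= 1).

Lemma ler_bexp J h h' : (forall X, X \subset J -> h X <= h' X) ->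
  bexp p J h <= bexp p J h'.
Proof.
move=> hh'; apply: ler_sum => X sX; apply: ler_wpM2l (hh' _ sX).
by rewrite mulr_ge0 ?exprn_ge0 // subr_ge0.
Qed.

Lemma bexp_ge0 J h : (forall X, X \subset J -> 0 <= h X) -> 0 <= bexp p J h.
Proof. by move=> h0; rewrite -(bexp_const p J 0); apply: ler_bexp. Qed.

Lemma bprob_le1 J E : bprob p J E <= 1.
Proof. by rewrite -(bexp_const p J 1); apply: ler_bexp => X _; rewrite lern1 leq_b1. Qed.

Lemma ler_bprob J (E E' : pred {set T}) :
  (forall X, X \subset J -> E X -> E' X) -> bprob p J E <= bprob p J E'.
Proof.
move=> EE'; apply: ler_bexp => X sX; rewrite ler_nat.
by case: (boolP (E X)) => // /(EE' _ sX) ->.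
Qed.

Lemma bprobC J (E : pred {set T}) : bprob p J E = 1 - bprob p J (fun X => ~~ E X).
Proof.
apply/eqP; rewrite eq_sym subr_eq -bexpD; apply/eqP.
rewrite -[LHS](bexp_const p J 1); apply: eq_bexp => X _.
by case: (E X); rewrite /= ?addr0 ?add0r.
Qed.

Lemma bprobU J (E1 E2 : pred {set T}) :
  bprob p J (fun X => E1 X || E2 X) <= bprob p J E1 + bprob p J E2.
Proof.
by rewrite -bexpD; apply: ler_bexp => X _; rewrite -natrD ler_nat; case: (E1 X); case: (E2 X).
Qed.

Lemma bprob_union J (I : finType) (Q : pred I) (E : I -> pred {set T}) (b : F) :
  (forall i, Q i -> bprob p J (E i) <= b) ->
  bprob p J (fun X => [exists i, Q i && E i X]) <= #|Q|%:R * b.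
Proof.
move=> Eb; apply: (@le_trans _ _ (\sum_(i | Q i) bprob p J (E i))).
  rewrite -bexp_sum; apply: ler_bexp => X _.
  case: existsP => [[i /andP[Qi EiX]]|_]; last by apply: sumr_ge0 => i _; apply: ler0n.
  by rewrite (bigD1 i) //= EiX lerDl; apply: sumr_ge0 => j _; apply: ler0n.
apply: (@le_trans _ _ (\sum_(i | Q i) b)); first exact: ler_sum.
by rewrite sumr_const mulr_natl.
Qed.

Lemma bprob_subset J (G : {set T}) : G \subset J -> bprob p J (fun X : {set T} => G \subset X) = p ^+ #|G|.
Proof.
elim/set_cons_ind: G J => [|x G xG IH] J sGJ.
  rewrite cards0 expr0 -[RHS](bexp_const p J 1).
  by apply: eq_bexp => X _; rewrite sub0set.
have xJ : x \in J by apply: (subsetP sGJ); rewrite !inE eqxx.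
rewrite /bprob -(setD1K xJ) bexp_cons ?inE ?eqxx //.
rewrite (@eq_bexp _ _ _ (fun=> 0)) => [|X sX]; last first.
  rewrite subUset sub1set; case: (boolP (x \in X)) => // /(subsetP sX).
  by rewrite !inE eqxx.
rewrite bexp_const mulr0 add0r cardsU1 xG exprD expr1 -(IH (J :\ x)).
  congr (_ * _); apply: eq_bexp => X sX; rewrite subUset sub1set !inE eqxx /=.
  congr (nat_of_bool _)%:R; apply/subsetP/subsetP => H y yG; last by rewrite inE H ?orbT.
  by move: (H _ yG); rewrite !inE => /orP[/eqP yx|//]; rewrite -yx yG in xG.
by apply/subsetP => y yG; rewrite !inE (memPn xG) //= (subsetP sGJ) // inE yG orbT.
Qed.

Lemma bexp_expn_card J (z : F) : bexp p J (fun X : {set T} => z ^+ #|X|) = (1 - p + p * z) ^+ #|J|.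
Proof.
elim/set_cons_ind: J => [|x J xJ IH]; first by rewrite bexp0 !cards0.
rewrite bexp_cons // cardsU1 xJ exprS IH.
rewrite (@eq_bexp _ _ _ (fun X : {set T} => z * z ^+ #|X|)) => [|X sX]; last first.
  by rewrite cardsU1 (contra (subsetP sX x) xJ) exprS.
by rewrite bexpZ IH; ring.
Qed.

(** Markov's inequality for [z ^+ #|X|]. *)
Lemma bprob_card_le J (z : F) (a : nat) : 0 < z <= 1 ->
  bprob p J (fun X : {set T} => #|X| <= a)%N * z ^+ a <= (1 - p + p * z) ^+ #|J|.
Proof.
move=> /andP[z0 z1]; rewrite -bexp_expn_card mulrC -bexpZ.
apply: ler_bexp => X _; case: leqP => h; rewrite ?mulr1 ?mulr0 ?exprn_ge0 ?(ltW z0) //.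
by apply: ler_wiXn2l; rewrite // ltW.
Qed.

End Prob.

Lemma bexp_marginal p J1 J h : J1 \subset J ->
  (forall X, X \subset J -> h X = h (X :&: J1)) -> bexp p J h = bexp p J1 h.
Proof.
move=> s1 hh; have -> : J = J1 :|: (J :\: J1) by rewrite -[LHS](setID J J1) (setIidPr s1).
rewrite bexp_split; last by rewrite -setI_eq0 setIDA setDIl setDv set0I.
apply: eq_bexp => Y sY; rewrite -[RHS](bexp_const p (J :\: J1)).
apply: eq_bexp => Z sZ; rewrite hh; last first.
  by rewrite subUset (subset_trans sY s1) (subset_trans sZ) ?subsetDl.
congr h; rewrite setIUl (setIidPl sY); apply/setUidPl.
apply/subsetP => x; rewrite inE => /andP[/(subsetP sZ)].
by rewrite inE => /andP[/negbTE->].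
Qed.

(** Two-round exposure: an element is absent from the union exactly when both rounds miss it. *)
Lemma bexp_sprinkle p p1 p2 J h : 1 - p = (1 - p1) * (1 - p2) ->
  bexp p J h = bexp p1 J (fun X => bexp p2 J (fun Y => h (X :|: Y))).
Proof.
move=> pE; elim/set_cons_ind: J h => [|x J xJ IH] h; first by rewrite !bexp0 setU0.
rewrite !bexp_cons //.
rewrite (@eq_bexp p1 J _ (fun X =>
   (1 - p2) * bexp p2 J (fun Y => h (X :|: Y)) + p2 * bexp p2 J (fun Y => h (x |: (X :|: Y))))); last first.
  move=> X sX; rewrite bexp_cons //; congr (_ + _ * _); apply: eq_bexp => Y _.
  by rewrite setUCA.
rewrite [X in _ = _ + _ * X](@eq_bexp p1 J _ (fun X => bexp p2 J (fun Y => h (x |: (X :|: Y))))); last first.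
  move=> X sX; rewrite bexp_cons //.
  rewrite (@eq_bexp p2 J (fun Y => h (x |: X :|: Y)) (fun Y => h (x |: (X :|: Y)))); last first.
    by move=> Y _; rewrite setUA.
  rewrite (@eq_bexp p2 J (fun Y => h (x |: X :|: (x |: Y))) (fun Y => h (x |: (X :|: Y)))); last first.
    by move=> Y _; rewrite setUACA setUid.
  ring.
rewrite bexpD !bexpZ -!IH -(IH (fun Z => h (x |: Z))).
have -> : p = 1 - (1 - p1) * (1 - p2) by rewrite -pE; ring.
ring.
Qed.

(** An upper-tail tool: m disjoint members all lie in X with probability p^(f m), and there are at
    most N^m / m! choices of them among N. To bound the number of members inside X, one extracts
    disjoint ones greedily first. *)
Lemma bprob_disjoint_family p J (FF : {set {set T}}) (f m : nat) :
  0 <= p -> p <= 1 -> (forall B, B \in FF -> B \subset J /\ #|B| = f) ->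
  bprob p J (fun X => [exists GG : {set {set T}},
     [&& GG \subset FF, #|GG| == m, trivIset GG & [forall B in GG, B \subset X]]])
  <= (#|FF|%:R * p ^+ f) ^+ m / m`!%:R.
Proof.
move=> p0 p1 HF.
apply: (@le_trans _ _ (bprob p J (fun X => [exists GG : {set {set T}},
   [&& GG \subset FF, #|GG| == m & trivIset GG] && (cover GG \subset X)]))).
  apply: ler_bprob => // X _ /existsP[GG /and4P[h1 h2 h3 /forall_inP h4]].
  apply/existsP; exists GG; rewrite h1 h2 h3 /=; apply/bigcupsP => B; exact: h4.
apply: le_trans (bprob_union p0 p1 (b := p ^+ (f * m)) _) _.
  move=> GG /and3P[/subsetP sG /eqP cG tG].
  have sJ : cover GG \subset J by apply/bigcupsP => B /sG /HF[].
  rewrite bprob_subset // -(eqP tG) (eq_bigr (fun=> f)).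
    by rewrite sum_nat_const cG mulnC.
  by move=> B /sG /HF[].
have le1 : (#|[pred GG : {set {set T}} | [&& GG \subset FF, #|GG| == m & trivIset GG]]| <= 'C(#|FF|, m))%N.
  rewrite -cards_draws; apply: subset_leq_card; apply/subsetP => GG.
  by rewrite !inE => /and3P[-> -> _].
have le2 : ('C(#|FF|, m) * m`! <= #|FF| ^ m)%N.
  rewrite bin_ffact; move: #|FF| => N; elim: m N {le1} => [|m IH] N //.
  case: N => [|N]; first by rewrite ffact0n.
  rewrite ffactSS expnS leq_mul2l /=; apply: leq_trans (IH N) _.
  by case: m {IH} => [|m] //; rewrite leq_exp2r.
rewrite ler_pdivlMr ?ltr0n ?fact_gt0 // exprMn -exprM mulrAC ler_wpM2r ?exprn_ge0 //.
rewrite -natrM -natrX ler_nat; apply: leq_trans le2; exact: leq_mul.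
Qed.

End Bernoulli.

(** * Half systems and symmetric connection sets *)

Section HalfSystem.
Variable A : finZmodType.
Hypothesis A6 : coprime #|A| 6.
Implicit Types (x y c d : A) (S X Y : {set A}).

Lemma mulrn_inj_coprime m : coprime #|A| m -> injective (fun x : A => x *+ m).
Proof.
move=> cop x y /eqP; rewrite -subr_eq0 -mulrnBl => /eqP xy0.
apply/eqP; rewrite -subr_eq0; set z := x - y in xy0 *.
have d1 : (#[z]%g %| m)%N by rewrite order_dvdn FinRing.zmodXgE xy0 FinRing.zmod1gE.
have d2 : (#[z]%g %| #|A|)%N by rewrite -cardsT order_dvdG ?inE.
have : (#[z]%g %| 1)%N by rewrite -(eqP cop) dvdn_gcd d1 d2.
by rewrite dvdn1 order_eq1 FinRing.zmod1gE.
Qed.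

Lemma coprime2 : coprime #|A| 2. Proof. by apply: coprime_dvdr A6. Qed.
Lemma coprime3 : coprime #|A| 3. Proof. by apply: coprime_dvdr A6. Qed.

Lemma dbl_inj : injective (fun x : A => x + x).
Proof. by move=> x y /= xy; apply: (mulrn_inj_coprime coprime2); rewrite /= !mulr2n. Qed.

Lemma dbl_eq0 x : (x + x == 0) = (x == 0).
Proof.
by apply/eqP/eqP => [h|->]; rewrite ?addr0 //; apply: dbl_inj; rewrite /= h addr0.
Qed.

Lemma tpl_eq0 x : (x + x + x == 0) = (x == 0).
Proof.
have -> : x + x + x = x *+ 3 by rewrite !mulrS mulr0n addr0 addrA.
apply/eqP/eqP => [h|->]; rewrite ?mul0rn //.
by apply: (mulrn_inj_coprime coprime3); rewrite /= h mul0rn.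
Qed.

Lemma eq_oppr_0 x : (x == - x) = (x == 0).
Proof. by rewrite -addr_eq0 dbl_eq0. Qed.

(* One element of each pair {x, -x}, x <> 0: the one that comes first in the
   enumeration of the type. *)
Definition Hf : {set A} := [set x | (enum_rank x < enum_rank (- x)%R)%N].
(** [rep 0] is 0, which is not in [Hf], so [sym X] avoids 0 whenever X lies in [Hf]. *)
Definition rep x := if x \in Hf then x else - x.
Definition sym X : {set A} := [set x | rep x \in X].

Lemma HfN x : x \in Hf -> - x \notin Hf.
Proof. by rewrite !inE opprK -leqNgt => /ltnW. Qed.

Lemma Hf0 : 0 \notin Hf. Proof. by rewrite inE oppr0 ltnn. Qed.

Lemma HfNN x : x != 0 -> x \notin Hf -> - x \in Hf.
Proof.
rewrite !inE opprK -leqNgt leq_eqVlt => x0 /orP[/eqP/val_inj/enum_rank_inj|//] e.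
by move: x0; rewrite -eq_oppr_0 {1}e eqxx.
Qed.

Lemma rep_Hf x : (rep x \in Hf) = (x != 0).
Proof.
rewrite /rep; case: (eqVneq x 0) => [->|x0]; first by rewrite (negbTE Hf0) oppr0 (negbTE Hf0).
by case: ifPn => // /(HfNN x0) ->.
Qed.

Lemma rep_id x : x \in Hf -> rep x = x. Proof. by rewrite /rep => ->. Qed.

Lemma repN x : rep (- x) = rep x.
Proof.
rewrite /rep; case: (eqVneq x 0) => [->|x0]; first by rewrite !oppr0.
case: ifPn => xH; first by have := HfN xH; rewrite opprK => /negbTE ->.
by rewrite (contraNT (HfNN x0) xH) opprK.
Qed.

Lemma repE x : rep x = x \/ rep x = - x.
Proof. by rewrite /rep; case: ifP; [left | right]. Qed.

Lemma eq_rep x y : (rep x == rep y) = (x == y) || (x == - y).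
Proof.
apply/eqP/orP => [e|[/eqP->|/eqP->]]; rewrite ?repN //.
case: (repE x) (repE y) => ex [] ey; move: e; rewrite ex ey => e.
- by left; rewrite e.
- by right; rewrite e.
- by right; rewrite -e opprK.
- by left; rewrite (oppr_inj e).
Qed.

Lemma mem_symN X x : (- x \in sym X) = (x \in sym X).
Proof. by rewrite !inE repN. Qed.

Lemma sym0 X : X \subset Hf -> 0 \notin sym X.
Proof.
by move=> /subsetP sX; rewrite inE; apply/negP => /sX; rewrite rep_Hf eqxx.
Qed.

Lemma mem_sym X x : x \in Hf -> (x \in sym X) = (x \in X).
Proof. by move=> xH; rewrite inE rep_id. Qed.

Lemma symU X Y : sym (X :|: Y) = sym X :|: sym Y.
Proof. by apply/setP => x; rewrite !inE. Qed.

Lemma symS X Y : X \subset Y -> sym X \subset sym Y.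
Proof. by move=> /subsetP s; apply/subsetP => x; rewrite !inE => /s. Qed.

Lemma sym_inv_closed X : X \subset Hf -> inv_closed (sym X).
Proof.
by move=> sX; rewrite /inv_closed sym0 //=; apply/forallP => x; rewrite mem_symN.
Qed.

Lemma symI X : X \subset Hf -> sym X :&: Hf = X.
Proof.
move=> /subsetP sX; apply/setP => x; rewrite 2!inE; apply/andP/idP => [[h xH]|xX].
  by rewrite rep_id in h.
by rewrite (rep_id (sX _ xX)) xX sX.
Qed.

Lemma symIK S : inv_closed S -> sym (S :&: Hf) = S.
Proof.
case/andP => S0 /forallP Sinv; apply/setP => x; rewrite 2!inE rep_Hf.
case: (eqVneq x 0) => [->|_]; first by rewrite andbF (negbTE S0).
by rewrite andbT; case: (repE x) => -> //; rewrite (eqP (Sinv x)).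
Qed.

Lemma pair_orbitsE : pair_orbits A = [set [set x; - x] | x in Hf].
Proof.
apply/setP => O; apply/imsetP/imsetP => [[x]|[x xH ->]].
  rewrite inE => x0 ->; exists (rep x); first by rewrite rep_Hf.
  by case: (repE x) => -> //; rewrite opprK setUC.
exists x => //; rewrite inE; apply: contraTneq xH => ->; exact: Hf0.
Qed.

Lemma pair_inj : {in Hf &, injective (fun x : A => [set x; - x])}.
Proof.
move=> x y xH yH /setP/(_ x); rewrite !inE eqxx /= => /esym/orP[/eqP//|/eqP e].
by move: (HfN yH); rewrite -e xH.
Qed.

Lemma card_pair_orbits : #|pair_orbits A| = #|Hf|.
Proof. by rewrite pair_orbitsE card_in_imset //; apply: pair_inj. Qed.

Lemma n_in_sym X : X \subset Hf -> n_in (sym X) = #|X|.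
Proof.
move=> sX; rewrite /n_in -(card_in_imset (f := fun x : A => [set x; - x]) (D := X)); last first.
  by move=> x y /(subsetP sX) xH /(subsetP sX) yH; apply: pair_inj.
congr #|pred_of_set _|; apply/setP => O; rewrite inE pair_orbitsE.
apply/andP/imsetP => [[/imsetP[x xH ->]]|[x xX ->]].
  by rewrite subUset !sub1set => /andP[]; rewrite mem_sym // => xX _; exists x.
have xH := subsetP sX _ xX.
split; first by apply/imsetP; exists x.
by rewrite subUset !sub1set mem_symN mem_sym // xX.
Qed.

(** An inverse-closed S is determined by its trace on [Hf], whose size is the number of chosen
    pairs. As n is odd there are no elements of order 2, and the model is a Bernoulli subset of
    [Hf]. *)
Lemma cay_probE (p : R) (E : {set A} -> bool) :
  cay_prob p E = bprob p Hf (fun X => E (sym X)).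
Proof.
rewrite /cay_prob /bprob /bexp.
rewrite [LHS](_ : _ = \sum_(S : {set A} | inv_closed S) cay_weight p S * (E S)%:R); last first.
  rewrite [LHS]big_mkcondr /=; apply: eq_bigr => S _.
  by case: (E S); rewrite ?mulr1 ?mulr0.
rewrite (reindex_onto sym (fun S => S :&: Hf)) /=; last by move=> S; apply: symIK.
apply: eq_big => [X|X].
  apply/andP/idP => [[_ /eqP <-]|sX]; first exact: subsetIr.
  by rewrite sym_inv_closed // symI.
move=> /andP[_ /eqP e]; have sX : X \subset Hf by rewrite -e subsetIr.
rewrite /cay_weight n_in_sym // card_pair_orbits -cardsDS // RpowE RpowE.
by [].
Qed.

Lemma card_Hf : #|A| = (#|Hf| + #|Hf|).+1.
Proof.
rewrite -cardsT (cardsD1 0) inE add1n; congr _.+1.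
have -> : [set: A] :\ 0 = Hf :|: (-%R @: Hf).
  apply/setP => x; rewrite !in_setU !in_setD1 in_setT andbT.
  case: (boolP (x \in Hf)) => [xH|xH] /=; first by apply: contraTneq xH => ->; apply: Hf0.
  apply/idP/imsetP => [x0|[y yH ->]].
    by exists (- x); rewrite ?opprK // HfNN.
  by rewrite oppr_eq0; apply: contraTneq yH => ->; apply: Hf0.
rewrite cardsU disjoint_setI0 ?cards0 ?subn0; last first.
  rewrite disjoint_sym disjoint_subset; apply/subsetP => x /imsetP[y yH ->].
  by rewrite inE HfN.
by rewrite (card_imset _ oppr_inj).
Qed.

End HalfSystem.

(** * From affine automorphisms to the distinguishing chromatic number *)

Section Colouring.
Variable A : finZmodType.
Hypothesis A6 : coprime #|A| 6.

Definition affine_perm (g : {perm A}) : bool :=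
  [exists c, [forall x, g x == x + c] || [forall x, g x == c - x]].

Definition affine_auts (S : {set A}) : bool :=
  [forall g : {perm A}, is_aut S g ==> affine_perm g].

Lemma imset_colour_class (r : nat) (f : {ffun A -> 'I_r}) (g : {perm A}) :
  (forall j, g @: colour_class f j = colour_class f j) -> forall x, f (g x) = f x.
Proof.
move=> H x; have : g x \in g @: colour_class f (f x) by rewrite imset_f // inE.
by rewrite H inE => /eqP.
Qed.

(** Suppose that for every t the recolouring [ft t] is preserved by some g <> 1. Then g fixes t, the
    only vertex of the new colour, so g is the reflection x |-> 2t - x, and f is invariant under it.
    Any two points are exchanged by the reflection in their midpoint, so f is constant, which the
    edge from 0 to s forbids. *)
Lemma dchromatic_affine (S : {set A}) s : s \in S -> affine_auts S ->
  (dchromatic S <= (chromatic S).+1)%N.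
Proof.
move=> sS /forallP aff; set r := chromatic S.
(* [find] never exceeds the length n + 1 of the search range. *)
have [hr|hr] := leqP #|A| r.
  by apply: leq_trans (find_size _ _) _; rewrite size_iota.
have rP : colorableb S r.
  have : has (colorableb S) (iota 0 #|A|.+1).
    by rewrite has_find size_iota -/(chromatic S) ltnW // ltnS.
  by move/(nth_find 0%N); rewrite -/(chromatic S) -/r nth_iota // ltnW.
case/existsP: rP => f fP.
pose ft t : {ffun A -> 'I_r.+1} := [ffun x => if x == t then ord_max else lift ord_max (f x)].
have ftP t : proper_col S (ft t).
  apply/forallP => j; apply/forall_inP => x; rewrite inE => /eqP fx.
  apply/forall_inP => y; rewrite inE => /eqP fy.
  have : ft t x = ft t y by rewrite fx fy.
  rewrite !ffunE; case: (eqVneq x t) => [->|xt]; case: (eqVneq y t) => [->|yt].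
  - move=> _; move: fP => /forallP/(_ (f t))/forall_inP/(_ t).
    by rewrite inE eqxx => /(_ isT)/forall_inP/(_ t); rewrite inE eqxx => /(_ isT).
  - by move/eqP; rewrite (negbTE (neq_lift _ _)).
  - by move/esym/eqP; rewrite (negbTE (neq_lift _ _)).
  move/lift_inj => fxy; move: fP => /forallP/(_ (f x))/forall_inP/(_ x).
  by rewrite inE eqxx => /(_ isT)/forall_inP/(_ y); rewrite inE fxy eqxx => /(_ isT).
have [t tP|nd] := pickP (fun t => distinguishing S (ft t)).
  rewrite leqNgt; apply/negP => h.
  have := before_find 0%N h; rewrite nth_iota ?add0n; last by rewrite ltnS.
  by move/negbT/negP; apply; rewrite /dcolorableb; apply/existsP; exists (ft t); rewrite ftP.
exfalso.
have fsym t x : f (t + t - x) = f x.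
  move/negbT: (nd t); rewrite negb_forall => /existsP[g].
  rewrite negb_imply negb_exists => /andP[/andP[ga g1] /forallP gc].
  have gcol : forall y, ft t (g y) = ft t y.
    by apply: imset_colour_class => j; apply/eqP; rewrite -[_ == _]negbK.
  have gt : g t = t.
    have := gcol t; rewrite !ffunE eqxx; case: eqP => // _ /esym/eqP.
    by rewrite (negbTE (neq_lift _ _)).
  have gE y : g y = t + t - y.
    have /existsP[c /orP[/forallP h|/forallP h]] := implyP (aff g) ga.
      have c0 : c = 0 by apply: (addrI t); rewrite addr0 -(eqP (h t)) gt.
      by case/eqP: g1; apply/permP => z; rewrite (eqP (h z)) c0 addr0 perm1.
    by rewrite (eqP (h y)) -{1}gt (eqP (h t)) subrK.
  have := gcol x; rewrite gE !ffunE.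
  case: (eqVneq x t) => [->|xt]; first by rewrite addrK.
  case: eqP => [e|_]; last by move/lift_inj.
  by case/eqP: xt; apply: oppr_inj; apply: (addrI (t + t)); rewrite e addrK.
have fconst x y : f x = f y.
  have [h hE] : exists h, h + h = x + y.
    have [b _ bK] := injF_bij (dbl_inj A6).
    by exists (b (x + y)); have := bK (x + y).
  by rewrite -(fsym h y) hE addrK.
move: fP => /forallP/(_ (f 0))/forall_inP/(_ 0); rewrite inE eqxx => /(_ isT)/forall_inP/(_ s).
by rewrite inE (fconst s 0) eqxx /cay_adj subr0 sS => /(_ isT).
Qed.

End Colouring.

(** * Codegrees and nearly affine permutations *)

Section Automorphisms.
Variable A : finZmodType.
Hypothesis A6 : coprime #|A| 6.
Implicit Types (x y z c d : A) (S X : {set A}) (g : {perm A}).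

(** For symmetric S this counts the common neighbours of x and x + d; representations are ordered, u
    and d - u both being counted. *)
Definition codeg S d : nat := #|[set u in S | d - u \in S]|.

Lemma aut_mem S g x y : is_aut S g -> (g y - g x \in S) = (y - x \in S).
Proof. by move=> /forallP/(_ x)/forallP/(_ y)/eqP. Qed.

Lemma codegB S x y : codeg S (y - x) = #|[set z | (z - x \in S) && (y - z \in S)]|.
Proof.
rewrite /codeg -(card_imset _ (addrI x)); congr #|pred_of_set _|.
apply/setP => z; apply/imsetP/idP => [[u]|].
  by rewrite !inE => /andP[uS dS] ->; rewrite addrC addKr opprD addrA uS.
rewrite inE => /andP[zx yz]; exists (z - x); last by rewrite addrC subrK.
by rewrite inE zx opprB addrA subrK.
Qed.

Lemma codeg_aut S g x y : is_aut S g -> codeg S (g y - g x) = codeg S (y - x).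
Proof.
move=> ag; rewrite !codegB -(card_imset [set z | (z - x \in S) && (y - z \in S)] (@perm_inj _ g)).
congr #|pred_of_set _|; apply/setP => z; apply/idP/imsetP => [|[w]].
  rewrite inE -{1 2}(permKV g z) !aut_mem // => h.
  by exists (g^-1 z)%g; rewrite ?inE ?permKV.
by rewrite !inE => h ->; rewrite !aut_mem.
Qed.

Lemma codegN S d : (forall x, (- x \in S) = (x \in S)) -> codeg S (- d) = codeg S d.
Proof.
move=> SN; rewrite /codeg -(card_imset [set u in S | d - u \in S] (@oppr_inj A)).
congr #|pred_of_set _|; apply/setP => z; apply/idP/imsetP => [|[w]].
  rewrite inE => h; exists (- z); rewrite ?opprK // inE SN opprK.
  by rewrite -[d + z \in S]SN opprD.
by rewrite !inE => h ->; rewrite SN opprK -[- d + w \in S]SN opprD opprK.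
Qed.

Lemma card_pairs (I J : finType) (P : I -> J -> bool) :
  #|[set xy : I * J | P xy.1 xy.2]| = (\sum_x #|[set y | P x y]|)%N.
Proof.
rewrite -sum1dep_card; under [RHS]eq_bigr do rewrite -sum1dep_card.
by rewrite pair_big_dep.
Qed.

Lemma card_pairs_swap (I J : finType) (P : I -> J -> bool) :
  #|[set xy : I * J | P xy.1 xy.2]| = (\sum_y #|[set x | P x y]|)%N.
Proof.
rewrite card_pairs; under eq_bigr do rewrite -sum1dep_card.
under [RHS]eq_bigr do rewrite -sum1dep_card.
by rewrite (exchange_big_dep xpredT).
Qed.

Definition nontriv (g : A -> A) x y : bool :=
  (g x - g y != x - y) && (g x - g y != y - x).

(** A pair is trivial exactly when g x - x or g x + x agrees at its two points, so trivial pairs lie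
    within level sets of these two functions, and B is the largest level set of either. A point y
    outside B has at most one trivial partner in B: the partner must share the value of the other
    function with y, and the two functions together determine a point because 2 is invertible. *)
Lemma near_affine g : exists B : {set A}, exists c,
  [/\ (forall x, x \in B -> g x = x + c) \/ (forall x, x \in B -> g x = c - x),
      (#|A| * #|A| <= #|[set xy : A * A | nontriv g xy.1 xy.2]| + 2 * #|A| * #|B|)%N
    & ((#|B| - 1) * (#|A| - #|B|) <= #|[set xy : A * A | nontriv g xy.1 xy.2]|)%N].
Proof.
pose val (b : bool) x := if b then g x + x else g x - x.
pose lev (b : bool) c := [set x | val b x == c].
pose N := [set xy : A * A | nontriv g xy.1 xy.2].
have trivP x y : ~~ nontriv g x y -> exists b, val b x = val b y.
  rewrite negb_and !negbK => /orP[/eqP e|/eqP e]; [exists false|exists true]; rewrite /val;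
    zmod_from e.
have valinj x y : val true x = val true y -> val false x = val false y -> x = y.
  rewrite /val => e1 e2; apply: (dbl_inj A6) => /=.
  have E z : z + z = (g z + z) - (g z - z) by zmod.
  by rewrite E e1 e2 -E.
case: (@arg_maxnP _ (true, 0 : A) xpredT (fun bc => #|lev bc.1 bc.2|) isT) => -[b c] _ /= maxP.
have sumlev b' : (#|[set xy : A * A | val b' xy.1 == val b' xy.2]| <= #|A| * #|lev b c|)%N.
  rewrite (card_pairs (fun x y => val b' x == val b' y)) -sum_nat_const.
  apply: leq_sum => x _; apply: leq_trans (maxP (b', val b' x) isT).
  by apply: subset_leq_card; apply/subsetP => y; rewrite !inE eq_sym.
have levE : (forall x, x \in lev b c -> g x = x + c) \/ (forall x, x \in lev b c -> g x = c - x).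
  by case: b {maxP sumlev} => /=; [right|left] => x; rewrite inE /val => /eqP <-;
    rewrite ?addrK // addrC subrK.
exists (lev b c), c; split=> //.
- have sub : [set: A * A] \subset N :|: ([set xy | val true xy.1 == val true xy.2] :|:
      [set xy | val false xy.1 == val false xy.2]).
    apply/subsetP => -[x y] _; rewrite !inE /=; case: (boolP (nontriv g x y)) => //=.
    by case/trivP => -[] /eqP ->; rewrite ?orbT.
  have := subset_leq_card sub; rewrite cardsT card_prod => h.
  have := leq_trans h (leq_card_setU _ _) => {}h.
  have h2 := leq_card_setU [set xy : A * A | val true xy.1 == val true xy.2]
      [set xy | val false xy.1 == val false xy.2].
  apply: leq_trans h _; rewrite leq_add2l; apply: leq_trans h2 _.
  by rewrite -mulnA mul2n -addnn leq_add.
- rewrite (card_pairs_swap (fun x y => nontriv g x y)).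
  apply: (@leq_trans (\sum_(y in ~: lev b c) (#|lev b c| - 1))).
    by rewrite sum_nat_const mulnC leq_mul2r cardsCs setCK leqnn orbT.
  rewrite [X in (_ <= X)%N](bigID (mem (~: lev b c))) /=; apply: leq_trans (leq_addr _ _).
  apply: leq_sum => y; rewrite !inE => yB.
  pose w := [set x in lev b c | ~~ nontriv g x y].
  have w1 : (#|w| <= 1)%N.
    have wP x : x \in w -> val b x = c /\ val (~~ b) x = val (~~ b) y.
      rewrite !inE => /andP[/eqP xB /trivP[b' e]]; split=> //.
      case: (eqVneq b' b) => [bb|]; first by case/eqP: yB; rewrite -bb -e bb.
      by case: (b) (b') e => -[].
    rewrite leqNgt; apply/negP => /card_gt1P[x [x' [/wP[e1 e2] /wP[e3 e4]]]] /eqP; apply.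
    have := etrans e1 (esym e3); have := etrans e2 (esym e4).
    by case: (b) => h1 h2; apply: valinj.
  rewrite leq_subLR; apply: leq_trans (leq_add w1 (leqnn _)).
  apply: leq_trans (leq_card_setU _ _); apply: subset_leq_card; apply/subsetP => x xB.
  apply/setUP; case: (boolP (nontriv g x y)) => h; [right|left]; first by rewrite inE.
  by apply/setIdP.
Qed.

End Automorphisms.

(** * Counting tuples with coinciding labels *)

Lemma card_exists (I J : finType) (P : I -> pred J) :
  (#|[pred b | [exists i, P i b]]| <= \sum_i #|P i|)%N.
Proof.
rewrite -sum1_card; under [X in (_ <= X)%N]eq_bigr do rewrite -sum1_card.
rewrite (exchange_big_dep predT) //= big_mkcond /=; apply: leq_sum => b _.
case: ifP => // /existsP[i Pi]; rewrite (bigD1 i) //=.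
Qed.

Section Generic.
Variable A : finZmodType.

Definition upd (V : finType) (b : {ffun V -> A}) (i : V) (a : A) : {ffun V -> A} :=
  [ffun j => if j == i then a else b j].

Lemma upd_id (V : finType) (b : {ffun V -> A}) i : upd b i (b i) = b.
Proof. by apply/ffunP => j; rewrite ffunE; case: eqP => [->|]. Qed.

Lemma upd_upd (V : finType) (b : {ffun V -> A}) i a a' : upd (upd b i a) i a' = upd b i a'.
Proof. by apply/ffunP => j; rewrite !ffunE; case: eqP. Qed.

Lemma coord_count (V : finType) (u v : {ffun V -> A} -> A) (i : V) :
  (forall b, injective (fun a => u (upd b i a))) ->
  (forall b a, v (upd b i a) = v b) ->
  (#|[pred b | u b == v b]| * #|A| <= #|A| ^ #|V|)%N.
Proof.
move=> uinj vind; rewrite -card_ffun.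
have -> : (#|[pred b | u b == v b]| * #|A|)%N = #|setX [set b | u b == v b] [set: A]|.
  by rewrite cardsX cardsT cardsE.
rewrite -(@card_in_imset _ _ (fun ba : {ffun V -> A} * A => upd ba.1 i ba.2)
   (setX [set b | u b == v b] [set: A])) ?max_card //.
move=> [b a] [b' a'] /setXP[]; rewrite inE => /eqP ub _ /setXP[]; rewrite inE => /eqP ub' _ /= e.
have ea : a = a' by have := congr1 (fun f : {ffun V -> A} => f i) e; rewrite !ffunE eqxx.
  have eb : b' = upd b i (b' i) by rewrite -(upd_upd b i a) e upd_upd upd_id.
  rewrite -ea; congr (_, _); apply/esym; rewrite eb -[RHS](upd_id b i); congr upd.
  by apply: (uinj b); rewrite -eb upd_id ub ub' eb vind.
Qed.

Definition sg (s : bool) (x : A) : A := if s then - x else x.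

Section GenericLabels.
Variables (I : finType) (d : bool -> I -> A).

(* The labels [d false e] and [d true e] are the values of a difference before
   and after applying a permutation; these are the coincidences that would
   make the corresponding events dependent. *)
Definition viol1 (k : I * bool) := d k.2 k.1 == 0.
Definition viol2 (k : I * I * bool * bool * bool) :=
  let: (e, f, l, l', s) := k in (e != f) && (d l e == sg s (d l' f)).
Definition viol3 (k : I * I * I * bool) :=
  let: (e, g, f, l) := k in (e != g) && (d false e - d false g == d l f).

Definition generic := ~~ [|| [exists k, viol1 k], [exists k, viol2 k] | [exists k, viol3 k]].

Lemma genericP : generic ->
  [/\ forall l e, d l e != 0,
      forall e f l l' s, e != f -> d l e != sg s (d l' f)
    & forall e g f l, e != g -> d false e - d false g != d l f].
Proof.
rewrite /generic !negb_or !negb_exists => /and3P[/forallP h1 /forallP h2 /forallP h3].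
split=> [l e|e f l l' s ef|e g f l eg].
- exact: (h1 (e, l)).
- by have := h2 (e, f, l, l', s); rewrite /viol2 ef.
- by have := h3 (e, g, f, l); rewrite /viol3 eg.
Qed.

End GenericLabels.

Section Labels.
Variables (V I : finType) (L : bool -> {ffun V -> A} -> I -> A).

Local Notation lab b := (fun l => L l b).

Definition inj_at i e := forall l b, injective (fun a => L l (upd b i a) e).
Definition ind_at i e := forall l b a, L l (upd b i a) e = L l b e.

Hypothesis H0 : forall e, exists i, inj_at i e.
Hypothesis H1 : forall e f, e != f -> exists i, inj_at i e /\ ind_at i f.
Hypothesis H2 : forall e g f, e != g ->
  exists i, ind_at i f /\ (inj_at i e /\ ind_at i g \/ inj_at i g /\ ind_at i e).

Lemma card_viol (K : finType) (viol : K -> pred {ffun V -> A}) :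
  (forall k, #|viol k| * #|A| <= #|A| ^ #|V|)%N ->
  (#|[pred b | [exists k, viol k b]]| * #|A| <= #|K| * #|A| ^ #|V|)%N.
Proof.
move=> h; apply: (@leq_trans ((\sum_k #|viol k|) * #|A|)).
  by rewrite leq_mul2r card_exists orbT.
by rewrite big_distrl /= -sum_nat_const; apply: leq_sum => k _; apply: h.
Qed.

(** Each coincidence holds for at most a fraction 1/n of all tuples, and there are 2|I| + 8|I|^2 +
    2|I|^3 of them. [H0], [H1] and [H2] provide for each a coordinate on which exactly one of the
    labels involved depends, and injectively so. *)
Lemma card_nongeneric :
  (#|[pred b | ~~ generic (lab b)]| * #|A| <= 12 * #|I| ^ 3 * #|A| ^ #|V|)%N.
Proof.
have c1 : (#|[pred b | [exists k, viol1 (lab b) k]]| * #|A| <= (#|I| * 2) * #|A| ^ #|V|)%N.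
  rewrite -card_bool -card_prod; apply: (card_viol (viol := fun k b => viol1 (lab b) k)) => -[e l].
  have [i ie] := H0 e.
  by apply: (coord_count (u := fun b => L l b e) (v := fun=> 0)) => // b; apply: ie.
have c2 : (#|[pred b | [exists k, viol2 (lab b) k]]| * #|A| <= (#|I| * #|I| * 2 * 2 * 2) * #|A| ^ #|V|)%N.
  rewrite -card_bool -!card_prod; apply: (card_viol (viol := fun k b => viol2 (lab b) k)) => -[[[[e f] l] l'] s].
  case: (boolP (e != f)) => ef; last first.
    rewrite (_ : #|_| = 0)%N ?mul0n //; apply: eq_card0 => b.
    by rewrite unfold_in /= (negbTE ef).
  have [i [ie iff]] := H1 ef.
  apply: leq_trans (coord_count (u := fun b => L l b e) (v := fun b => sg s (L l' b f)) (i := i) _ _).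
  - rewrite leq_mul2r; apply/orP; right; apply: subset_leq_card; apply/subsetP => b.
    by rewrite !unfold_in /= ef.
  - by move=> b; apply: ie.
  - by move=> b a; rewrite iff.
have c3 : (#|[pred b | [exists k, viol3 (lab b) k]]| * #|A| <= (#|I| * #|I| * #|I| * 2) * #|A| ^ #|V|)%N.
  rewrite -card_bool -!card_prod; apply: (card_viol (viol := fun k b => viol3 (lab b) k)) => -[[[e g] f] l].
  case: (boolP (e != g)) => eg; last first.
    rewrite (_ : #|_| = 0)%N ?mul0n //; apply: eq_card0 => b.
    by rewrite unfold_in /= (negbTE eg).
  have [i [iff [[ie ig]|[ig ie]]]] := H2 f eg.
    apply: leq_trans (coord_count (u := fun b => L false b e)
      (v := fun b => L l b f + L false b g) (i := i) _ _).
    - rewrite leq_mul2r; apply/orP; right; apply: subset_leq_card; apply/subsetP => b.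
      by rewrite !unfold_in /= eg /= => /eqP <-; rewrite subrK.
    - by move=> b a a' /ie.
    - by move=> b a; rewrite iff ig.
  apply: leq_trans (coord_count (u := fun b => L false b g)
      (v := fun b => L false b e - L l b f) (i := i) _ _).
  - rewrite leq_mul2r; apply/orP; right; apply: subset_leq_card; apply/subsetP => b.
    by rewrite !unfold_in /= eg /= => /eqP <-; rewrite subKr.
  - by move=> b a a' /ig.
  - by move=> b a; rewrite iff ie.
set U := (#|A| ^ #|V|)%N in c1 c2 c3 *.
pose v1 := [set b | [exists k, viol1 (lab b) k]]; pose v2 := [set b | [exists k, viol2 (lab b) k]].
pose v3 := [set b | [exists k, viol3 (lab b) k]].
apply: (@leq_trans ((#|v1| + #|v2| + #|v3|) * #|A|)).
  rewrite leq_mul2r; apply/orP; right; apply: (@leq_trans #|v1 :|: v2 :|: v3|).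
    by apply: subset_leq_card; apply/subsetP => b; rewrite !inE /generic negbK !orbA.
  do 2! [apply: leq_trans (leq_card_setU _ _) _; rewrite leq_add2r].
  by [].
rewrite !mulnDl !cardsE; apply: leq_trans (leq_add (leq_add c1 c2) c3) _.
rewrite -!mulnDl leq_mul2r; apply/orP; right.
by case: #|I| => // m; nia.
Qed.

End Labels.

End Generic.

Section CountTuples.
Variables (A : finZmodType) (V : finType).

Lemma card_ffun1_le (P : pred A) (i : V) :
  (#|[set b : {ffun V -> A} | P (b i)]| * #|A| <= #|[set x | P x]| * #|A| ^ #|V|)%N.
Proof.
rewrite -card_ffun -!cardsT -!cardsX.
rewrite -(@card_in_imset _ _ (fun ba : {ffun V -> A} * A => (ba.1 i, upd ba.1 i ba.2))).
  apply: subset_leq_card; apply/subsetP => _ /imsetP[[b a] /setXP[bP _] ->].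
  by rewrite !inE in bP *; rewrite bP.
move=> [b a] [b' a'] _ _ /= [e1 e2].
have ea : a = a' by have := congr1 (fun f : {ffun V -> A} => f i) e2; rewrite !ffunE eqxx.
by rewrite ea; congr (_, _); rewrite -(upd_id b i) e1 -(upd_upd b i a) e2 upd_upd upd_id.
Qed.

Lemma card_ffun2_ge (P : A -> A -> bool) (i j : V) : i != j ->
  (#|[set xy : A * A | P xy.1 xy.2]| * #|A| ^ #|V| <=
   #|[set b : {ffun V -> A} | P (b i) (b j)]| * (#|A| * #|A|))%N.
Proof.
move=> ij; rewrite -card_ffun -card_prod -!cardsT -!cardsX.
rewrite -(@card_in_imset _ _ (fun xyb : (A * A) * {ffun V -> A} =>
   (upd (upd xyb.2 i xyb.1.1) j xyb.1.2, (xyb.2 i, xyb.2 j)))).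
  apply: subset_leq_card; apply/subsetP => _ /imsetP[[[x y] b] /setXP[xyP _] ->].
  rewrite !inE /= in xyP *; by rewrite !ffunE !eqxx (negbTE ij) xyP.
move=> [[x y] b] [[x' y'] b'] _ _ /= [e1 e2 e3].
have ey : y = y' by have := congr1 (fun f : {ffun V -> A} => f j) e1; rewrite !ffunE eqxx.
have ex : x = x'.
  have := congr1 (fun f : {ffun V -> A} => f i) e1.
  by rewrite !ffunE (negbTE ij) eqxx.
rewrite ex ey; congr (_, _); apply/ffunP => l.
have := congr1 (fun f : {ffun V -> A} => f l) e1; rewrite !ffunE.
by case: (eqVneq l j) => [-> _|lj]; rewrite ?e3 //; case: (eqVneq l i) => [->|].
Qed.

End CountTuples.

(** * Rigidity from an invariant with independent increments *)

Section Rigid.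
Variable A : finZmodType.
Hypothesis A6 : coprime #|A| 6.
Variables (Fd : realFieldType) (p : Fd).
Hypotheses (p0 : 0 <= p) (p1 : p <= 1).
Variable W : {set A} -> A -> nat.
Local Notation n := #|A|.

Lemma n_gt0 : (0 < n)%N. Proof. by apply/card_gt0P; exists 0. Qed.

Section RandomPairs.
Variable k : nat.
Local Notation V := ('I_k + 'I_k)%type.
Local Notation I := ('I_k * 'I_k)%type.

Definition plab (b : {ffun V -> A}) (e : I) : A := b (inl e.1) - b (inr e.2).
Definition pairlab (b b' : {ffun V -> A}) (l : bool) : I -> A := plab (if l then b' else b).
Definition pairset (b b' : {ffun V -> A}) : {set I} :=
  [set e | (plab b' e != plab b e) && (plab b' e != - plab b e)].

Definition gmap (g : {perm A}) (b : {ffun V -> A}) : {ffun V -> A} := [ffun i => g (b i)].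

Lemma card_nongeneric_pair (g : {perm A}) :
  (#|[pred b | ~~ generic (pairlab b (gmap g b))]| * n <= 12 * (k * k) ^ 3 * n ^ (k + k))%N.
Proof.
have -> : (k * k = #|{: I}|)%N by rewrite card_prod !card_ord.
have -> : (k + k = #|{: V}|)%N by rewrite card_sum !card_ord.
pose L := fun l (b : {ffun V -> A}) => pairlab b (gmap g b) l.
pose G (l : bool) (x : A) := if l then g x else x.
have Ginj l : injective (G l) by case: l => // x y /perm_inj.
have LE l b e : L l b e = G l (b (inl e.1)) - G l (b (inr e.2)).
  by rewrite /L /pairlab /plab; case: l; rewrite ?ffunE.
have injl e : inj_at L (inl e.1) e.
  by move=> l b a a'; rewrite !LE !ffunE eqxx /= => /addIr/Ginj.
have injr e : inj_at L (inr e.2) e.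
  by move=> l b a a'; rewrite !LE !ffunE eqxx /= => /addrI/oppr_inj/Ginj.
have indl i e : e.1 != i -> ind_at L (inl i) e.
  move=> ie l b a; rewrite !LE !ffunE /=.
  by have -> : (inl e.1 == inl i :> V) = false by apply/negbTE; apply: contra ie => /eqP[->].
have indr i e : e.2 != i -> ind_at L (inr i) e.
  move=> ie l b a; rewrite !LE !ffunE /=.
  by have -> : (inr e.2 == inr i :> V) = false by apply/negbTE; apply: contra ie => /eqP[->].
apply: (@card_nongeneric A V I L).
- by move=> e; exists (inl e.1).
- move=> [e1 e2] [f1 f2]; rewrite xpair_eqE negb_and => /orP[h|h].
    by exists (inl e1); split; [apply: (injl (e1, e2)) | apply: indl; rewrite eq_sym].
  by exists (inr e2); split; [apply: (injr (e1, e2)) | apply: indr; rewrite eq_sym].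
- move=> [e1 e2] [g1 g2] [f1 f2]; rewrite xpair_eqE negb_and => /orP[h|h].
    have [fe|fe] := eqVneq f1 e1.
      exists (inl g1); split; first by apply: indl; rewrite /= fe.
      by right; split; [apply: (injl (g1, g2)) | apply: indl].
    exists (inl e1); split; first by apply: indl.
    by left; split; [apply: (injl (e1, e2)) | apply: indl; rewrite eq_sym].
  have [fe|fe] := eqVneq f2 e2.
    exists (inr g2); split; first by apply: indr; rewrite /= fe.
    by right; split; [apply: (injr (g1, g2)) | apply: indr].
  exists (inr e2); split; first by apply: indr.
  by left; split; [apply: (injr (e1, e2)) | apply: indr; rewrite eq_sym].
Qed.

(** First moment: if there are N nontrivial pairs, a uniform sample contains k^2 N / n^2 of them on
    average. Non-generic samples form a proportion of at most 12 k^6 / n and contribute at most 12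
    k^8 / n to this average, so some generic sample has m of them. *)
Lemma generic_pair_exists (g : {perm A}) (m N0 : nat) :
  (m * n ^ 2 + 12 * k ^ 8 * n <= k ^ 2 * N0)%N ->
  (N0 < #|[set xy : A * A | nontriv g xy.1 xy.2]|)%N -> (0 < k)%N ->
  exists b, generic (pairlab b (gmap g b)) && (m <= #|pairset b (gmap g b)|)%N.
Proof.
move=> num big k0; apply/existsP; rewrite -[X in is_true X]negbK negb_exists; apply/negP => /forallP h.
set N := #|_| in big.
have sumE : (k * k * N * n ^ (k + k) <= (\sum_(b : {ffun V -> A}) #|pairset b (gmap g b)|) * (n * n))%N.
  have -> : (\sum_(b : {ffun V -> A}) #|pairset b (gmap g b)| =
     \sum_(e : I) #|[set b : {ffun V -> A} | nontriv g (b (inl e.1)) (b (inr e.2))]|)%N.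
    pose Q (e : I) (b : {ffun V -> A}) := nontriv g (b (inl e.1)) (b (inr e.2)).
    rewrite -(card_pairs Q) (card_pairs_swap Q); apply: eq_bigr => b _; apply: eq_card => e.
    by rewrite !inE /nontriv /plab !ffunE opprB.
  rewrite big_distrl /= -mulnA -[X in (X * _ <= _)%N]/(k * k)%N.
  have -> : (k * k = #|{: I}|)%N by rewrite card_prod !card_ord.
  rewrite -sum_nat_const; apply: leq_sum => e _.
  have -> : (k + k = #|{: V}|)%N by rewrite card_sum !card_ord.
  exact: card_ffun2_ge.
have sumle : ((\sum_(b : {ffun V -> A}) #|pairset b (gmap g b)|) <=
   m * n ^ (k + k) + k * k * #|[pred b | ~~ generic (pairlab b (gmap g b))]|)%N.
  rewrite (bigID (fun b => generic (pairlab b (gmap g b)))) /=; apply: leq_add.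
    apply: (@leq_trans (\sum_(b : {ffun V -> A}) m)); last first.
      by rewrite sum_nat_const mulnC card_ffun card_sum !card_ord.
    rewrite big_mkcond; apply: leq_sum => b _; case: ifP => // gb.
    by have := h b; rewrite gb /= -ltnNge => /ltnW.
  rewrite mulnC -sum_nat_const; apply: leq_sum => b _.
  by apply: leq_trans (max_card _) _; rewrite card_prod !card_ord.
have ng := card_nongeneric_pair g.
set G := #|[pred b | ~~ generic (pairlab b (gmap g b))]| in sumle ng; set P := (n ^ (k + k))%N in sumE sumle ng.
have P0 : (0 < P)%N by rewrite expn_gt0 n_gt0.
set S := (\sum_b _)%N in sumE sumle.
have n0 := n_gt0.
have h1 : (k * k * N * P <= (m * P + k * k * G) * (n * n))%N.
  by apply: leq_trans sumE _; rewrite leq_mul2r sumle orbT.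
have h2 : (k * k * G * (n * n) <= 12 * k ^ 8 * n * P)%N.
  have -> : (k * k * G * (n * n) = (k * k * n) * (G * n))%N by lia.
  have -> : (12 * k ^ 8 * n * P = (k * k * n) * (12 * (k * k) ^ 3 * P))%N by lia.
  by rewrite leq_mul2l ng orbT.
have h3 : (k * k * N * P <= (m * n ^ 2 + 12 * k ^ 8 * n) * P)%N.
  by apply: leq_trans h1 _; rewrite mulnDl mulnDl; apply: leq_add => //; lia.
have h4 : (k ^ 2 * N <= k ^ 2 * N0)%N.
  by apply: leq_trans num; move: h3; rewrite leq_pmul2r // -mulnn.
by move: h4; rewrite leq_pmul2l ?expn_gt0 ?k0 // leqNgt big.
Qed.

End RandomPairs.

Section RandomStar.
Variable M : nat.

Definition starlab (x y : A) (b : {ffun 'I_M -> A}) (l : bool) (i : 'I_M) : A :=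
  b i - (if l then y else x).

Definition starok x y (b : {ffun 'I_M -> A}) : bool :=
  generic (starlab x y b) &&
  [forall i, (starlab x y b true i != starlab x y b false i) &&
             (starlab x y b true i != - starlab x y b false i)].

Definition starviol (X : {set A}) x y (b : {ffun 'I_M -> A}) : nat :=
  #|[set i | W X (starlab x y b false i) != W X (starlab x y b true i)]|.

(** Besides coincidences only 2 b_i = x + y has to be avoided; this adds M to 12 M^3, whence the
    13. *)
Lemma card_nongeneric_star x y : x != y ->
  (#|[pred b | ~~ starok x y b]| * n <= 13 * M ^ 3 * n ^ M)%N.
Proof.
move=> xy.
have c1 : (#|[pred b | ~~ generic (starlab x y b)]| * n <= 12 * M ^ 3 * n ^ M)%N.
  pose L := fun l (b : {ffun 'I_M -> A}) => starlab x y b l.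
  have inje i : inj_at L i i by move=> l b a a'; rewrite /L /starlab !ffunE eqxx => /addIr.
  have inde i e : e != i -> ind_at L i e.
    by move=> ie l b a; rewrite /L /starlab !ffunE (negbTE ie).
  have := @card_nongeneric A _ _ L; rewrite card_ord; apply.
  - by move=> e; exists e.
  - by move=> e f ef; exists e; split=> //; apply: inde; rewrite eq_sym.
  move=> e g f eg; have [fe|fe] := eqVneq f e.
    by exists g; split; [apply: inde; rewrite fe | right; split=> //; apply: inde].
  by exists e; split; [apply: inde | left; split=> //; apply: inde; rewrite eq_sym].
have c2 : (#|[pred b : {ffun 'I_M -> A} | [exists i, (b i + b i == x + y)%R]]| * n <= M * n ^ M)%N.
  have := @card_viol A _ _ (fun (i : 'I_M) (b : {ffun 'I_M -> A}) => (b i + b i) == x + y).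
  rewrite !card_ord; apply => i.
  have := @coord_count A 'I_M (fun b => b i + b i) (fun=> x + y) i; rewrite card_ord; apply=> //.
  by move=> b a a' /(dbl_inj A6); rewrite !ffunE eqxx.
apply: (@leq_trans ((#|[pred b | ~~ generic (starlab x y b)]| +
    #|[pred b : {ffun 'I_M -> A} | [exists i, (b i + b i == x + y)%R]]|) * n)).
  rewrite leq_mul2r; apply/orP; right; rewrite -[X in (_ <= X + _)%N]cardsE -[X in (_ <= _ + X)%N]cardsE.
  apply: leq_trans (leq_card_setU _ _); apply: subset_leq_card; apply/subsetP => b.
  rewrite !inE negb_and => /orP[->//|]; rewrite negb_forall => /existsP[i].
  rewrite negb_and !negbK /starlab => /orP[/eqP/addrI/oppr_inj e|/eqP e].
    by rewrite e eqxx in xy.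
  by apply/orP; right; apply/existsP; exists i; apply/eqP; zmod_from e.
rewrite mulnDl; apply: leq_trans (leq_add c1 c2) _; rewrite -mulnDl leq_mul2r; apply/orP; right.
by case: (M) => // m; nia.
Qed.

(** Markov's inequality: the average number of separations in a tuple is at most M N1 / n, so more
    than v occur with probability at most M N1 / (n (v + 1)). Together with the tuples that are not
    [starok] this is at most one half. *)
Lemma card_star_ge X x y (v N1 : nat) : x != y ->
  (2 * (M * N1 + 13 * M ^ 3 * v.+1) <= n * v.+1)%N ->
  (#|[set z | W X (z - x)%R != W X (z - y)%R]| <= N1)%N ->
  (n ^ M <= 2 * #|[pred b | starok x y b && (starviol X x y b <= v)%N]|)%N.
Proof.
move=> xy num DN; set T := #|[pred b | starok x y b && (starviol X x y b <= v)%N]|.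
have n0 := n_gt0; set P := (n ^ M)%N.
pose B1 := [set b | ~~ starok x y b]; pose B2 := [set b | (v < starviol X x y b)%N].
have cov : (P <= T + #|B1| + #|B2|)%N.
  have -> : P = #|[set: {ffun 'I_M -> A}]| by rewrite cardsT card_ffun card_ord.
  rewrite /T -[X in (_ <= X + _ + _)%N]cardsE.
  apply: (@leq_trans #|[set b | starok x y b && (starviol X x y b <= v)%N] :|: B1 :|: B2|).
    apply: subset_leq_card; apply/subsetP => b _; rewrite !inE.
    by case: (starok x y b) => //=; rewrite ?orbT // orbF ltnNge orbN.
  by apply: leq_trans (leq_card_setU _ _) _; rewrite leq_add2r; apply: leq_card_setU.
have b1 : (#|B1| * n <= 13 * M ^ 3 * P)%N by rewrite cardsE; apply: card_nongeneric_star.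
have b2 : (#|B2| * v.+1 * n <= M * N1 * P)%N.
  apply: (@leq_trans ((\sum_(b : {ffun 'I_M -> A}) starviol X x y b) * n)).
    rewrite leq_mul2r; apply/orP; right; rewrite -sum_nat_const.
    rewrite big_mkcond /=; apply: leq_sum => b _; rewrite inE; by case: ifP.
  have -> : (\sum_(b : {ffun 'I_M -> A}) starviol X x y b =
     \sum_(i < M) #|[set b : {ffun 'I_M -> A} | W X (b i - x)%R != W X (b i - y)%R]|)%N.
    pose Q (i : 'I_M) (b : {ffun 'I_M -> A}) := W X (b i - x) != W X (b i - y).
    by rewrite -(card_pairs Q) (card_pairs_swap Q).
  rewrite big_distrl /= -mulnA.
  have -> : (M * (N1 * P) = \sum_(i < M) N1 * P)%N by rewrite sum_nat_const card_ord.
  apply: leq_sum => i _.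
  have := card_ffun1_le (fun z => W X (z - x) != W X (z - y)) i; rewrite card_ord => h.
  by apply: leq_trans h _; rewrite leq_mul2r DN orbT.
have P0 : (0 < P)%N by rewrite expn_gt0 n0.
have h1 : ((#|B1| + #|B2|) * (v.+1 * n) <= (M * N1 + 13 * M ^ 3 * v.+1) * P)%N.
  have : (#|B1| * n * v.+1 <= 13 * M ^ 3 * P * v.+1)%N by rewrite leq_mul2r b1 orbT.
  by move: b2; rewrite !mulnDl; lia.
have h2 : (2 * ((#|B1| + #|B2|) * (v.+1 * n)) <= n * v.+1 * P)%N.
  apply: leq_trans (leq_mul (leqnn 2) h1) _; rewrite mulnA leq_mul2r num orbT //.
have h3 : (2 * (#|B1| + #|B2|) <= P)%N.
  rewrite -(@leq_pmul2r (v.+1 * n)) ?muln_gt0 //.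
  by move: h2; lia.
by move: cov h3; lia.
Qed.

End RandomStar.

Definition close_pair X (N1 : nat) : bool :=
  [exists xy : A * A, (xy.1 != xy.2) && (#|[set z | W X (z - xy.1)%R != W X (z - xy.2)%R]| <= N1)%N].

Section Conclusion.
Variables (Good : pred {set A}) (k m M v N0 N1 : nat) (b1 b2 : Fd).
Hypotheses (b10 : 0 <= b1) (b20 : 0 <= b2).
Hypothesis k0 : (0 < k)%N.
Hypothesis num1 : (m * n ^ 2 + 12 * k ^ 8 * n <= k ^ 2 * N0)%N.
Hypothesis num2 : (2 * (M * N1 + 13 * M ^ 3 * v.+1) <= n * v.+1)%N.
Hypothesis num3 : forall a, (a <= n -> n * n <= N0 + 2 * n * a -> (a - 1) * (n - a) <= N0 -> n - a <= N1)%N.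
Hypothesis Winv : forall (X : {set A}) (g : {perm A}) x y, X \subset Hf A -> is_aut (sym X) g ->
  W X (g x - g y) = W X (x - y).
Hypothesis WN : forall X x, W X (- x) = W X x.
Hypothesis star1 : forall (d : bool -> 'I_k * 'I_k -> A) (E : {set 'I_k * 'I_k}),
  generic d -> (forall e, e \in E -> (d true e != d false e) && (d true e != - d false e)) ->
  (m <= #|E|)%N ->
  bprob p (Hf A) (fun X => Good X && [forall e in E, W X (d false e) == W X (d true e)]) <= b1.
Hypothesis star2 : forall (d : bool -> 'I_M -> A), generic d ->
  (forall e, (d true e != d false e) && (d true e != - d false e)) ->
  bprob p (Hf A) (fun X => Good X &&
    (#|[set i | W X (d false i) != W X (d true i)]| <= v)%N) <= b2.

(** For fixed x <> y the events over all z are dependent, so sampled points replace them: if x and y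
    are close, at least half of all tuples are admissible and show at most v separations.
    Admissibility does not depend on X, so exchanging the sums over X and over tuples gives twice
    the bound for a single tuple. *)
Lemma close_pair_prob : bprob p (Hf A) (fun X => Good X && close_pair X N1) <= (n * n)%:R * (2%:R * b2).
Proof.
apply: (@le_trans _ _ (bprob p (Hf A) (fun X => [exists xy : A * A, (xy.1 != xy.2) &&
  (Good X && (#|[set z | W X (z - xy.1)%R != W X (z - xy.2)%R]| <= N1)%N)]))).
  apply: ler_bprob => // X _ /andP[GX /existsP[xy /andP[h1 h2]]].
  by apply/existsP; exists xy; rewrite h1 GX.
apply: le_trans (bprob_union p0 p1 (b := 2%:R * b2) (Q := fun xy : A * A => xy.1 != xy.2) _) _; last first.
  rewrite ler_wpM2r ?mulr_ge0 // ler_nat -card_prod; exact: max_card.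
move=> [x y] /= xy.
have Pgt0 : (0 : Fd) < (n ^ M)%:R by rewrite ltr0n expn_gt0 n_gt0.
rewrite -(ler_pM2l Pgt0) /bprob -bexpZ.
apply: (@le_trans _ _ (bexp p (Hf A) (fun X => \sum_(b : {ffun 'I_M -> A} | starok x y b)
   2%:R * (Good X && (starviol X x y b <= v)%N)%:R))).
  apply: ler_bexp => // X _; case: (Good X) => /=; last first.
    by rewrite mulr0; apply: sumr_ge0 => b _; rewrite mulr0.
  case: leqP => DN; last by rewrite mulr0; apply: sumr_ge0 => b _; rewrite mulr_ge0 ?ler0n.
  rewrite mulr1 -big_distrr /= -natr_sum -natrM ler_nat.
  apply: leq_trans (card_star_ge xy num2 DN) _.
  by rewrite leq_mul2l /= -sum1_card big_mkcondr /=; apply: leq_sum => b _; case: (starviol _ _ _ _ <= _)%N.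
rewrite bexp_sum.
apply: (@le_trans _ _ (\sum_(b : {ffun 'I_M -> A} | starok x y b) 2%:R * b2)).
  apply: ler_sum => b /andP[gb /forallP nb]; rewrite bexpZ ler_wpM2l //.
  exact: (star2 gb nb).
rewrite sumr_const -[X in X <= _]mulr_natl ler_wpM2r ?mulr_ge0 // ler_nat.
by apply: leq_trans (max_card _) _; rewrite card_ffun card_ord.
Qed.

Lemma pair_prob : bprob p (Hf A) (fun X => Good X &&
   [exists bb : {ffun 'I_k + 'I_k -> A} * {ffun 'I_k + 'I_k -> A},
      (generic (pairlab bb.1 bb.2) && (m <= #|pairset bb.1 bb.2|)%N) &&
      [forall e in pairset bb.1 bb.2, W X (plab bb.1 e) == W X (plab bb.2 e)]])
  <= (n ^ (4 * k))%:R * b1.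
Proof.
apply: (@le_trans _ _ (bprob p (Hf A) (fun X =>
   [exists bb : {ffun 'I_k + 'I_k -> A} * {ffun 'I_k + 'I_k -> A},
      (generic (pairlab bb.1 bb.2) && (m <= #|pairset bb.1 bb.2|)%N) &&
      (Good X && [forall e in pairset bb.1 bb.2, W X (plab bb.1 e) == W X (plab bb.2 e)])]))).
  apply: ler_bprob => // X _ /andP[GX /existsP[bb /andP[h1 h2]]].
  by apply/existsP; exists bb; rewrite h1 GX.
apply: le_trans (bprob_union p0 p1 (b := b1) _) _; last first.
  rewrite ler_wpM2r // ler_nat; apply: leq_trans (max_card _) _.
  by rewrite card_prod card_ffun card_sum card_ord -expnD; apply: leq_pexp2l; [apply: n_gt0 | lia].
move=> [b b'] /andP[gb mb]; apply: (star1 gb) => // e; by rewrite inE.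
Qed.

Lemma rigid : bprob p (Hf A) (fun X => Good X && ~~ affine_auts (sym X))
  <= (n ^ (4 * k))%:R * b1 + (n * n)%:R * (2%:R * b2).
Proof.
apply: le_trans (lerD pair_prob close_pair_prob).
apply: le_trans (bprobU p0 p1 _ _ _); apply: ler_bprob => // X sX /andP[GX].
rewrite GX /= negb_forall => /existsP[g]; rewrite negb_imply => /andP[ag naff].
have [few|many] := leqP #|[set xy : A * A | nontriv g xy.1 xy.2]| N0; last first.
  apply/orP; left; have [b bP] := generic_pair_exists num1 many k0.
  apply/existsP; exists (b, gmap g b); rewrite bP /=; apply/forall_inP => e _.
  by rewrite /plab !ffunE Winv.
apply/orP; right.
have [B [c [Bc B1 B2]]] := near_affine A6 g.
have BN : (n - #|B| <= N1)%N.
  apply: num3; first exact: max_card.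
    by apply: leq_trans B1 _; rewrite leq_add2r.
  exact: leq_trans B2 few.
(* If g x <> f x, compare x with x' = f^(-1) (g x). For z in B, W (z - x) = W (g z - g x) = W (f z -
   f x') = W (z - x'), so only points outside B separate x from x'. *)
have mv : forall f : A -> A, (forall z y, W X (f z - f y) = W X (z - y)) ->
  bijective f -> (forall x, x \in B -> g x = f x) -> (exists x, g x != f x) -> close_pair X N1.
  move=> f Wf [f' fK f'K] Bf [x gx].
  apply/existsP; exists (x, f' (g x)) => /=.
  apply/andP; split; first by apply: contra gx => /eqP {2}->; rewrite f'K.
  apply: leq_trans BN; rewrite leq_subRL ?max_card // -cardsUI.
  rewrite [X in (_ + X)%N](_ : _ = 0)%N ?addn0 ?max_card //.
  apply/eqP; rewrite cards_eq0 -subset0; apply/subsetP => z; rewrite !inE => /andP[zB] /eqP[].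
  by rewrite -(Winv z x sX ag) (Bf _ zB) -{1}(f'K (g x)) Wf.
case: Bc => Bc.
  apply: (mv (fun x => x + c)) => //.
  - by move=> z y; congr W; zmod.
  - by exists (fun x => x - c) => x; rewrite ?addrK ?subrK.
  apply/existsP; rewrite -negb_forall; apply: contra naff => h.
  by apply/existsP; exists c; rewrite h.
apply: (mv (fun x => c - x)) => //.
- by move=> z y; rewrite -WN; congr W; zmod.
- by exists (fun x => c - x) => x; zmod.
apply/existsP; rewrite -negb_forall; apply: contra naff => h.
by apply/existsP; exists c; rewrite h orbT.
Qed.

End Conclusion.
End Rigid.

(** * Independent blocks and exponential tails *)

Section Blocks.
Variables (Fd : realFieldType) (T I : finType) (p : Fd).
Hypotheses (p0 : 0 <= p) (p1 : p <= 1).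
Implicit Types (E : {set I}) (Bl : I -> {set T}).

Lemma bexp_prod E Bl (h : I -> {set T} -> Fd) :
  (forall e f, e \in E -> f \in E -> e != f -> [disjoint Bl e & Bl f]) ->
  (forall e X, e \in E -> h e X = h e (X :&: Bl e)) ->
  bexp p (\bigcup_(e in E) Bl e) (fun X => \prod_(e in E) h e X) =
  \prod_(e in E) bexp p (Bl e) (h e).
Proof.
elim/set_cons_ind: E => [|x E xE IH] dis loc.
  by rewrite !big_set0 bexp0 big_set0.
rewrite !big_setU1 //= bexp_split; last first.
  rewrite bigcup_disjoint // => e eE; apply: dis; rewrite ?inE ?eqxx ?eE ?orbT //.
  by apply: contraNneq xE => ->.
rewrite mulrC -bexpZ; apply: eq_bexp => Y sY.
rewrite mulrC -IH => [|e f eE fE|e X eE]; first last.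
- by apply: loc; rewrite inE eE orbT.
- by apply: dis; rewrite inE ?eE ?fE orbT.
rewrite -bexpZ; apply: eq_bexp => Z sZ; rewrite big_setU1 //=.
have dYZ e : e \in E -> [disjoint Bl x & Bl e].
  by move=> eE; apply: dis; rewrite ?inE ?eqxx ?eE ?orbT //; apply: contraNneq xE => ->.
congr (_ * _).
  rewrite loc ?inE ?eqxx // [RHS]loc ?inE ?eqxx //; congr h.
  rewrite setIUl [Z :&: _](_ : _ = set0) ?setU0 //; apply/eqP; rewrite setI_eq0.
  apply: disjointWl sZ _; rewrite disjoint_sym bigcup_disjoint //.
apply: eq_bigr => e eE; rewrite loc ?inE ?eE ?orbT // [RHS]loc ?inE ?eE ?orbT //; congr h.
rewrite setIUl [Y :&: _](_ : _ = set0) ?set0U //; apply/eqP; rewrite setI_eq0.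
by apply: disjointWl sY _; apply: dYZ.
Qed.

(** Markov's inequality for 2 to the power minus the number of occurring events; its expectation
    factors over the disjoint blocks into terms of size at most 1 - c / 2. *)
Lemma blocks_tail E Bl (Vl : I -> pred {set T}) (c : Fd) (v : nat) :
  (forall e f, e \in E -> f \in E -> e != f -> [disjoint Bl e & Bl f]) ->
  (forall e (X : {set T}), e \in E -> X \subset \bigcup_(f in E) Bl f -> Vl e X = Vl e (X :&: Bl e)) ->
  (forall e, e \in E -> c <= bprob p (Bl e) (Vl e)) ->
  bprob p (\bigcup_(e in E) Bl e) (fun X => #|[set e in E | Vl e X]| <= v)%N <=
    2%:R ^+ v * (1 - c / 2%:R) ^+ #|E|.
Proof.
move=> dis loc ge.
pose h e (X : {set T}) : Fd := if Vl e (X :&: Bl e) then 2%:R^-1 else 1.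
apply: (@le_trans _ _ (bexp p (\bigcup_(e in E) Bl e) (fun X => 2%:R ^+ v * \prod_(e in E) h e X))).
  apply: ler_bexp => // X sX.
  have -> : \prod_(e in E) h e X = 2%:R^-1 ^+ #|[set e in E | Vl e X]|.
    rewrite (eq_bigr (fun e => if Vl e X then 2%:R^-1 else 1)); last first.
      by move=> e eE; rewrite /h -loc.
    rewrite -big_mkcondr /= prodr_const; congr (_ ^+ _); apply: eq_card => e.
    by rewrite !inE.
  case: leqP => hv; last by rewrite mulr_ge0 ?exprn_ge0 ?invr_ge0 ?ler0n.
  rewrite -(subnKC hv) exprD -mulrA [_ * 2^-1 ^+ _]mulrC mulrA -exprMn divff ?pnatr_eq0 // expr1n mul1r.
  by rewrite exprn_ege1 // ler1n.
rewrite bexpZ ler_wpM2l ?exprn_ge0 ?ler0n // bexp_prod // => [|e X eE]; last first.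
  by rewrite /h -setIA setIid.
apply: (@le_trans _ _ (\prod_(e in E) (1 - c / 2%:R))); last by rewrite prodr_const.
apply: ler_prod => e eE; apply/andP; split.
  by apply: bexp_ge0 => // X _; rewrite /h; case: ifP; rewrite ?invr_ge0 ?ler0n.
have -> : bexp p (Bl e) (h e) = 1 - bprob p (Bl e) (Vl e) / 2%:R.
  rewrite -[X in X - _](bexp_const p (Bl e)) mulrC -mulNr /bprob -bexpZ -bexpD.
  apply: eq_bexp => X sX; rewrite /h (setIidPl sX); case: (Vl e X) => /=; lra.
by have := ge e eE; lra.
Qed.

End Blocks.

Section IndicatorLabels.
Variable A : finZmodType.
Hypothesis A6 : coprime #|A| 6.
Variables (Fd : realFieldType) (p : Fd).
Hypotheses (p0 : 0 <= p) (p1 : p <= 1).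

(** Genericity makes the blocks formed by the classes of d false e and d true e disjoint, and each
    block is split with probability 2 p (1 - p). *)
Lemma star_indicator (I : finType) (d : bool -> I -> A) (E : {set I}) (v : nat) :
  generic d -> (forall e, e \in E -> (d true e != d false e) && (d true e != - d false e)) ->
  bprob p (Hf A) (fun X => #|[set e in E | (d false e \in sym X) != (d true e \in sym X)]| <= v)%N
   <= 2%:R ^+ v * (1 - p * (1 - p)) ^+ #|E|.
Proof.
move=> /genericP[g1 g2 _] gE.
pose Bl e := [set rep (d false e); rep (d true e)].
have rneq e f l l' : e != f -> rep (d l e) != rep (d l' f).
  move=> ef; rewrite (eq_rep A6) negb_or.
  by rewrite (g2 e f l l' false ef) (g2 e f l l' true ef).
have dis e f : e != f -> [disjoint Bl e & Bl f].
  move=> ef; rewrite disjoint_subset; apply/subsetP => x; rewrite !inE => /orP[/eqP->|/eqP->];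
  by rewrite negb_or !rneq.
have sB : \bigcup_(e in E) Bl e \subset Hf A.
  apply/bigcupsP => e eE; apply/subsetP => x /set2P[->|->];
  by rewrite rep_Hf.
pose Vl e (X : {set A}) := (d false e \in sym X) != (d true e \in sym X).
rewrite /bprob (@bexp_marginal _ _ p (\bigcup_(e in E) Bl e)) //; last first.
  move=> X sX; congr (nat_of_bool (_ <= _)%N)%:R; apply: eq_card => e; rewrite !inE.
  case: (boolP (e \in E)) => //= eE.
  have inB l : rep (d l e) \in \bigcup_(e in E) Bl e.
    by apply/bigcupP; exists e => //; rewrite !inE; case: l; rewrite eqxx ?orbT.
  by rewrite !inB !andbT.
have -> : 1 - p * (1 - p) = 1 - (2%:R * p * (1 - p)) / 2%:R by field.
apply: (blocks_tail (Vl := Vl) p0 p1) => [e f _ _ ef|e X eE _|e eE]; first exact: dis.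
  by rewrite /Vl !inE !eqxx ?orbT !andbT.
have rr : rep (d true e) != rep (d false e).
  by rewrite (eq_rep A6) negb_or; apply: gE.
rewrite /bprob /Bl bexp_cons; last by rewrite inE eq_sym.
rewrite !bexp1 /Vl !inE !eqxx (negbTE rr) [rep (d false e) == _]eq_sym (negbTE rr) /=.
lra.
Qed.

End IndicatorLabels.

Lemma card_bigcup_le (I T : finType) (G : I -> {set T}) (m : nat) :
  (forall i, #|G i| <= m)%N -> (#|\bigcup_i G i| <= #|I| * m)%N.
Proof.
move=> h; apply: (@leq_trans (\sum_i #|G i|)).
  elim/big_rec2: _ => [|i s U _ IH]; first by rewrite cards0.
  by apply: leq_trans (leq_card_setU _ _) _; rewrite leq_add2l.
by rewrite -sum_nat_const; apply: leq_sum.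
Qed.

(** * Anticoncentration of codegrees *)

Section CodegreeLabels.
Variable A : finZmodType.
Hypothesis A6 : coprime #|A| 6.
Local Notation Hf := (Hf A).

(** At 0 the codegree is the degree, hence the exception. *)
Definition low_codeg (kap : nat) (X : {set A}) : bool :=
  [forall c, (c != 0) ==> (codeg (sym X) c <= kap)%N].

Lemma codegS (S S' : {set A}) c : S \subset S' -> (codeg S c <= codeg S' c)%N.
Proof.
move=> /subsetP s; apply: subset_leq_card; apply/subsetP => u.
by rewrite !inE => /andP[/s -> /s ->].
Qed.

Lemma low_codegS kap (X Y : {set A}) : X \subset Y -> low_codeg kap Y -> low_codeg kap X.
Proof.
move=> sXY /forallP h; apply/forallP => c; apply/implyP => c0.
by apply: leq_trans (implyP (h c) c0); apply: codegS; apply: symS.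
Qed.

Variables (I : finType) (d : bool -> I -> A) (E : {set I}).
Hypothesis gen : generic d.
Hypothesis gE : forall e, e \in E -> (d true e != d false e) && (d true e != - d false e).

Section FirstRound.
Variable X1 : {set A}.
Hypothesis sX1 : X1 \subset Hf.

(** The w such that w or -w, together with an element of X1, sums to d false g. *)
Definition sP g : {set A} := [set w | (d false g - w \in X1) || (d false g + w \in X1)].

Lemma sPN g w : (- w \in sP g) = (w \in sP g).
Proof. by rewrite !inE opprK orbC. Qed.

(** Adding y shall affect no label other than d false e. The clauses say that y is new, that neither
    y nor -y represents another label with help of X1, and that neither represents any label with
    help of an element of a block, since all blocks lie in sets [sP]. *)
Definition okA e y : bool :=
  [&& y \notin sym X1,
      [forall fl : I * bool, (d fl.2 fl.1 != d false e) ==>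
         (d fl.2 fl.1 - y \notin sym X1) && (d fl.2 fl.1 + y \notin sym X1)]
    & [forall gfl : I * (I * bool), (d gfl.2.2 gfl.2.1 - y \notin sP gfl.1) &&
         (d gfl.2.2 gfl.2.1 + y \notin sP gfl.1)]].

(** The second clause of [okA] with the second-round elements outside all blocks in place of X1. It
    is separate because the blocks must be fixed before [Z] is exposed. *)
Definition okZ (Z : {set A}) e y : bool :=
  [forall fl : I * bool, (d fl.2 fl.1 != d false e) ==>
         (d fl.2 fl.1 - y \notin sym Z) && (d fl.2 fl.1 + y \notin sym Z)].

Lemma okAN e y : okA e (- y) = okA e y.
Proof.
rewrite /okA mem_symN //; congr [&& _, _ & _].
  by apply: eq_forallb => fl; rewrite opprK andbC.
by apply: eq_forallb => fl; rewrite opprK andbC.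
Qed.

Lemma okZN Z e y : okZ Z e (- y) = okZ Z e y.
Proof. by apply: eq_forallb => fl; rewrite opprK andbC. Qed.

Definition blk e : {set A} := [set x in Hf | (x \in sP e) && okA e x].
Definition blkZ (Z : {set A}) e : {set A} := [set x in blk e | okZ Z e x].

Lemma blk_disjoint e g : e \in E -> g \in E -> e != g -> [disjoint blk e & blk g].
Proof.
move=> eE gE' eg; rewrite disjoint_subset; apply/subsetP => x; rewrite !inE.
move=> /and3P[xH xe _]; apply/negP => /and3P[_ _ /and3P[_ /forallP/(_ (e, false))]].
have [_ g2 _] := genericP gen.
rewrite /= (g2 e g false false false eg) /= => /andP[h1 h2] _.
case/orP: xe => h.
  by rewrite (mem_sym _ (subsetP sX1 _ h)) h in h1.
by rewrite (mem_sym _ (subsetP sX1 _ h)) h in h2.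
Qed.

(* The exceptional s come from representations of a fixed nonzero c as a sum
   of two elements of S; when c = 0 the equation would force -s into the half
   system X1, which is impossible. *)
Lemma card_blkZ (Z : {set A}) (kap a : nat) e : e \in E ->
  low_codeg kap (X1 :|: Z) -> (0 < kap)%N -> (2 * a + 14 * #|I| ^ 2 * kap <= #|X1|)%N ->
  (a <= #|blkZ Z e|)%N.
Proof.
move=> eE low kap0 num; set S := sym (X1 :|: Z).
have [g1 g2 g3] := genericP gen.
have SN x : (- x \in S) = (x \in S) by apply: mem_symN.
have S1S x : x \in sym X1 -> x \in S by rewrite /S symU in_setU => ->.
have SZS x : x \in sym Z -> x \in S by rewrite /S symU in_setU orbC => ->.
have lowc c : c != 0 -> (codeg S c <= kap)%N by move=> c0; apply: (implyP (forallP low c)).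
clearbody S.
have X1S x : x \in X1 -> x \in S.
  by move=> xX; apply: S1S; rewrite mem_sym // (subsetP sX1).
have cm c : c != 0 -> (#|[set s in X1 | (c - s)%R \in S]| <= kap)%N.
  move=> c0; apply: leq_trans (lowc c c0); apply: subset_leq_card; apply/subsetP => s.
  by rewrite !inE => /andP[/X1S -> ->].
have cp c : c != 0 -> (#|[set s in X1 | (c + s)%R \in S]| <= kap)%N.
  move=> c0; apply: leq_trans (lowc (- c) _); last by rewrite oppr_eq0.
  apply: subset_leq_card; apply/subsetP => s.
  by rewrite !inE => /andP[/X1S -> h]; rewrite -opprD SN.
have cmX c : (#|[set s in X1 | (c - s)%R \in X1]| <= kap)%N.
  have [->|c0] := eqVneq c 0.
    rewrite (_ : [set _ in _ | _] = set0) ?cards0 //; apply/setP => s; rewrite !inE sub0r.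
    apply/negP => /andP[/(subsetP sX1)/HfN/negP h /(subsetP sX1)]; exact: h.
  apply: leq_trans (cm c c0); apply: subset_leq_card; apply/subsetP => s.
  by rewrite !inE => /andP[-> /X1S].
have cpX c : c != 0 -> (#|[set s in X1 | (c + s)%R \in X1]| <= kap)%N.
  move=> c0; apply: leq_trans (cp c c0); apply: subset_leq_card; apply/subsetP => s.
  by rewrite !inE => /andP[-> /X1S].
pose de := d false e.
pose bad0 := [set s in X1 | de - s \in S].
pose bad1 := \bigcup_(fl : I * bool) (if d fl.2 fl.1 == de then set0 else
   [set s in X1 | (d fl.2 fl.1 - de) + s \in S] :|: [set s in X1 | (d fl.2 fl.1 + de) - s \in S]).
pose bad2 := \bigcup_(gfl : I * (I * bool)) let l := d gfl.2.2 gfl.2.1 in let dg := d false gfl.1 in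
   ([set s in X1 | (dg - l + de) - s \in X1] :|: [set s in X1 | (dg + l - de) + s \in X1]) :|:
   ([set s in X1 | (dg - l - de) + s \in X1] :|: [set s in X1 | (dg + l + de) - s \in X1]).
pose bad := (de |: bad0) :|: (bad1 :|: bad2).
pose D := X1 :\: bad.
have DP s : s \in D -> rep (de - s) \in blkZ Z e.
  case/setDP=> sX; rewrite !in_setU in_set1 !negb_or => /andP[/andP[sde nb0] /andP[nb1 nb2]].
  have y0 : de - s != 0 by rewrite subr_eq0 eq_sym.
  have H1 f l : d l f != de -> (d l f - (de - s) \notin S) && (d l f + (de - s) \notin S).
    move=> lde; apply/andP; split; apply: contra nb1 => h; apply/bigcupP; exists (f, l) => //=;
    rewrite (negbTE lde) !inE sX /=; apply/orP; [left|right].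
      by rewrite (_ : _ + _ = d l f - (de - s)) //; zmod.
    by rewrite (_ : _ - _ = d l f + (de - s)) //; zmod.
  have sy : okA e (de - s) && okZ Z e (de - s).
    rewrite /okA /okZ -!andbA; apply/and4P; split.
    - by apply: contra nb0 => /S1S h; rewrite inE sX.
    - apply/forallP => -[f l]; apply/implyP => /= lde; have /andP[h1 h2] := H1 f l lde.
      by rewrite (contra (S1S _) h1) (contra (S1S _) h2).
    - apply/forallP => -[g [f l]] /=; apply/andP; split; apply: contra nb2; rewrite inE => h;
      apply/bigcupP; exists (g, (f, l)) => //=; rewrite !inE sX /=; case/orP: h => h.
      + by rewrite (_ : _ - s = d false g - (d l f - (de - s))) ?h //; zmod.
      + by rewrite (_ : d false g + d l f - de + s = d false g + (d l f - (de - s))) ?h ?orbT //; zmod.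
      + by rewrite (_ : d false g - d l f - de + s = d false g - (d l f + (de - s))) ?h ?orbT //; zmod.
      + by rewrite (_ : d false g + d l f + de - s = d false g + (d l f + (de - s))) ?h ?orbT //; zmod.
    - apply/forallP => -[f l]; apply/implyP => /= lde; have /andP[h1 h2] := H1 f l lde.
      by rewrite (contra (SZS _) h1) (contra (SZS _) h2).
  case/andP: sy => sA sZ.
  have sPe : de - s \in sP e by rewrite inE subKr sX.
  apply/setIdP; split; first (apply/setIdP; split; first by rewrite (rep_Hf A6)).
    by case: (repE (de - s)) => ->; rewrite ?okAN ?sPN sA sPe.
  by case: (repE (de - s)) => ->; rewrite ?okZN.
(* The representative of de - s determines s up to two choices. *)
have Dle : (#|D| <= 2 * #|blkZ Z e|)%N.
  rewrite mul2n -addnn.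
  apply: (@leq_trans (#|[set de - x | x in blkZ Z e]| + #|[set de + x | x in blkZ Z e]|)).
    apply: leq_trans (leq_card_setU _ _); apply: subset_leq_card; apply/subsetP => s /DP h.
    rewrite inE; case: (repE (de - s)) => er; rewrite er in h; apply/orP; [left|right]; apply/imsetP.
      by exists (de - s); rewrite ?subKr.
    by exists (- (de - s)); rewrite ?subKr.
  by apply: leq_add; apply: leq_imset_card.
(* The contributions 1, kap, 4 |I| kap and 8 |I|^2 kap add up to at most 14 |I|^2 kap. *)
have badle : (#|bad| <= 14 * #|I| ^ 2 * kap)%N.
  have b0 : (#|de |: bad0| <= 1 + kap)%N.
    rewrite cardsU1; apply: leq_add; first by case: (_ \notin _).
    by apply: cm; apply: g1.
  have b1 : (#|bad1| <= (#|I| * 2) * (kap + kap))%N.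
    rewrite -card_bool -card_prod; apply: card_bigcup_le => -[f l] /=.
    case: eqP => [_|/eqP ne]; first by rewrite cards0.
    apply: leq_trans (leq_card_setU _ _) _; apply: leq_add.
      by apply: cp; rewrite subr_eq0.
    apply: cm; rewrite addr_eq0.
    have [fe|fe] := eqVneq f e; last exact: (g2 f e l false true fe).
    by move: ne; rewrite fe; case: (l) => [_|]; [case/andP: (gE eE) | rewrite eqxx].
  have b2 : (#|bad2| <= (#|I| * (#|I| * 2)) * ((kap + kap) + (kap + kap)))%N.
    rewrite -card_bool -!card_prod; apply: card_bigcup_le => -[g [f l]] /=.
    apply: leq_trans (leq_card_setU _ _) _; apply: leq_add.
      apply: leq_trans (leq_card_setU _ _) _; apply: leq_add => //; apply: cpX.
      have [ge|ge] := eqVneq e g; first by rewrite -ge (_ : d false e + d l f - de = d l f) ?g1 // /de; zmod.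
      have := g3 e g f l ge; apply: contra; rewrite /de => /eqP h; apply/eqP; zmod_from h.
    apply: leq_trans (leq_card_setU _ _) _; apply: leq_add => //; apply: cpX.
    have [ge|ge] := eqVneq g e; first by rewrite ge (_ : d false e - d l f - de = - d l f) ?oppr_eq0 ?g1 // /de; zmod.
    have := g3 g e f l ge; apply: contra; rewrite /de => /eqP h; apply/eqP; zmod_from h.
  have I0 : (0 < #|I|)%N by apply/card_gt0P; exists e.
  apply: leq_trans (leq_card_setU _ _) _; apply: leq_trans (leq_add b0 (leq_card_setU _ _)) _.
  by move: b1 b2; nia.
have : (#|X1| - #|bad| <= #|D|)%N by rewrite cardsD leq_sub2l // subset_leq_card // subsetIr.
by move: num badle Dle; lia.
Qed.

Local Notation AA := (\bigcup_(e in E) blk e).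

(** The second clause of [okA], [okZ] and the third clause of [okA] deal with the parts X1, Z and B
    of the final set in turn; an element of B lies in some block, hence in some [sP]. *)
Lemma blocked (Z B : {set A}) g x u f l : g \in E -> x \in blkZ Z g -> B \subset AA ->
  d l f != d false g -> rep u = x -> d l f - u \notin sym (X1 :|: (Z :|: B)).
Proof.
move=> gE' /setIdP[/setIdP[_ /andP[_ oA]] oZ] sB lg ux.
have {}oA : okA g u by move: oA; rewrite -ux; case: (repE u) => ->; rewrite ?okAN.
have {}oZ : okZ Z g u by move: oZ; rewrite -ux; case: (repE u) => ->; rewrite ?okZN.
case/and3P: oA => _ /forallP/(_ (f, l)) /= oA /forallP oP.
move/forallP/(_ (f, l)): oZ => /= oZ.
case/andP: (implyP oA lg) => h1 _; case/andP: (implyP oZ lg) => h2 _.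
rewrite !symU !in_setU (negbTE h1) (negbTE h2) /=; apply/negP; rewrite inE => /(subsetP sB)/bigcupP[h hE].
case/setIdP => _ /andP[hP _].
have : d l f - u \in sP h by case: (repE (d l f - u)) hP => ->; rewrite ?sPN.
by have /andP[/negbTE -> _] := oP (h, (f, l)).
Qed.

Section SecondRound.
Variables (Z Z' : {set A}) (Bl : I -> {set A}).
Hypothesis dZ : [disjoint Z & AA].
Hypothesis sBl : forall e, e \in E -> Bl e \subset blkZ Z e.
Hypothesis sZ' : Z' \subset AA :\: \bigcup_(e in E) Bl e.

Local Notation full T := (X1 :|: (Z :|: (Z' :|: T))).

Lemma Bl_sub : \bigcup_(e in E) Bl e \subset AA.
Proof.
apply/bigcupsP => e eE; apply/subsetP => x /(subsetP (sBl eE))/setIdP[xb _].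
by apply/bigcupP; exists e.
Qed.

(** By [blocked], an element of T from another block takes part in no representation of a label of
    e. This is the locality that [blocks_tail] requires. *)
Lemma codeg_loc e l (T : {set A}) : e \in E -> T \subset \bigcup_(f in E) Bl f ->
  codeg (sym (full T)) (d l e) = codeg (sym (full (T :&: Bl e))) (d l e).
Proof.
move=> eE sT; have [g1 g2 _] := genericP gen.
have sB : Z' :|: T \subset AA.
  by rewrite subUset (subset_trans sZ' (subsetDl _ _)) (subset_trans sT Bl_sub).
have key u : u \in sym (full T) -> d l e - u \in sym (full T) -> u \in sym (full (T :&: Bl e)).
  move=> uS uS'; move: (uS); rewrite !symU !in_setU.
  case: (u \in sym X1) => //=; case: (u \in sym Z) => //=; case: (u \in sym Z') => //=.
  rewrite !inE => uT; rewrite uT /=; apply/negPn/negP => nu.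
  have /bigcupP[g gE' ug] := subsetP sT _ uT.
  have eg : e != g by apply: contraNneq nu => ->.
  have := blocked (u := u) gE' (subsetP (sBl gE') _ ug) sB (g2 e g l false false eg) erefl.
  by rewrite uS'.
apply/eqP; rewrite eqn_leq; apply/andP; split; last first.
  by apply: codegS; apply: symS; rewrite !setUS // subsetIl.
apply: subset_leq_card; apply/subsetP => u /setIdP[h1 h2].
by apply/setIdP; split; [exact: key | apply: key; rewrite ?subKr].
Qed.

(** As x lies in [sP e], it completes a representation of d false e with X1, while [blocked] keeps
    it out of those of d true e. So if the two codegrees agree without x, they differ with it. *)
Lemma codeg_change e x : e \in E -> x \in Bl e ->
  (codeg (sym (full set0)) (d false e) < codeg (sym (full [set x])) (d false e))%N /\
  codeg (sym (full set0)) (d true e) = codeg (sym (full [set x])) (d true e).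
Proof.
move=> eE xB; have xb := subsetP (sBl eE) _ xB.
have xAA : x \in AA.
  by apply: (subsetP Bl_sub); apply/bigcupP; exists e.
case/setIdP: (xb) => /setIdP[xH /andP[xP oA]] _.
have xn : x \notin full set0.
  rewrite !in_setU in_set0 orbF !negb_or; apply/and3P; split.
  - by case/and3P: oA => h _ _; rewrite mem_sym in h.
  - by rewrite (disjointFl dZ xAA).
  - by apply/negP => /(subsetP sZ'); rewrite inE => /andP[/negP h _]; apply: h; apply/bigcupP; exists e.
have sub : sym (full set0) \subset sym (full [set x]).
  by apply: symS; rewrite !setUS // sub0set.
split.
  apply: proper_card; apply/properP; split.
    apply/subsetP => u /setIdP[h1 h2].
    by apply/setIdP; rewrite (subsetP sub _ h1) (subsetP sub _ h2).
  have [u ux uX] : exists2 u, rep u = x & d false e - u \in X1.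
    rewrite inE in xP; case/orP: xP => h; first by exists x => //; rewrite rep_id.
    by exists (- x); rewrite ?opprK // repN // rep_id.
  exists u.
    apply/setIdP; split; first by rewrite inE ux !in_setU in_set1 eqxx !orbT.
    by rewrite symU in_setU (mem_sym _ (subsetP sX1 _ uX)) uX.
  by apply: contra xn => /setIdP[+ _]; rewrite inE ux.
apply/eqP; rewrite eqn_leq; apply/andP; split; first exact: codegS.
have sB : Z' :|: [set x] \subset AA.
  by rewrite subUset (subset_trans sZ' (subsetDl _ _)) sub1set.
have ne : d true e != d false e by case/andP: (gE eE).
have key u : u \in sym (full [set x]) -> d true e - u \in sym (full [set x]) -> u \in sym (full set0).
  move=> h1 h2; case: (eqVneq (rep u) x) => [ux|ux].
    by have := blocked eE xb sB ne ux; rewrite h2.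
  by move: h1; rewrite !inE (negbTE ux) !orbF.
apply: subset_leq_card; apply/subsetP => u /setIdP[h1 h2].
by apply/setIdP; split; [exact: key | apply: key; rewrite ?subKr].
Qed.

End SecondRound.
End FirstRound.

Section Probability.
Variables (Fd : realFieldType).

(** The event holds at the empty set or else at all singletons, and either possibility has
    probability at least c. *)
Lemma bprob_small_ge (p c : Fd) (B : {set A}) (V : pred {set A}) : 0 <= p -> p <= 1 ->
  c <= (1 - p) ^+ #|B| -> c <= #|B|%:R * (p * (1 - p) ^+ #|B|.-1) ->
  (~~ V set0 -> forall x, x \in B -> V [set x]) -> c <= bprob p B V.
Proof.
move=> p0 p1 c1 c2 HV.
have q0 : 0 <= 1 - p by rewrite subr_ge0.
have t0 (X : {set A}) : 0 <= p ^+ #|X| * (1 - p) ^+ #|B :\: X| * (V X)%:R.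
  by rewrite !mulr_ge0 ?exprn_ge0 ?ler0n.
case: (boolP (V set0)) => V0.
  apply: le_trans c1 _; rewrite /bprob /bexp (bigD1 set0) ?sub0set //= V0 cards0 setD0 expr0 mul1r mulr1.
  by rewrite lerDl; apply: sumr_ge0 => X _.
apply: le_trans c2 _.
apply: (@le_trans _ _ (\sum_(X in [set [set x] | x in B]) p ^+ #|X| * (1 - p) ^+ #|B :\: X| * (V X)%:R)).
  rewrite big_imset /=; last by move=> x y _ _ /set1_inj.
  rewrite mulr_natl -sumr_const; apply: ler_sum => x xB.
  by rewrite (HV V0 x xB) cards1 expr1 mulr1 cardsDS ?sub1set // cards1 subn1.
rewrite /bprob /bexp [X in _ <= X](bigID (mem [set [set x] | x in B])) /=.
rewrite (eq_bigl (fun X : {set A} => (X \subset B) && (X \in [set [set x] | x in B]))); last first.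
  move=> X; rewrite andbC; case: imsetP => // -[x xB ->]; by rewrite sub1set xB.
by rewrite lerDl; apply: sumr_ge0 => X _.
Qed.

Variables (p p1 p2 c : Fd) (kap a v : nat).
Hypotheses (p10 : 0 <= p1) (p11 : p1 <= 1) (p20 : 0 <= p2) (p21 : p2 <= 1).
Hypothesis pE : 1 - p = (1 - p1) * (1 - p2).
Hypotheses (c1 : c <= (1 - p2) ^+ a) (c2 : c <= a%:R * (p2 * (1 - p2) ^+ a.-1)).
Hypothesis kap0 : (0 < kap)%N.

(** The second round is exposed outside all blocks ([Z]), then on the surplus of the blocks ([Z']),
    then on the trimmed blocks, and all but the last stage are conditioned on. The construction can
    fail only through a small X1, charged to the last term, or a large codegree, excluded by
    [low_codeg]. *)
Lemma star_codeg :
  bprob p Hf (fun X => low_codeg kap X &&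
    (#|[set e in E | codeg (sym X) (d false e) != codeg (sym X) (d true e)]| <= v)%N)
  <= 2%:R ^+ v * (1 - c / 2%:R) ^+ #|E| +
     bprob p1 Hf (fun X => #|X| < 2 * a + 14 * #|I| ^ 2 * kap)%N.
Proof.
set m0 := (_ + _)%N.
have c1' : c <= 1.
  by apply: le_trans c1 _; apply: exprn_ile1; rewrite ?subr_ge0 // lerBlDr lerDl.
have K0 : 0 <= 2%:R ^+ v * (1 - c / 2%:R) ^+ #|E|.
  by rewrite mulr_ge0 ?exprn_ge0 // subr_ge0; move: c1'; lra.
set K := (X in X + _); rewrite -/K in K0.
rewrite /bprob (bexp_sprinkle _ _ pE) -[X in _ <= X + _](bexp_const p1 Hf) -bexpD.
apply: ler_bexp => // X1 sX1; case: ltnP => hX1.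
  apply: le_trans (bprob_le1 p20 p21 Hf (fun Y => low_codeg kap (X1 :|: Y) && _)) _.
  by rewrite /= lerDr.
rewrite addr0.
pose AA := \bigcup_(e in E) blk X1 e.
have sAA : AA \subset Hf by apply/bigcupsP => e eE; apply/subsetP => x /setIdP[].
have -> : Hf = (Hf :\: AA) :|: AA.
  by rewrite setUC -{1}(setIidPr sAA) setID.
rewrite bexp_split; last by rewrite -setI_eq0 setIDAC setDIl setDv setI0.
rewrite -[X in _ <= X](bexp_const p2 (Hf :\: AA)); apply: ler_bexp => // Z sZ.
have dZ : [disjoint Z & AA].
  by apply: disjointWl sZ _; rewrite -setI_eq0 setIDAC setDIl setDv setI0.
have [low|nlow] := boolP (low_codeg kap (X1 :|: Z)); last first.
  (* Codegrees only grow as more is exposed, so the event is impossible here. *)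
  apply: le_trans K0; rewrite -[X in _ <= X](bexp_const p2 AA 0); apply: ler_bexp => // B sB.
  rewrite [X in nat_of_bool X](contraNF _ nlow) // => /andP[h _]; apply: low_codegS h.
  by rewrite setUS // subsetUl.
(* Blocks are cut to exactly a elements, the size for which c is assumed to be a lower bound. The
   cut depends on X1 and Z only. *)
pose Bl e := [set x in take a (enum (blkZ X1 Z e))].
have sBl e : e \in E -> Bl e \subset blkZ X1 Z e.
  by move=> _; apply/subsetP => x; rewrite inE => /mem_take; rewrite mem_enum.
have cBl e : e \in E -> #|Bl e| = a.
  move=> eE; rewrite cardsE; have /card_uniqP -> : uniq (take a (enum (blkZ X1 Z e))).
    exact/take_uniq/enum_uniq.
  by rewrite size_takel // -cardE; apply: (card_blkZ sX1 eE low kap0 hX1).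
have sB0 : \bigcup_(e in E) Bl e \subset AA by apply: Bl_sub sBl.
have -> : AA = (AA :\: \bigcup_(e in E) Bl e) :|: \bigcup_(e in E) Bl e.
  by rewrite setUC -{1}(setIidPr sB0) setID.
rewrite bexp_split; last by rewrite -setI_eq0 setIDAC setDIl setDv setI0.
rewrite -[X in _ <= X](bexp_const p2 (AA :\: \bigcup_(e in E) Bl e)); apply: ler_bexp => // Z' sZ'.
pose Vl e T := codeg (sym (X1 :|: (Z :|: (Z' :|: T)))) (d false e) !=
               codeg (sym (X1 :|: (Z :|: (Z' :|: T)))) (d true e).
apply: (@le_trans _ _ (bprob p2 (\bigcup_(e in E) Bl e) (fun T => #|[set e in E | Vl e T]| <= v)%N)).
  by apply: ler_bprob => // T _ /andP[].
apply: blocks_tail => // [e f eE fE ef|e T eE sT|e eE].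
- have sb g : g \in E -> Bl g \subset blk X1 g.
    by move=> gE'; apply: subset_trans (sBl g gE') _; apply/subsetP => x /setIdP[].
  by apply: disjointWl (sb e eE) _; apply: disjointWr (sb f fE) _; apply: blk_disjoint.
- by rewrite /Vl !(codeg_loc sBl sZ' _ eE sT).
apply: bprob_small_ge; rewrite ?cBl // => nV x xB.
have [h1 h2] := codeg_change sX1 dZ sBl sZ' eE xB.
by rewrite /Vl -h2 -(eqP (negPn nV)) neq_ltn h1 orbT.
Qed.

End Probability.
End CodegreeLabels.

(** * Additive collisions in sparse sets *)

Section Greedy.
Variables (I T : finType) (D : {set I}) (G : I -> {set T}) (f K : nat).
Hypothesis f0 : (0 < f)%N.
Hypothesis K0 : (0 < K)%N.
Hypothesis Gf : forall i, i \in D -> #|G i| = f.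
Hypothesis GK : forall x, (#|[set i in D | x \in G i]| <= K)%N.

(** Chosen sets covering m f points block at most m f K indices; while fewer than |D| are blocked,
    another set can be added. *)
Lemma greedy_disjoint m : (m * (f * K) <= #|D|)%N ->
  exists D' : {set I}, [/\ D' \subset D, #|D'| = m &
    forall i j, i \in D' -> j \in D' -> i != j -> [disjoint G i & G j]].
Proof.
elim: m => [_|m IH hm]; first by exists set0; split; rewrite ?sub0set ?cards0 // => i j; rewrite inE.
have [|D' [sD cD disD]] := IH; first by apply: leq_trans hm; rewrite leq_mul2r leqnSn orbT.
pose C := \bigcup_(i in D') G i.
have cC : (#|C| <= m * f)%N.
  rewrite -cD -sum_nat_const; apply: (@leq_trans (\sum_(i in D') #|G i|)).
    rewrite /C; elim/big_rec2: _ => [|i s U _ h]; first by rewrite cards0.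
    by apply: leq_trans (leq_card_setU _ _) _; rewrite leq_add2l.
  by apply: leq_sum => i iD; rewrite Gf // (subsetP sD).
pose B := \bigcup_(x in C) [set i in D | x \in G i].
have cB : (#|B| <= #|C| * K)%N.
  rewrite -sum_nat_const; apply: (@leq_trans (\sum_(x in C) #|[set i in D | x \in G i]|)).
    rewrite /B; elim/big_rec2: _ => [|i s U _ h]; first by rewrite cards0.
    by apply: leq_trans (leq_card_setU _ _) _; rewrite leq_add2l.
  exact: leq_sum.
have : (0 < #|D :\: B|)%N.
  have : (#|D| - #|B| <= #|D :\: B|)%N.
    by rewrite cardsD leq_sub2l // subset_leq_card // subsetIr.
  apply: leq_trans; rewrite subn_gt0; apply: leq_ltn_trans cB _.
  apply: leq_ltn_trans (leq_mul cC (leqnn K)) _; apply: leq_trans hm.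
  by rewrite -mulnA mulSn -[X in (X < _)%N]add0n ltn_add2r muln_gt0 f0.
rewrite card_gt0 => /set0Pn[i /setDP[iD iB]].
have iC j : j \in D' -> [disjoint G i & G j].
  move=> jD; rewrite disjoint_subset; apply/subsetP => x xi; rewrite inE; apply: contra iB => xj.
  by apply/bigcupP; exists x; [apply/bigcupP; exists j | rewrite inE iD].
have iD' : i \notin D'.
  apply/negP => h; have := iC _ h; rewrite -setI_eq0 setIid -cards_eq0 Gf // => /eqP e.
  by move: f0; rewrite e.
exists (i |: D'); split.
- by rewrite subUset sub1set iD.
- by rewrite cardsU1 iD' cD.
move=> a b /setU1P[->|aD] /setU1P[->|bD] ab; first by rewrite eqxx in ab.
- exact: iC.
- by rewrite disjoint_sym; apply: iC.
- exact: disD.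
Qed.

Lemma greedy_family m (X : {set T}) : (forall i, i \in D -> G i \subset X) ->
  (m * (f * K) <= #|D|)%N ->
  [exists GG : {set {set T}}, [&& GG \subset G @: D, #|GG| == m, trivIset GG
     & [forall B in GG, B \subset X]]].
Proof.
move=> GX /greedy_disjoint[D' [sD cD disD]].
apply/existsP; exists (G @: D'); apply/and4P; split.
- exact: imsetS.
- rewrite card_in_imset ?cD // => i j iD jD Gij; apply/eqP/negPn/negP => ij.
  have := disD i j iD jD ij; rewrite Gij -setI_eq0 setIid -cards_eq0 Gf ?(subsetP sD) // => /eqP e.
  by move: f0; rewrite e.
- apply/trivIsetP => _ _ /imsetP[i iD ->] /imsetP[j jD ->] h.
  by apply: disD => //; apply: contraNneq h => ->.
- by apply/forall_inP => _ /imsetP[i iD ->]; apply: GX; apply: (subsetP sD).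
Qed.

End Greedy.

Section Collisions.
Variable A : finZmodType.
Hypothesis A6 : coprime #|A| 6.
Local Notation Hf := (Hf A).
Local Notation n := #|A|.
Implicit Types (x y s t u : A) (S X : {set A}).

Definition codeg2 S s : nat := #|[set t in S | s + (t + t) \in S]|.

Definition low_codeg2 (kap : nat) X : bool :=
  [forall c, (c != 0) ==> (codeg2 (sym X) c <= kap)%N].

Lemma card_set4 (D : {set A}) (a b c e : A) :
  (forall t, t \in D -> [|| t == a, t == b, t == c | t == e]) -> (#|D| <= 4)%N.
Proof.
move=> h; apply: (@leq_trans #|[set a; b; c; e]|).
  by apply: subset_leq_card; apply/subsetP => t /h; rewrite !inE !orbA.
do 2! [apply: leq_trans (leq_card_setU _ _) _; rewrite cards1 addn1 ltnS].
by rewrite cards2; case: (_ != _).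
Qed.

Lemma card_set2 (D : {set A}) (a b : A) :
  (forall t, t \in D -> (t == a) || (t == b)) -> (#|D| <= 2)%N.
Proof.
move=> h; apply: (@leq_trans #|[set a; b]|).
  by apply: subset_leq_card; apply/subsetP => t /h; rewrite !inE.
by rewrite cards2; case: (_ != _).
Qed.

Lemma rep_sub2 X t u : t \in sym X -> u \in sym X -> [set rep t; rep u] \subset X.
Proof. by rewrite !inE => h1 h2; rewrite subUset !sub1set h1. Qed.

Section Prob.
Variables (Fd : realFieldType) (p : Fd) (m kap : nat).
Hypotheses (p0 : 0 <= p) (p1 : p <= 1).

(** A class lies in at most 4 of the pairs {rep t, rep (w t)}, so more than |E| + 8 m values of t
    yield m disjoint pairs. [E] collects the t whose pair degenerates. *)
Lemma pair_family_prob (w : A -> A) (E : {set A}) (kap' : nat) : injective w ->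
  (forall t, t \notin E -> (t != w t) && (t != - w t)) -> (#|E| + 8 * m <= kap')%N ->
  bprob p Hf (fun X => kap' < #|[set t in sym X | w t \in sym X]|)%N <=
    (n%:R * p ^+ 2) ^+ m / m`!%:R.
Proof.
move=> winj wE num.
pose G t := [set rep t; rep (w t)].
pose V := [set t : A | [&& t \notin E, t != 0 & w t != 0]].
pose FF := G @: V.
apply: (@le_trans _ _ ((#|FF|%:R * p ^+ 2) ^+ m / m`!%:R)); last first.
  apply: ler_wpM2r; first by rewrite invr_ge0 ler0n.
  rewrite lerXn2r ?nnegrE ?mulr_ge0 ?ler0n ?exprn_ge0 //; apply: ler_wpM2r; first exact: exprn_ge0.
  by rewrite ler_nat; apply: leq_trans (leq_imset_card _ _) (max_card _).
apply: le_trans (bprob_disjoint_family m p0 p1 (f := 2) (FF := FF) (J := Hf) _); last first.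
  move=> _ /imsetP[t tV ->]; move: tV; rewrite inE => /and3P[tE t0 wt0]; split.
    by rewrite subUset !sub1set !(rep_Hf A6) t0.
  by rewrite cards2 (eq_rep A6) negb_or wE.
apply: ler_bprob => // X sX big.
pose D := [set t in sym X | w t \in sym X] :\: E.
have S0 x : x \in sym X -> x != 0 by apply: contraTneq => ->; apply: sym0.
have DV t : t \in D -> t \in V.
  by case/setDP => /setIdP[h1 h2] tE; rewrite inE tE !S0.
suff /existsP[GG /and4P[h1 h2 h3 h4]] : [exists GG : {set {set A}},
    [&& GG \subset G @: D, #|GG| == m, trivIset GG & [forall B in GG, B \subset X]]].
  apply/existsP; exists GG; rewrite h2 h3 h4 !andbT.
  by apply: subset_trans h1 _; apply: imsetS; apply/subsetP => t; apply: DV.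
apply: (@greedy_family A A D G 2 4).
- by [].
- by [].
- by move=> t /DV; rewrite inE => /and3P[tE _ _]; rewrite cards2 (eq_rep A6) negb_or wE.
- move=> x; have wex y : exists z, forall t, (w t == y) -> t == z.
    case: (pickP (fun t => w t == y)) => [z /eqP zy|h]; last by exists 0 => t; rewrite h.
    by exists z => t /eqP; rewrite -zy => /winj ->.
  have [z1 h1] := wex x; have [z2 h2] := wex (- x).
  apply: (@card_set4 _ x (- x) z1 z2) => t /setIdP[_ /set2P[xt|xt]]; rewrite xt.
    by case: (repE t) => ->; rewrite ?opprK eqxx ?orbT.
  case: (repE (w t)) => e; first by rewrite -xt in e; rewrite h1 ?orbT // e.
  by rewrite -xt in e; rewrite (h2 t) ?orbT // e opprK.
- by move=> t /setDP[/setIdP[h1 h2] _]; apply: rep_sub2.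
- have : (#|[set t in sym X | w t \in sym X]| - #|E| <= #|D|)%N.
    by rewrite cardsD leq_sub2l // subset_leq_card // subsetIr.
  by move: big num; lia.
Qed.

Lemma union_nz (Q : A -> pred {set A}) (b : Fd) : 0 <= b ->
  (forall c, c != 0 -> bprob p Hf (fun X => ~~ Q c X) <= b) ->
  bprob p Hf (fun X => ~~ [forall c, (c != 0) ==> Q c X]) <= n%:R * b.
Proof.
move=> b0 h; apply: (@le_trans _ _ (bprob p Hf (fun X => [exists c, (c != 0) && ~~ Q c X]))).
  apply: ler_bprob => // X _; rewrite negb_forall => /existsP[c]; rewrite negb_imply => hc.
  by apply/existsP; exists c.
apply: le_trans (bprob_union p0 p1 (b := b) h) _.
by rewrite ler_wpM2r // ler_nat max_card.
Qed.

Local Notation b2 := ((n%:R * p ^+ 2) ^+ m / m`!%:R).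
Local Notation b3 := (((n ^ 2)%:R * p ^+ 3) ^+ m / m`!%:R).

Lemma b2_ge0 : 0 <= b2.
Proof. by rewrite divr_ge0 ?exprn_ge0 ?mulr_ge0 ?exprn_ge0 ?ler0n. Qed.

Lemma b3_ge0 : 0 <= b3.
Proof. by rewrite divr_ge0 ?exprn_ge0 ?mulr_ge0 ?exprn_ge0 ?ler0n. Qed.

Lemma low_codeg_prob : (8 * m + 2 <= kap)%N ->
  bprob p Hf (fun X => ~~ low_codeg kap X) <= n%:R * b2.
Proof.
move=> num; apply: (union_nz b2_ge0) => c c0.
apply: le_trans (@pair_family_prob (fun t => c - t) [set t | t + t == c] kap _ _ _).
- by apply: ler_bprob => // X _; rewrite -ltnNge.
- by move=> x y /addrI/oppr_inj.
- move=> t; rewrite inE => tc; apply/andP; split.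
    by apply: contra tc => /eqP e; apply/eqP; zmod_from e.
  by apply: contra c0 => /eqP e; apply/eqP; zmod_from e.
- apply: leq_trans num; rewrite addnC leq_add2l; apply: (@leq_trans 1) => //.
  rewrite leqNgt; apply/negP => /card_gt1P[x [y []]]; rewrite !inE => /eqP <- /eqP/(dbl_inj A6) ->.
  by rewrite eqxx.
Qed.

(** The pair degenerates for t = -c and 3t = -c, at most two values because n is prime to 3. *)
Lemma low_codeg2_prob : (8 * m + 2 <= kap)%N ->
  bprob p Hf (fun X => ~~ low_codeg2 kap X) <= n%:R * b2.
Proof.
move=> num; apply: (union_nz b2_ge0) => c c0.
apply: le_trans (@pair_family_prob (fun t => c + (t + t)) [set t | (c + t == 0) || (t + t + t == - c)] kap _ _ _).
- by apply: ler_bprob => // X _; rewrite -ltnNge.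
- by move=> x y /addrI/(dbl_inj A6).
- move=> t; rewrite inE negb_or => /andP[t1 t2]; apply/andP; split.
    by apply: contra t1 => /eqP e; apply/eqP; zmod_from e.
  by apply: contra t2 => /eqP e; apply/eqP; zmod_from e.
- apply: leq_trans num; rewrite addnC leq_add2l.
  have [z hz] : exists z, forall t : A, t + t + t = - c -> t = z.
    case: (pickP (fun t => t + t + t == - c)) => [z /eqP zc|h]; last by exists 0 => t /eqP; rewrite h.
    exists z => t tc; apply/eqP; rewrite -subr_eq0 -(tpl_eq0 A6); apply/eqP.
    by apply: (@etrans _ _ ((t + t + t) - (z + z + z))); [zmod | rewrite tc zc; zmod].
  apply: (@card_set2 _ (- c) z) => t; rewrite inE => /orP[/eqP e|/eqP/hz ->]; last by rewrite eqxx orbT.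
  by apply/orP; left; apply/eqP; zmod_from e.
Qed.

(* s + t = u + v with {u, v} <> {s, t} and t, u, v in distinct classes *)
Definition nondeg S s t u : bool :=
  [&& t \in S, u \in S, s + t - u \in S, u != s & u != t] &&
  [&& u != - t, s + t - u != - t, u != s + t - u & s + t != 0].

Definition ndset S s : {set A} := [set t | [exists u, nondeg S s t u]].

(** For fixed s a collision is given by t and u, hence n^2 triples of classes. A class lies in at
    most 2 + 2 kap <= 6 kap of the chosen triples: once u or v is known, v - t = s - u or u - t = s
    - v is a fixed nonzero difference of elements of S. *)
Lemma ndset_prob (N : nat) s : (0 < kap)%N -> (m * (3 * (6 * kap)) <= N)%N ->
  bprob p Hf (fun X => low_codeg kap X && (N <= #|ndset (sym X) s|)%N) <= b3.
Proof.
move=> kap0 num.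
pose G3 (tu : A * A) := [set rep tu.1; rep tu.2; rep (s + tu.1 - tu.2)].
pose FF := G3 @: [set tu : A * A | [&& tu.1 != 0, tu.2 != 0, s + tu.1 - tu.2 != 0 & #|G3 tu| == 3]].
apply: (@le_trans _ _ ((#|FF|%:R * p ^+ 3) ^+ m / m`!%:R)); last first.
  apply: ler_wpM2r; first by rewrite invr_ge0 ler0n.
  rewrite lerXn2r ?nnegrE ?mulr_ge0 ?ler0n ?exprn_ge0 //; apply: ler_wpM2r; first exact: exprn_ge0.
  rewrite ler_nat; apply: leq_trans (leq_imset_card _ _) _; apply: leq_trans (max_card _) _.
  by rewrite card_prod -mulnn.
apply: le_trans (bprob_disjoint_family m p0 p1 (f := 3) (FF := FF) (J := Hf) _); last first.
  move=> _ /imsetP[[t u] tV ->]; move: tV; rewrite inE => /and4P[h1 h2 h3 /eqP h4]; split=> //.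
  by rewrite !subUset !sub1set !(rep_Hf A6) h1 h2 h3.
apply: ler_bprob => // X sX /andP[low big]; set S := sym X in big.
have S0 x : x \in S -> x != 0 by apply: contraTneq => ->; apply: sym0.
have SN x : (- x \in S) = (x \in S) by apply: mem_symN.
have Srep x : x \in S -> rep x \in X by rewrite inE.
have lowc c : c != 0 -> (codeg S c <= kap)%N by move=> c0; apply: (implyP (forallP low c)).
clearbody S.
pose D := ndset S s.
(* One collision is chosen for each t; on [D] the default 0 is not reached. *)
pose wit t := odflt 0 [pick u | nondeg S s t u].
have witP t : t \in D -> nondeg S s t (wit t).
  rewrite inE => /existsP[u0 hu0]; rewrite /wit; case: pickP => [u //|h].
  by rewrite h in hu0.
pose G t := G3 (t, wit t).
have G3c t u : nondeg S s t u -> #|G3 (t, u)| = 3.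
  case/andP => /and5P[h1 h2 h3 h4 h5] /and4P[h6 h7 h8 h9]; rewrite /G3 /= setUC cardsU1 cards2 !inE !(eq_rep A6).
  rewrite !negb_or [t == u]eq_sym h5 (_ : t != - u); last first.
    by apply: contra h6 => /eqP ->; rewrite opprK.
  rewrite h7 (_ : s + t - u != t); last first.
    by apply: contra h4 => /eqP e; apply/eqP; zmod_from e.
  rewrite [s + t - u == u]eq_sym h8 (_ : s + t - u != - u) //.
  by apply: contra h9 => /eqP e; apply/eqP; zmod_from e.
have cD c : c != 0 -> (#|[set t in D | (t + c)%R \in S]| <= kap)%N.
  move=> c0; apply: leq_trans (lowc (- c) _); last by rewrite oppr_eq0.
  apply: subset_leq_card; apply/subsetP => t /setIdP[/witP/andP[/and5P[tS _ _ _ _] _] tc].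
  by rewrite inE tS -SN (_ : - _ = t + c) //; zmod.
suff /existsP[GG /and4P[h1 h2 h3 h4]] : [exists GG : {set {set A}},
    [&& GG \subset G @: D, #|GG| == m, trivIset GG & [forall B in GG, B \subset X]]].
  apply/existsP; exists GG; rewrite h2 h3 h4 !andbT.
  apply: subset_trans h1 _; apply/subsetP => _ /imsetP[t /witP tD ->].
  apply/imsetP; exists (t, wit t) => //; rewrite inE (G3c _ _ tD) eqxx andbT.
  by case/andP: tD => /and5P[tS uS vS _ _] _; rewrite !S0.
apply: (@greedy_family A A D G 3 (6 * kap)).
- by [].
- by rewrite muln_gt0 kap0.
- by move=> t /witP; apply: G3c.
- move=> x.
  pose T0 := [set t in D | (t == x) || (t == - x)].
  pose T1 y := [set t in D | (y != s) && (t + (s - y) \in S)].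
  have cT0 : (#|T0| <= 2)%N by apply: (@card_set2 _ x (- x)) => t /setIdP[].
  have cT1 y : (#|T1 y| <= kap)%N.
    have [ys|ys] := eqVneq y s.
      by rewrite (_ : T1 y = set0) ?cards0 //; apply/setP => t; rewrite !inE ys eqxx /= andbF.
    apply: leq_trans (cD (s - y) _); last by rewrite subr_eq0 eq_sym.
    by apply: subset_leq_card; apply/subsetP => t /setIdP[tD /andP[_ h]]; rewrite inE tD.
  apply: (@leq_trans #|T0 :|: ((T1 x :|: T1 (- x)))|).
    apply: subset_leq_card; apply/subsetP => t /setIdP[tD].
    have /andP[/and5P[h1 h2 h3 h4 h5] _] := witP t tD.
    have k1 : t \in T1 (wit t).
      by apply/setIdP; rewrite tD h4 (_ : t + (s - wit t) = s + t - wit t) //; zmod.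
    have k2 : t \in T1 (s + t - wit t).
      apply/setIdP; split=> //; apply/andP; split; last by rewrite (_ : t + _ = wit t) //; zmod.
      by apply: contra h5 => /eqP e; apply/eqP; zmod_from e.
    rewrite /G /G3 /= => /setUP[/set2P[ex|ex]|/set1P ex]; rewrite /T0 ex.
    + apply/setUP; left; apply/setIdP; split=> //.
      by case: (repE t) => ->; rewrite ?opprK eqxx ?orbT.
    + apply/setUP; right; apply/setUP.
      by case: (repE (wit t)) => ->; rewrite ?opprK; [left | right].
    + apply/setUP; right; apply/setUP.
      by case: (repE (s + t - wit t)) => ->; rewrite ?opprK; [left | right].
  apply: leq_trans (leq_card_setU _ _) _; apply: leq_trans (leq_add cT0 (leq_card_setU _ _)) _.
  by move: (cT1 x) (cT1 (- x)); lia.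
- move=> t /witP /andP[/and5P[tS uS vS _ _] _].
  by rewrite /G /G3 /= !subUset !sub1set !Srep.
- exact: leq_trans num big.
Qed.

Definition badset S s : {set A} := [set t in S | (t == s) || (codeg S (s + t) != 2)].

(** If s + t = u + v is a further representation outside [ndset], it is degenerate: u or v is -t, so
    s + 2t is in S; or u = v, so t = 2u - s; or t = -s. The first two kinds are counted by [codeg2],
    the second after replacing u by -u. *)
Lemma card_badset X s : X \subset Hf -> s \in sym X -> s != 0 -> low_codeg2 kap X ->
  (#|badset (sym X) s| <= #|ndset (sym X) s| + 2 * kap + 2)%N.
Proof.
move=> sX sS s0 low2; set S := sym X in sS *.
have SN x : (- x \in S) = (x \in S) by apply: mem_symN.
have low : (codeg2 S s <= kap)%N by apply: (implyP (forallP low2 s)).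
clearbody S.
pose C1 := [set t in S | s + (t + t) \in S].
pose C2 := [set (u + u) - s | u in [set u in S | (u + u) - s \in S]].
have c2 : (#|C2| <= kap)%N.
  apply: leq_trans (leq_imset_card _ _) _; apply: leq_trans low.
  rewrite -(card_imset [set u in S | u + u - s \in S] (@oppr_inj A)).
  apply: subset_leq_card; apply/subsetP => _ /imsetP[u /setIdP[uS h] ->].
  by rewrite inE SN uS -SN (_ : - (s + (- u - u)) = u + u - s) //; zmod.
have sub : badset S s \subset ndset S s :|: (C1 :|: (C2 :|: [set s; - s])).
  apply/subsetP => t /setIdP[tS /orP[/eqP->|bad]]; first by rewrite !inE eqxx ?orbT.
  apply/negPn/negP; rewrite !in_setU !negb_or => /and5P[nd n1 n2 n3 n4].
  rewrite !inE in n3 n4.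
  case/eqP: bad; rewrite /codeg.
  have -> : [set u in S | s + t - u \in S] = [set s; t].
    apply/setP => u; rewrite in_set2; apply/setIdP/orP => [[uS vS]|[/eqP->|/eqP->]]; first last.
    - by rewrite addrK.
    - by rewrite (_ : s + t - s = t) //; zmod.
    apply/orP/negPn/negP; rewrite negb_or => /andP[us ut]; case/negP: nd.
    rewrite inE; apply/existsP; exists u; rewrite /nondeg tS uS vS us ut /=; apply/and4P; split.
    - apply: contra n1 => /eqP ut'; apply/setIdP; split=> //.
      by rewrite (_ : s + (t + t) = s + t - u) // ut'; zmod.
    - apply: contra n1 => /eqP e; apply/setIdP; split=> //.
      by rewrite (_ : s + (t + t) = u) //; zmod_from e.
    - apply: contra n2 => /eqP e; apply/imsetP; exists u; last by zmod_from e.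
      by apply/setIdP; split=> //; rewrite (_ : u + u - s = t) //; zmod_from e.
    - by apply: contra n4 => /eqP e; apply/eqP; zmod_from e.
  by rewrite cards2 eq_sym n3.
have c4 : (#|[set s; (- s)%R]| <= 2)%N by rewrite cards2; case: (_ != _).
apply: leq_trans (subset_leq_card sub) _.
have c1 : (#|C1| <= kap)%N := low.
apply: leq_trans (leq_card_setU _ _) _; rewrite -addnA leq_add2l.
apply: leq_trans (leq_card_setU _ _) _; apply: leq_trans (leq_add c1 (leq_card_setU _ _)) _.
by rewrite mul2n -addnn -addnA leq_add2l leq_add.
Qed.

End Prob.
End Collisions.

(** * Subgroups, additive maps and the sparse range *)

Section Generation.
Variables (gT : finGroupType) (L : nat).
Hypothesis hL : (#|gT| < 2 ^ L)%N.

(** A new generator outside the subgroup generated so far at least doubles it, so L steps reach H;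
    after that the list is padded with 1. *)
Lemma group_gen (H : {group gT}) :
  exists f : {ffun 'I_L -> gT}, (H : {set gT}) = <<[set f i | i : 'I_L]>>%g.
Proof.
suff [s [ss sH [gs|gs]]] : exists s : seq gT, [/\ size s = L, {subset s <= H} &
    (<<[set x in s]>>%g = H \/ 2 ^ L <= #|<<[set x in s]>>%g|)%N].
- exists [ffun i : 'I_L => nth 1%g s i]; rewrite -gs; congr <<_>>%g.
  apply/setP => x; rewrite inE; apply/idP/imsetP => [xs|[i _ ->]].
    have hx : (index x s < L)%N by rewrite -ss index_mem.
    by exists (Ordinal hx) => //; rewrite ffunE nth_index.
  by rewrite ffunE mem_nth // ss.
- by have := leq_trans gs (max_card _); rewrite leqNgt hL.
elim: (L) => [|m [s [ss sH gs]]].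
  by exists [::]; split=> //; right; rewrite expn0 cardG_gt0.
have [e|ne] := eqVneq <<[set x in s]>>%g (H : {set gT}).
  exists (1%g :: s); split; first by rewrite /= ss.
    by move=> x; rewrite inE => /orP[/eqP->|/sH//]; apply: group1.
  left; apply/eqP; rewrite eqEsubset; apply/andP; split.
    rewrite gen_subG; apply/subsetP => x; rewrite !inE => /orP[/eqP->|/sH//]; exact: group1.
  rewrite -{1}e genS //; apply/subsetP => x; rewrite !inE => ->; exact: orbT.
have sG : <<[set x in s]>>%g \subset H by rewrite gen_subG; apply/subsetP => x; rewrite inE => /sH.
have [x xH xs] : exists2 x, x \in H & x \notin <<[set x in s]>>%g.
  by apply/subsetPn; apply: contra ne => h; rewrite eqEsubset sG.
exists (x :: s); split; first by rewrite /= ss.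
  by move=> y; rewrite inE => /orP[/eqP->|/sH].
right; case: gs => [e|gs]; first by rewrite e eqxx in ne.
set K := <<[set x in s]>>%G; set K' := <<[set y in x :: s]>>%G.
have pr : K \proper K'.
  apply/properP; split; first by rewrite genS //; apply/subsetP => y; rewrite !inE => ->; exact: orbT.
  by exists x => //; apply: mem_gen; rewrite !inE eqxx.
have := Lagrange (proper_sub pr) => /= <-.
rewrite expnSr; apply: leq_mul => //.
by rewrite indexg_gt1; case/andP: pr.
Qed.

End Generation.

Section Additivity.
Variable A : finZmodType.
Hypothesis A6 : coprime #|A| 6.
Local Notation Hf := (Hf A).
Local Notation n := #|A|.
Implicit Types (x y s t u : A) (S X : {set A}).

(** The index is not 1 and is prime to 6, hence at least 5. *)
Lemma card_proper_subgroup (H : {group A}) : (H : {set A}) != [set: A] -> (5 * #|H| <= n)%N.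
Proof.
move=> ne; have := Lagrange (subsetT H); rewrite cardsT => e.
have i1 : (#|[set: A] : H|%g != 1)%N.
  by rewrite indexg_eq1 subTset.
have cop : coprime #|[set: A] : H|%g 6 by apply: coprime_dvdl A6; rewrite -e dvdn_mull.
rewrite -e mulnC leq_mul2l; apply/orP; right.
move: (#|_ : _|%g) i1 cop => [|[|[|[|[|k]]]]] //.
Qed.

Lemma zgroup_set (K : {set A}) : 0 \in K -> (forall x y, x \in K -> y \in K -> x + y \in K) ->
  group_set K.
Proof. by move=> K0 KD; apply/group_setP; split=> //; rewrite FinRing.zmod1gE. Qed.

Definition additive_perm (g : {perm A}) : bool :=
  [forall x : A, forall y : A, g (x + y) == g x + g y].

Section Squares.
Variables (S : {set A}) (N : nat).
Hypothesis badN : forall s, s \in S -> (#|badset S s| <= N)%N.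
Hypothesis outN : forall H : {group A}, (H : {set A}) != [set: A] -> (N < #|S :\: H|)%N.

(** By invariance of the codegree, the image difference D is represented exactly through a and b, so
    D - b is a or b. If D - b = b, then D - a is b, which is the claim, or a, and then 2a = 2b
    contradicts a <> b. *)
Lemma square_aut g x s t : is_aut S g -> s \in S -> t \in S -> t \notin badset S s ->
  g (x + t + s) - g (x + t) = g (x + s) - g x.
Proof.
move=> ag sS tS; rewrite inE tS negb_or negbK => /andP[ts /eqP c2].
set D := g (x + t + s) - g x.
have cD : codeg S D = 2.
  by rewrite /D (codeg_aut _ _ ag) -c2; congr codeg; zmod.
set a := g (x + s) - g x; set b := g (x + t) - g x.
have aR : a \in [set u in S | D - u \in S].
  rewrite inE; apply/andP; split; first by rewrite aut_mem // (_ : _ - _ = s) //; zmod.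
  have -> : D - a = g (x + t + s) - g (x + s) by rewrite /D /a; zmod.
  by rewrite aut_mem // (_ : _ - _ = t) //; zmod.
have bR : b \in [set u in S | D - u \in S].
  rewrite inE; apply/andP; split; first by rewrite aut_mem // (_ : _ - _ = t) //; zmod.
  have -> : D - b = g (x + t + s) - g (x + t) by rewrite /D /b; zmod.
  by rewrite aut_mem // (_ : _ - _ = s) //; zmod.
have ab : a != b by rewrite /a /b (inj_eq (addIr _)) (inj_eq perm_inj) (inj_eq (addrI _)) eq_sym.
have RE : [set u in S | D - u \in S] = [set a; b].
  apply/esym/eqP; rewrite eqEcard cards2 ab [X in (X <= _)%N]cD leqnn andbT.
  by apply/subsetP => u /set2P[->|->].
have DR u : u \in [set u in S | D - u \in S] -> D - u \in [set a; b].
  by rewrite -RE !inE subKr andbC.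
have Db : D - b = a.
  have /set2P[//|e1] := DR b bR.
  have /set2P[e2|e2] := DR a aR; last by zmod_from e2.
  case/eqP: ab; apply: (dbl_inj A6) => /=.
  have -> : a + a = D by zmod_from e2.
  by zmod_from e1.
by rewrite -/a -Db /D /b; zmod.
Qed.

(** For s in S, the shifts that preserve all increments of g in direction s form a subgroup
    containing S minus [badset S s]; a proper subgroup would miss more than N elements of S. So it
    is everything, and hence the a for which g (x + a) - g x does not depend on x form a subgroup
    containing S, which is again everything. *)
Lemma squares g : is_aut S g -> exists phi : {perm A},
  [/\ additive_perm phi, is_aut S phi & forall x, g x = phi x + g 0].
Proof.
move=> ag.
have step s : s \in S -> forall x a, g (x + a + s) - g (x + a) = g (x + s) - g x.
  move=> sS; pose K := [set a : A | [forall x : A, g (x + a + s) - g (x + a) == g (x + s) - g x]].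
  have gK : group_set K.
    apply: zgroup_set => [|a b]; rewrite !inE.
      by apply/forallP => x; rewrite addr0.
    move=> /forallP ha /forallP hb; apply/forallP => x; rewrite -(eqP (ha x)) -(eqP (hb (x + a))).
    by rewrite !addrA.
  have [KT|KT] := eqVneq K [set: A].
    move=> x a; have : a \in K by rewrite KT inE.
    by rewrite inE => /forallP/(_ x)/eqP.
  have /subsetPn[t /setDP[tS tK] tb] : ~~ (S :\: K \subset badset S s).
    apply/negP => /subset_leq_card; apply/negP; rewrite -ltnNge.
    by apply: leq_ltn_trans (badN sS) (outN (H := group gK) KT).
  case/negP: tK; rewrite inE; apply/forallP => x; apply/eqP; exact: square_aut.
pose K := [set a : A | [forall x : A, g (x + a) - g x == g a - g 0]].
have gK : group_set K.
  apply: zgroup_set => [|a b]; rewrite !inE; first by apply/forallP => x; rewrite addr0 !subrr.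
  move=> /forallP ha /forallP hb; apply/forallP => x; apply/eqP.
  have e1 := eqP (ha x); have e2 := eqP (hb (x + a)); have e3 := eqP (hb a).
  have E : x + (a + b) = x + a + b by rewrite addrA.
  rewrite E (_ : _ - g x = (g (x + a + b) - g (x + a)) + (g (x + a) - g x)); last by zmod.
  rewrite e1 e2 -e3; zmod.
have KT : K = [set: A].
  apply/eqP/negPn/negP => /(outN (H := group gK)) /=.
  have sK : S \subset K.
    apply/subsetP => s sS; rewrite inE; apply/forallP => x.
    by have := step s sS 0 x; rewrite !add0r => ->.
  by rewrite (eqP (_ : S :\: K == set0)) ?setD_eq0 // cards0.
have gD x a : g (x + a) - g x = g a - g 0.
  have : a \in K by rewrite KT inE.
  by rewrite inE => /forallP/(_ x)/eqP.
have pinj : injective (fun x => g x - g 0) by move=> x y /addIr/perm_inj.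
exists (perm pinj); split.
- apply/forallP => x; apply/forallP => y; rewrite !permE; apply/eqP.
  by have e := gD x y; zmod_from e.
- apply/forallP => x; apply/forallP => y; rewrite !permE /cay_adj.
  rewrite (_ : g y - g 0 - (g x - g 0) = g y - g x); last by zmod.
  by rewrite aut_mem.
- by move=> x; rewrite permE subrK.
Qed.

End Squares.

Section SparseProbability.
Variables (Fd : realFieldType) (p : Fd).
Hypotheses (p0 : 0 <= p) (p1 : p <= 1).
Variable L : nat.
Hypothesis hL : (n < 2 ^ L)%N.

Lemma card_Hf_sym (B : {set A}) : (forall x, (- x \in B) = (x \in B)) -> 0 \notin B ->
  #|B| = (#|Hf :&: B| + #|Hf :&: B|)%N.
Proof.
move=> BN B0.
have eB : B = (Hf :&: B) :|: (-%R @: (Hf :&: B)).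
  apply/setP => x; rewrite in_setU in_setI; case: (boolP (x \in Hf)) => xH /=.
    case: (boolP (x \in B)) => //= xB; apply/esym/negbTE/imsetP => -[y /setIP[_ yB] e].
    by rewrite e BN yB in xB.
  apply/idP/imsetP => [xB|[y /setIP[_ yB] ->]]; last by rewrite BN.
  exists (- x); rewrite ?opprK // inE BN xB (HfNN A6) //.
  by apply: contraNneq B0 => <-.
have dis : (Hf :&: B) :&: (-%R @: (Hf :&: B)) = set0.
  apply/eqP; rewrite -subset0; apply/subsetP => x /setIP[/setIP[xH _] /imsetP[y /setIP[yH _] e]].
  by move: (HfN yH); rewrite -e xH.
by rewrite {1}eB cardsU dis cards0 subn0 (card_imset _ oppr_inj).
Qed.

(** Subgroups are given by L-tuples of generators, so that a union bound over them costs n^L. *)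
Definition thin_subgroup (a : nat) X : bool :=
  [exists f : {ffun 'I_L -> A}, (<<[set f i | i : 'I_L]>>%g != [set: A]) &&
     (#|X :\: <<[set f i | i : 'I_L]>>%g| <= a)%N].

(** A proper subgroup leaves at least 4n/5 elements outside, and half of these lie in [Hf]. *)
Lemma thin_subgroup_prob (a : nat) (z : Fd) : 0 < z -> z <= 1 ->
  bprob p Hf (thin_subgroup a) <= (n ^ L)%:R * ((1 - p + p * z) ^+ (2 * n %/ 5) / z ^+ a).
Proof.
move=> z0 z1.
have y0 : 0 <= 1 - p + p * z by rewrite addr_ge0 ?subr_ge0 ?mulr_ge0 // ltW.
have y1 : 1 - p + p * z <= 1 by rewrite -addrA gerDl addrC subr_le0 ler_piMr.
apply: le_trans (bprob_union p0 p1 (b := (1 - p + p * z) ^+ (2 * n %/ 5) / z ^+ a) _) _; last first.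
  rewrite ler_wpM2r ?divr_ge0 ?exprn_ge0 ?(ltW z0) // ler_nat.
  by apply: leq_trans (max_card _) _; rewrite card_ffun card_ord.
have Hex f : exists H : {group A}, (H : {set A}) = <<[set (f : {ffun 'I_L -> A}) i | i : 'I_L]>>%g.
  by exists <<[set f i | i : 'I_L]>>%G.
move=> f; have [H <-] := Hex f => Hf'.
rewrite ler_pdivlMr ?exprn_gt0 //.
have HN x : (- x \in H) = (x \in H) by rewrite -FinRing.zmodVgE groupV.
have cH : (2 * n %/ 5 <= #|Hf :\: H|)%N.
  have h5 := card_proper_subgroup Hf'.
  have e : (n - #|H| = #|Hf :\: H| + #|Hf :\: H|)%N.
    have -> : (n - #|H| = #|~: H|)%N by rewrite [RHS]cardsCs setCK.
    rewrite setDE; apply: card_Hf_sym => [x|]; first by rewrite !in_setC HN.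
    by rewrite in_setC negbK; apply: (group1 H).
  have : (2 * n %/ 5 <= (5 * #|Hf :\: H|) %/ 5)%N by apply: leq_div2r; move: e h5; lia.
  by rewrite mulKn.
rewrite /bprob (@bexp_marginal _ _ p (Hf :\: H)) ?subsetDl //; last first.
  move=> X sX; congr (nat_of_bool (_ <= _)%N)%:R; apply: eq_card => x; rewrite !inE.
  case: (boolP (x \in H)) => //= xH; case: (boolP (x \in X)) => //= xX.
  by have := subsetP sX _ xX; rewrite inE => ->.
apply: (@le_trans _ _ (bprob p (Hf :\: H) (fun X : {set A} => #|X| <= a)%N * z ^+ a)).
  rewrite ler_wpM2r ?exprn_ge0 ?(ltW z0) //; apply: ler_bprob => // X sX.
  suff -> : X :\: H = X by [].
  by apply/setDidPl; apply: disjointWl sX _; rewrite -setI_eq0 setIDAC setDIl setDv setI0.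
apply: le_trans (bprob_card_le p0 p1 _ _ _) _; first by rewrite z0 z1.
by apply: ler_wiXn2l.
Qed.

Lemma not_thin X (a : nat) (H : {group A}) : X \subset Hf -> ~~ thin_subgroup a X ->
  (H : {set A}) != [set: A] -> (a < #|sym X :\: H|)%N.
Proof.
move=> sX; rewrite negb_exists => /forallP h ne.
have [f fH] := group_gen hL H; have := h f; rewrite -fH ne /= -ltnNge => h1.
apply: leq_trans h1 _; apply: subset_leq_card; apply: setSD; apply/subsetP => x xX.
by rewrite mem_sym // (subsetP sX).
Qed.

Definition sym_aut X : bool :=
  [exists phi : {perm A}, [&& additive_perm phi, ~~ affine_perm phi & is_aut (sym X) phi]].

Lemma card_additive_perm : (#|[pred phi : {perm A} | additive_perm phi]| <= n ^ L)%N.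
Proof.
have [f fT] := group_gen hL [set: A]%G.
pose F (phi : {perm A}) : {ffun 'I_L -> A} := [ffun i => phi (f i)].
suff inj : {in [pred phi : {perm A} | additive_perm phi] &, injective F}.
  by rewrite -(card_in_imset inj); apply: leq_trans (max_card _) _; rewrite card_ffun card_ord.
move=> phi psi; rewrite !inE => /forallP h1 /forallP h2 e; apply/permP => x.
have D1 y z : phi (y + z) = phi y + phi z by apply/eqP; apply: (forallP (h1 y)).
have D2 y z : psi (y + z) = psi y + psi z by apply/eqP; apply: (forallP (h2 y)).
pose K := [set x | phi x == psi x].
have gK : group_set K.
  apply: zgroup_set => [|y z]; rewrite !inE; last by rewrite D1 D2 => /eqP-> /eqP->.
  apply/eqP; apply: (addrI (phi 0)); rewrite -D1 !addr0.
  by apply: (addrI (psi 0)); rewrite addrCA -D2 addr0 addrC.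
have : x \in <<[set f i | i : 'I_L]>>%g by rewrite -fT inE.
have sK : <<[set f i | i : 'I_L]>>%g \subset group gK.
  rewrite gen_subG; apply/subsetP => _ /imsetP[i _ ->]; rewrite inE.
  by have := congr1 (fun h : {ffun 'I_L -> A} => h i) e; rewrite !ffunE => ->.
by move/(subsetP sK); rewrite inE => /eqP.
Qed.

(** As phi is neither the identity nor its negative, the subgroups where it agrees with these have
    at most n/5 elements each, so phi x differs from x and -x for at least 3n/5 elements, half of
    them in [Hf]. Each class lies in at most two pairs {x, rep (phi x)}, so one quarter of 3n/10
    pairs can be made disjoint, and an automorphism may split none of them. *)
Lemma sym_aut_prob : bprob p Hf sym_aut <= (n ^ L)%:R * (1 - p * (1 - p)) ^+ (3 * n %/ 40).
Proof.
have q0 : 0 <= 1 - p by rewrite subr_ge0.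
have q1 : 1 - p <= 1 by rewrite lerBlDr lerDl.
have c0 : 0 <= 1 - p * (1 - p) by rewrite subr_ge0 mulr_ile1.
have c1 : 1 - p * (1 - p) <= 1 by rewrite lerBlDr lerDl mulr_ge0.
apply: (@le_trans _ _ (bprob p Hf (fun X => [exists phi : {perm A},
    (additive_perm phi && ~~ affine_perm phi) && is_aut (sym X) phi]))).
  by apply: ler_bprob => // X _ /existsP[phi h]; apply/existsP; exists phi; rewrite -andbA.
apply: le_trans (bprob_union p0 p1 (b := (1 - p * (1 - p)) ^+ (3 * n %/ 40)) _) _; last first.
  rewrite ler_wpM2r ?exprn_ge0 // ler_nat; apply: leq_trans card_additive_perm.
  by apply: subset_leq_card; apply/subsetP => phi /andP[].
move=> phi /andP[/forallP add naff].
have D y z : phi (y + z) = phi y + phi z by apply/eqP; apply: (forallP (add y)).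
have phi0 : phi 0 = 0 by apply: (addrI (phi 0)); rewrite -D !addr0.
have phiN x : phi (- x) = - phi x by apply/eqP; rewrite -addr_eq0 -D addNr phi0.
have g1 : group_set [set x | phi x == x].
  by apply: zgroup_set => [|y z]; rewrite !inE ?phi0 // D => /eqP-> /eqP->.
have g2 : group_set [set x | phi x == - x].
  by apply: zgroup_set => [|y z]; rewrite !inE ?phi0 ?oppr0 // D opprD => /eqP-> /eqP->.
have h1 := @card_proper_subgroup (group g1); have h2 := @card_proper_subgroup (group g2).
rewrite /= in h1 h2.
have {}h1 : (5 * #|[set x | phi x == x]| <= n)%N.
  apply: h1; apply: contra naff => /eqP h; apply/existsP; exists 0; apply/orP; left; apply/forallP => x.
  have : x \in [set x | phi x == x] by rewrite h inE.
  by rewrite inE addr0.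
have {}h2 : (5 * #|[set x | phi x == - x]| <= n)%N.
  apply: h2; apply: contra naff => /eqP h; apply/existsP; exists 0; apply/orP; right; apply/forallP => x.
  have : x \in [set x | phi x == - x] by rewrite h inE.
  by rewrite inE sub0r.
pose B := [set x | (phi x != x) && (phi x != - x)].
have cB : (3 * n <= 5 * #|B|)%N.
  have : (n <= #|[set x | phi x == x]| + #|[set x | phi x == - x]| + #|B|)%N.
    rewrite -cardsT; apply: (@leq_trans #|[set x | phi x == x] :|: [set x | phi x == - x] :|: B|).
      by apply: subset_leq_card; apply/subsetP => x _; rewrite !inE; case: (phi x == x); case: (phi x == - x).
    by apply: leq_trans (leq_card_setU _ _) _; rewrite leq_add2r; apply: leq_card_setU.
  by move: h1 h2; lia.
have cHB := card_Hf_sym (B := B).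
have {}cHB : #|B| = (#|Hf :&: B| + #|Hf :&: B|)%N.
  apply: cHB; last by rewrite inE phi0 eqxx.
  by move=> x; rewrite !inE phiN !(inj_eq oppr_inj).
pose G x := [set x; rep (phi x)].
have Gr x : x \in Hf :&: B -> x != rep (phi x).
  rewrite inE => /andP[xH]; rewrite inE => /andP[e1 e2]; rewrite -{1}(rep_id xH) (eq_rep A6) negb_or.
  by rewrite eq_sym e1 /=; apply: contra e2 => /eqP {2}->; rewrite opprK.
have [E [sE cE disE]] : exists E : {set A}, [/\ E \subset Hf :&: B, #|E| = (3 * n %/ 40)%N &
    forall x y, x \in E -> y \in E -> x != y -> [disjoint G x & G y]].
  apply: (@greedy_disjoint A A (Hf :&: B) G 2 2) => // [x /Gr h|x|].
  - by rewrite cards2 h.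
  - apply: (@card_set2 _ _ x (rep (phi^-1%g x))) => y /setIdP[/setIP[yH _] /set2P[->|e]].
      by rewrite eqxx.
    apply/orP; right; rewrite -{1}(rep_id yH) e.
    by case: (repE (phi y)) => ->; rewrite -?phiN permK ?repN.
  have : (3 * n %/ 40 * 40 <= 3 * n)%N by apply: leq_trunc_div.
  by move: cB cHB; lia.
have EH x : x \in E -> x \in Hf /\ rep (phi x) \in Hf.
  move=> /(subsetP sE)/setIP[xH _]; split=> //; rewrite (rep_Hf A6) -phi0 (inj_eq perm_inj).
  by apply: contraTneq xH => ->; apply: Hf0.
have sB : \bigcup_(x in E) G x \subset Hf.
  by apply/bigcupsP => x /EH[h3 h4]; rewrite subUset !sub1set h3 h4.
pose Vl x (X : {set A}) := (x \in X) != (rep (phi x) \in X).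
apply: (@le_trans _ _ (bprob p Hf (fun X : {set A} => #|[set x in E | Vl x X]| <= 0)%N)).
  apply: ler_bprob => // X sX aut; rewrite leqn0 cards_eq0 -subset0; apply/subsetP => x.
  rewrite inE => /andP[/EH[xH _]]; rewrite /Vl -(mem_sym X xH) => /negP[].
  have := aut_mem 0 x aut; rewrite phi0 !subr0 => <-.
  by rewrite [phi x \in _]inE eqxx.
rewrite /bprob (@bexp_marginal _ _ p (\bigcup_(x in E) G x)) //; last first.
  move=> X sX; congr (nat_of_bool (_ <= _)%N)%:R; apply: eq_card => x; rewrite !inE.
  case: (boolP (x \in E)) => //= xE; rewrite /Vl !in_setI.
  have -> : x \in \bigcup_(x in E) G x by apply/bigcupP; exists x => //; rewrite !inE eqxx.
  have -> : rep (phi x) \in \bigcup_(x in E) G x.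
    by apply/bigcupP; exists x => //; rewrite !inE eqxx orbT.
  by rewrite !andbT.
rewrite -[X in _ <= X]mul1r -cE -[X in X * _](expr0 2%:R).
have -> : 1 - p * (1 - p) = 1 - (2%:R * p * (1 - p)) / 2%:R by field.
apply: (blocks_tail (Vl := Vl) p0 p1) => // [x X xE _|x xE].
  by rewrite /Vl !in_setI !inE !eqxx ?orbT !andbT.
have rr := Gr x (subsetP sE _ xE).
rewrite /bprob /G bexp_cons; last by rewrite inE.
rewrite !bexp1 /Vl !inE !eqxx (negbTE rr) [rep (phi x) == _]eq_sym (negbTE rr) /=.
lra.
Qed.

Lemma squares_prob (m1 m kap a N : nat) (z : Fd) : 0 < z -> z <= 1 -> (0 < kap)%N ->
  (8 * m1 + 2 <= kap)%N -> (m * (3 * (6 * kap)) <= N)%N -> (N + 2 * kap + 2 <= a)%N ->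
  bprob p Hf (fun X => ~~ affine_auts (sym X)) <=
    2%:R * (n%:R * ((n%:R * p ^+ 2) ^+ m1 / m1`!%:R)) + n%:R * (((n ^ 2)%:R * p ^+ 3) ^+ m / m`!%:R) +
    (n ^ L)%:R * ((1 - p + p * z) ^+ (2 * n %/ 5) / z ^+ a) +
    (n ^ L)%:R * (1 - p * (1 - p)) ^+ (3 * n %/ 40).
Proof.
move=> z0 z1 kap0 num1 num2 num3.
pose E3 (X : {set A}) := low_codeg kap X && [exists s : A, (s != 0) && (N <= #|ndset (sym X) s|)%N].
have e3 : bprob p Hf E3 <= n%:R * (((n ^ 2)%:R * p ^+ 3) ^+ m / m`!%:R).
  apply: (@le_trans _ _ (bprob p Hf (fun X => [exists s : A, (s != 0) &&
      (low_codeg kap X && (N <= #|ndset (sym X) s|)%N)]))).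
    apply: ler_bprob => // X _ /andP[h1 /existsP[s /andP[h2 h3]]].
    by apply/existsP; exists s; rewrite h1 h2.
  apply: le_trans (bprob_union p0 p1 (b := ((n ^ 2)%:R * p ^+ 3) ^+ m / m`!%:R) _) _.
    by move=> s _; apply: ndset_prob.
  by rewrite ler_wpM2r ?b3_ge0 // ler_nat max_card.
rewrite mulr_natl mulr2n.
apply: le_trans (lerD (lerD (lerD (lerD (low_codeg_prob A6 p0 p1 num1) (low_codeg2_prob A6 p0 p1 num1)) e3)
   (thin_subgroup_prob a z0 z1)) sym_aut_prob).
apply: le_trans (lerD (lerD (lerD (bprobU p0 p1 _ _ _) (lexx _)) (lexx _)) (lexx _)).
apply: le_trans (lerD (lerD (bprobU p0 p1 _ _ _) (lexx _)) (lexx _)).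
apply: le_trans (lerD (bprobU p0 p1 _ _ _) (lexx _)).
apply: le_trans (bprobU p0 p1 _ _ _).
apply: ler_bprob => // X sX; apply: contraR; rewrite !negb_or.
move=> /andP[/andP[/andP[/andP[/negPn low /negPn low2] nE3] nthin] nsym].
apply/forallP => g; apply/implyP => ag.
have [phi [addphi autphi gphi]] : exists phi : {perm A},
    [/\ additive_perm phi, is_aut (sym X) phi & forall x, g x = phi x + g 0].
  apply: (@squares (sym X) a) => // [s sS|H ne]; last exact: (not_thin sX nthin ne).
  have s0 : s != 0 by apply: contraTneq sS => ->; apply: sym0.
  apply: leq_trans (card_badset A6 sX sS s0 low2) _; apply: leq_trans num3.
  rewrite -!addnA leq_add2r; apply: ltnW; rewrite ltnNge; apply: contra nE3 => h.
  by rewrite /E3 low; apply/existsP; exists s; rewrite s0.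
have : affine_perm phi.
  apply: contraR nsym => h; apply/existsP; exists phi; by rewrite addphi h autphi.
case/existsP => c /orP[/forallP h|/forallP h]; apply/existsP; exists (c + g 0); apply/orP.
  by left; apply/forallP => x; rewrite gphi (eqP (h x)) addrA.
by right; apply/forallP => x; rewrite gphi (eqP (h x)) addrAC.
Qed.

End SparseProbability.
End Additivity.

(** * Probability of non-affine automorphisms in the three ranges of p *)

Lemma exp_ln_card (A : finZmodType) : INR #|A| = exp (ln (INR #|A|)).
Proof. by rewrite exp_ln //; apply: lt_0_INR; apply/ssrnat.ltP; apply: n_gt0. Qed.

Lemma expn_pow (a b : nat) : (a ^ b)%N = Nat.pow a b.
Proof. by elim: b => // b IH; rewrite expnS IH. Qed.

(** The interface of the sampling argument: for a given [W] only a tail bound for separations of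
    generic labels has to be supplied. The size limit on I covers both the k^2 pairs and the M
    points of a star. *)
Lemma rigid_num : exists l0 : R, Rle 2 l0 /\
  forall (A : finZmodType) (p c err : R) (Good : pred {set A}) (W : {set A} -> A -> nat),
  coprime #|A| 6 -> 0 <= p -> p <= 1 -> 0 <= err ->
  let l := ln (INR #|A|) in
  Rle l0 l -> Rle (exp (Ropp (Rdiv l 20))) c /\ Rle c 1 ->
  (forall (X : {set A}) (g : {perm A}) x y, X \subset Hf A -> is_aut (sym X) g ->
     W X (g x - g y) = W X (x - y)) ->
  (forall X x, W X (- x) = W X x) ->
  (forall (I : finType) (d : bool -> I -> A) (E : {set I}) (v : nat),
     Rle (INR #|I|) (pow (Rdiv (Rmult 8000 l) (pow c 2)) 2) -> generic d ->
     (forall e, e \in E -> (d true e != d false e) && (d true e != - d false e)) ->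
     bprob p (Hf A) (fun X => Good X && (#|[set e in E | W X (d false e) != W X (d true e)]| <= v)%N)
      <= 2%:R ^+ v * (1 - c / 2%:R) ^+ #|E| + err) ->
  Rle (bprob p (Hf A) (fun X => Good X && ~~ affine_auts (sym X)))
      (Rplus (exp (Ropp (pow l 2)))
         (Rmult (Rmult 3 (exp (Rdiv (Rmult 32000 (pow l 2)) (pow c 2)))) err)).
Proof.
have [l0 [l02 H]] := rigid_choice; exists l0; split=> // A p c err Good W A6 p0 p1 err0 l hl hc Winv WN star.
have nE : INR #|A| = exp l by apply: exp_ln_card.
have [k [M [v [m [N0 [N1 [k0 [[n1 [n2 n3]] [hk [hM fin]]]]]]]]]] := H #|A| l c nE hl hc.
have c1 : 0 <= 1 - c / 2%:R.
  have /RleP := proj2 hc; rewrite R1E => h; lra.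
have c1' : 1 - c / 2%:R <= 1.
  have : 0 <= c by apply/RleP; apply: Rle_trans (proj1 hc); left; apply: exp_pos.
  lra.
have hI1 : Rle (INR #|{: 'I_k * 'I_k}|) (pow (Rdiv (Rmult 8000 l) (pow c 2)) 2).
  rewrite card_prod card_ord mult_INR -[Rmult (INR k) (INR k)]/(Rmult (INR k) (INR k)).
  have -> : Rmult (INR k) (INR k) = pow (INR k) 2 by rewrite /= Rmult_1_r.
  by apply: pow_incr; split; [apply: pos_INR | exact: hk].
have hI2 : Rle (INR #|{: 'I_M}|) (pow (Rdiv (Rmult 8000 l) (pow c 2)) 2) by rewrite card_ord.
have err0' : Rle 0 err by apply/RleP.
have fin' := fin err err0'; apply: Rle_trans fin' => {fin}.
apply/RleP.
have := @rigid A A6 R p p0 p1 W Good k m M v N0 N1 (1 * (1 - c / 2%:R) ^+ m + err)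
  (2%:R ^+ v * (1 - c / 2%:R) ^+ M + err).
have -> : (#|A| ^ (4 * k))%:R = exp l ^+ (4 * k) by rewrite natrX -INRE nE.
have -> : (#|A| * #|A|)%:R = exp l * exp l by rewrite natrM -INRE nE.
rewrite !RpowE => rig; apply: le_trans (rig _ _ _ _ _ _ Winv WN _ _) _ => {rig}.
- by rewrite addr_ge0 // mul1r exprn_ge0.
- by rewrite addr_ge0 // mulr_ge0 ?exprn_ge0.
- exact/ssrnat.ltP.
- by have /ssrnat.leP := INR_num1 _ _ _ _ n1; rewrite -!expn_pow.
- by have /ssrnat.leP := INR_num2 _ _ _ _ n2; rewrite -!expn_pow.
- move=> a /ssrnat.leP h1 /ssrnat.leP h2 /ssrnat.leP h3; apply/ssrnat.leP.
  exact: (INR_num3 _ _ _ _ (n3 a) h1 h2 h3).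
(* Agreement on all of E is the case v = 0, and |E| >= m only improves the bound. *)
- move=> d E gd nE' mE; apply: le_trans (_ : _ <= 2%:R ^+ 0 * (1 - c / 2%:R) ^+ #|E| + err) _; last first.
    by rewrite expr0 !mul1r lerD2r ler_wiXn2l.
  apply: le_trans (star _ d E 0%N hI1 gd nE'); apply: ler_bprob => // X _ /andP[-> /forall_inP h] /=.
  rewrite leqn0 cards_eq0 -subset0; apply/subsetP => e; rewrite inE => /andP[/h ->] //.
- move=> d gd nE'.
  have := star _ d [set: 'I_M] v hI2 gd; rewrite cardsT card_ord => h.
  apply: le_trans (h (fun e _ => nE' e)); apply: ler_bprob => // X _ /andP[-> hv] /=.
  by apply: leq_trans hv; apply: subset_leq_card; apply/subsetP => e; rewrite !inE.
by rewrite -[IZR 1]/(1 : R) -?IZRposE.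
Qed.

Lemma fact_natE (m : nat) : m`! = Factorial.fact m.
Proof. by elim: m => // m IH; rewrite factS IH. Qed.

Lemma IZR_half : Rdiv (IZR 1) (IZR 2) = 1 / 2%:R :> R.
Proof. by rewrite RdivE R1E IZRposE INRE. Qed.

(** Here p <= 1/2 makes the separation probability 2 p (1 - p) at least p, so c = p; independence is
    exact and err is 0. *)
Lemma affine_prob_dense : exists l0 : R, forall (A : finZmodType) (p : R),
  coprime #|A| 6 -> let l := ln (INR #|A|) in Rle l0 l ->
  Rle (exp (Ropp (Rdiv l 20))) p -> Rle p (Rdiv 1 2) ->
  Rle (bprob p (Hf A) (fun X => ~~ affine_auts (sym X))) (exp (Ropp (pow l 2))).
Proof.
have [l0 [_ H]] := rigid_num; exists l0 => A p A6 l hl hp1 hp2.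
have p0 : 0 <= p by apply/RleP; apply: Rle_trans hp1; left; apply: exp_pos.
have ph : p <= 1 / 2%:R by rewrite -IZR_half; apply/RleP.
have p1 : p <= 1 by move: ph; lra.
have hp1' : Rle p 1 by apply/RleP; rewrite R1E.
have := H A p p 0 xpredT (fun X x => nat_of_bool (x \in sym X)) A6 p0 p1 (lexx _) hl (conj hp1 hp1').
rewrite Rmult_0_r Rplus_0_r; apply.
- by move=> X g x y _ ag; rewrite aut_mem.
- by move=> X x; rewrite (mem_symN A6).
move=> I d E v _ gd nE; rewrite addr0.
have h := star_indicator A6 p0 p1 v gd nE.
apply: le_trans (le_trans h _).
  apply: ler_bprob => // X _ /= hX; apply: leq_trans hX; apply: subset_leq_card.
  by apply/subsetP => e; rewrite !inE; do 2!case: (_ \in X).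
apply: ler_wpM2l; first by rewrite exprn_ge0.
apply: lerXn2r; rewrite ?nnegrE; nra.
Qed.

(** Large codegrees are split off by [low_codeg_prob]; the remaining error [err] is the chance of a
    small first round, from [bprob_card_le] with z = 1/2. *)
Lemma affine_prob_middle : exists l0 : R, forall (A : finZmodType) (p : R),
  coprime #|A| 6 -> let l := ln (INR #|A|) in Rle l0 l ->
  Rle (exp (Ropp (Rmult (Rdiv 51 100) l))) p -> Rle p (exp (Ropp (Rdiv l 20))) ->
  Rle (bprob p (Hf A) (fun X => ~~ affine_auts (sym X)))
      (Rmult 3 (exp (Ropp (Rdiv (pow l 2) 40000)))).
Proof.
have [l0 [l02 H]] := rigid_num; have [l1 [l14 H1]] := middle_numerics.
exists (Rmax l0 l1) => A p A6 l hl hp1 hp2.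
have hl0 : Rle l0 l by apply: Rle_trans hl; apply: Rmax_l.
have hl1 : Rle l1 l by apply: Rle_trans hl; apply: Rmax_r.
have hl4 : Rle 4 l by apply: Rle_trans hl1.
have p0R : Rle 0 p by apply: Rle_trans hp1; left; apply: exp_pos.
have p0 : 0 <= p by apply/RleP.
have p1 : p <= 1.
  apply/RleP; apply: Rle_trans hp2 _; rewrite -R1E -exp_0; apply: exp_le.
  have : Rle 0 l by apply: Rle_trans hl4; apply: IZR_le.
  move=> h; apply: Rge_le; apply: Ropp_0_le_ge_contravar.
  by apply: Rmult_le_pos => //; left; apply: Rinv_0_lt_compat; apply: IZR_lt.
have nE : INR #|A| = exp l by apply: exp_ln_card.
have [q1 [q2 [c [a [m]]]]] := H1 #|A| l p nE hl1 (conj hp1 hp2).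
set kap := Nat.add _ _.
move=> [[[q10 q11] [[q20 q21] qE]] [hc [[hc1 hc2] [hm [herr hfin]]]]].
have {}q10 : 0 <= q1 by apply/RleP.
have {}q11 : q1 <= 1 by apply/RleP; rewrite -R1E.
have {}q20 : 0 <= q2 by apply/RleP.
have {}q21 : q2 <= 1 by apply/RleP; rewrite -R1E.
set err := exp (Ropp (Rdiv (Rmult (INR #|A|) p) 20)).
have err0 : 0 <= err by apply/RleP; left; apply: exp_pos.
have low : Rle (bprob p (Hf A) (fun X => ~~ low_codeg kap X)) (exp (Ropp (Rdiv (pow l 2) 4))).
  have hF : Rle (pow (Rdiv (INR m) (exp 1)) m) (INR m`!).
    by rewrite fact_natE; apply: fact_lower_bound.
  have := codeg_error l (INR #|A|) p (INR m`!) m hl4 nE p0R hm hF.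
  apply: Rle_trans; apply/RleP.
  rewrite !INRE !RpowE; apply: (low_codeg_prob A6 p0 p1); exact: leqnn.
have rig : Rle (bprob p (Hf A) (fun X => low_codeg kap X && ~~ affine_auts (sym X)))
   (Rplus (exp (Ropp (pow l 2))) (exp (Ropp (pow l 2)))).
  apply: Rle_trans (H A p c err (fun X => low_codeg kap X) (fun X x => codeg (sym X) x)
    A6 p0 p1 err0 hl0 hc _ _ _) _.
  - by move=> X g x y _ ag; rewrite codeg_aut.
  - by move=> X x; rewrite codegN // => y; rewrite (mem_symN A6).
  - move=> I d E v hI gd nE'.
    apply: le_trans (star_codeg A6 gd nE' v q10 q11 q20 q21 _ (c := c) (a := a) _ _ _) _.
    + exact: qE.
    + by apply/RleP; rewrite -RpowE.
    + by apply/RleP; rewrite -RpowE -INRE.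
    + by rewrite /kap -[Nat.add _ _]/(addn _ _) addn2.
    rewrite lerD2l; set m0 := (2 * a + _)%N.
    have m0E : m0 = Nat.add (Nat.mul 2 a) (Nat.mul (Nat.mul 14 (Nat.pow #|I| 2)) kap).
      by rewrite /m0 -expn_pow.
    have hb := herr #|I| m0 #|Hf A| hI m0E (card_Hf A6).
    have z0 : 0 < 2%:R^-1 :> R by rewrite invr_gt0 ltr0n.
    have z1 : 2%:R^-1 <= 1 :> R by rewrite invf_le1 ?ltr0n // ler1n.
    have := bprob_card_le q10 q11 (Hf A) m0 (introT andP (conj z0 z1)).
    have zm := exprn_gt0 m0 z0.
    rewrite -ler_pdivlMr // => hcard.
    have mono : bprob q1 (Hf A) (fun X => #|X| < m0)%N <= bprob q1 (Hf A) (fun X => #|X| <= m0)%N.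
      by apply: ler_bprob => // X _; apply: ltnW.
    apply: le_trans mono (le_trans hcard _); move/RleP: hb; apply: le_trans.
    rewrite !RpowE exprVn invrK -RinvE IZRposE INRE.
    by rewrite le_eqVlt; apply/orP; left; apply/eqP; congr (_ * _).
  by apply: Rplus_le_compat_l.
have tot : Rle (bprob p (Hf A) (fun X => ~~ affine_auts (sym X)))
   (Rplus (bprob p (Hf A) (fun X => ~~ low_codeg kap X))
          (bprob p (Hf A) (fun X => low_codeg kap X && ~~ affine_auts (sym X)))).
  apply/RleP; apply: le_trans (bprobU p0 p1 _ _ _); apply: ler_bprob => // X _ ->.
  by rewrite andbT orNb.
apply: Rle_trans tot _; apply: Rle_trans (Rplus_le_compat _ _ _ _ low rig) _.
exact: middle_total.
Qed.

Lemma affine_prob_sparse : exists l0 : R, forall (A : finZmodType) (p : R),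
  coprime #|A| 6 -> let l := ln (INR #|A|) in Rle l0 l ->
  Rle (Rmult 44 (pow l 2)) (Rmult (INR #|A|) p) ->
  Rle 0 p -> Rle p 1 -> Rle p (exp (Ropp (Rmult (Rdiv 51 100) l))) ->
  Rle (bprob p (Hf A) (fun X => ~~ affine_auts (sym X)))
      (exp (Ropp (Rdiv (pow l 2) 40000))).
Proof.
have [l1 [l14 H1]] := sparse_numerics.
exists l1 => A p A6 l hl hD p0R p1R hp2.
have hl4 : Rle 4 l by apply: Rle_trans hl.
have p0 : 0 <= p by apply/RleP.
have p1 : p <= 1 by apply/RleP; rewrite -R1E.
have nE : INR #|A| = exp l by apply: exp_ln_card.
have n0 : (0 < #|A|)%N by apply: n_gt0.
have [m1 [m2]] := H1 #|A| l p nE hl hD (conj p0R hp2).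
set kap := Nat.add _ _ => {}H1.
pose L := (trunc_log 2 #|A|).+1.
have hL : (#|A| < 2 ^ L)%N by apply: trunc_log_ltn.
have kap0 : (0 < kap)%N by rewrite /kap -[Nat.add _ _]/(addn _ _) addn2.
have hLl : Rle (INR L) (Rplus (Rmult 2 l) 1).
  rewrite S_INR; apply: Rplus_le_compat_r.
  have h1 : Rle (exp (Rmult (INR (trunc_log 2 #|A|)) (ln 2))) (exp l).
    rewrite -nE -exp_INR exp_ln; last by apply: IZR_lt.
    apply/RleP; rewrite RpowE IZRposE !INRE -natrX ler_nat; exact: trunc_logP.
  have {h1}h1 : Rle (Rmult (INR (trunc_log 2 #|A|)) (ln 2)) l.
    case: (Rle_lt_dec (Rmult (INR (trunc_log 2 #|A|)) (ln 2)) l) => // /exp_increasing h2.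
    by case: (Rlt_irrefl _ (Rlt_le_trans _ _ _ h2 h1)).
  have h2 := pos_INR (trunc_log 2 #|A|); have /Rlt_le h3 := ln_lt_2.
  apply: (Rmult_le_reg_r (Rinv 2)); first by apply: Rinv_0_lt_compat; apply: IZR_lt.
  have -> : Rmult (Rmult 2 l) (Rinv 2) = l.
    by rewrite (Rmult_comm 2) Rmult_assoc Rinv_r ?Rmult_1_r //; apply/eqP; rewrite IZRposE INRE pnatr_eq0.
  by apply: Rle_trans h1; apply: Rmult_le_compat_l.
have F1 : Rle 1 (INR m1`!) by apply: (le_INR 1); apply/ssrnat.leP; apply: fact_gt0.
have F2 : Rle (pow (Rdiv (INR m2) (exp 1)) m2) (INR m2`!).
  by rewrite fact_natE; apply: fact_lower_bound.
have h2 : Rle (Rmult 2 (INR #|A|)) (Rmult 5 (Rplus (INR (2 * #|A| %/ 5)) 1)).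
  rewrite -S_INR; apply/RleP; rewrite !RmultE !IZRposE !INRE -!natrM ler_nat [X in (_ <= X)%N]mulnC.
  exact/ltnW/ltn_ceil.
have h3 : Rle (Rmult 3 (INR #|A|)) (Rmult 40 (Rplus (INR (3 * #|A| %/ 40)) 1)).
  rewrite -S_INR; apply/RleP; rewrite !RmultE !IZRposE !INRE -!natrM ler_nat [X in (_ <= X)%N]mulnC.
  exact/ltnW/ltn_ceil.
apply: Rle_trans (H1 _ _ L _ _ _ erefl F1 F2 hLl h2 h3).
have z0 : 0 < 2%:R^-1 :> R by rewrite invr_gt0 ltr0n.
have z1 : 2%:R^-1 <= 1 :> R by rewrite invf_le1 ?ltr0n // ler1n.
apply/RleP; rewrite !RpowE IZRposE !INRE.
apply: le_trans (squares_prob A6 p0 p1 hL z0 z1 kap0 (m1 := m1) (m := m2) (leqnn _) (leqnn _) (leqnn _)) _.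
by rewrite !natrX.
Qed.

Lemma affine_prob : exists l0 : R, forall (A : finZmodType) (p : R),
  coprime #|A| 6 -> let l := ln (INR #|A|) in Rle l0 l ->
  Rle (Rmult 44 (pow l 2)) (Rmult (INR #|A|) p) ->
  Rle 0 p -> Rle p (Rdiv 1 2) ->
  Rle (bprob p (Hf A) (fun X => ~~ affine_auts (sym X)))
      (Rmult 3 (exp (Ropp (Rdiv (pow l 2) 40000)))).
Proof.
have [l1 H1] := affine_prob_dense; have [l2 H2] := affine_prob_middle.
have [l3 H3] := affine_prob_sparse.
exists (Rmax 4 (Rmax l1 (Rmax l2 l3))) => A p A6 l hl hD p0 ph.
have h4 : Rle 4 l := Rle_trans _ _ _ (Rmax_l _ _) hl.
have {hl}hl := Rle_trans _ _ _ (Rmax_r _ _) hl.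
have hl1 := Rle_trans _ _ _ (Rmax_l _ _) hl.
have {hl}hl := Rle_trans _ _ _ (Rmax_r _ _) hl.
have hl2 := Rle_trans _ _ _ (Rmax_l _ _) hl.
have hl3 := Rle_trans _ _ _ (Rmax_r _ _) hl.
have p1 : Rle p 1 by apply: Rle_trans ph _; apply/RleP; rewrite IZR_half R1E; lra.
set B := exp _.
have B0 : 0 <= B by apply/RleP; left; apply: exp_pos.
have B3 x : Rle x B -> Rle x (Rmult 3 B).
  by move=> h; apply: Rle_trans h _; apply/RleP; rewrite IZRposE INRE; change (B <= 3%:R * B); lra.
case: (Rle_lt_dec p (exp (Ropp (Rmult (Rdiv 51 100) l)))) => [h51|/Rlt_le h51].
  by apply: B3; apply: H3.
case: (Rle_lt_dec p (exp (Ropp (Rdiv l 20)))) => [h20|/Rlt_le h20]; first exact: H2.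
apply: Rle_trans (H1 A p A6 hl1 h20 ph) (Rle_trans _ _ _ _ (middle_total _ h4)).
apply: Rle_trans (_ : Rle (Rplus (exp (Ropp (pow l 2))) (exp (Ropp (pow l 2)))) _).
  rewrite -[X in Rle X _]Rplus_0_r; apply: Rplus_le_compat_l; left; exact: exp_pos.
rewrite -[X in Rle X _]Rplus_0_l; apply: Rplus_le_compat_r; left; exact: exp_pos.
Qed.

(** * The random Cayley graph *)

Section Complement.
Variable A : finZmodType.
Hypothesis A6 : coprime #|A| 6.

Lemma bexp_setC (F : realFieldType) (T : finType) (p : F) (J : {set T}) h :
  bexp p J h = bexp (1 - p) J (fun X => h (J :\: X)).
Proof.
rewrite /bexp (reindex_onto (fun X : {set T} => J :\: X) (fun X : {set T} => J :\: X)) /=; last first.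
  by move=> X sX; rewrite setDDr setDv set0U; apply/setIidPr.
apply: eq_big => [X|X /andP[_ /eqP e]]; last by rewrite e subKr [X in X * _ = _]mulrC.
rewrite subsetDl /= setDDr setDv set0U; apply/eqP/idP => [<-|/setIidPr //].
exact: subsetIl.
Qed.

Lemma is_aut_setC (X : {set A}) (g : {perm A}) :
  is_aut (sym (Hf A :\: X)) g = is_aut (sym X) g.
Proof.
have E x : (x \in sym (Hf A :\: X)) = (x != 0) && (x \notin sym X).
  by rewrite /sym 2!in_set in_setD rep_Hf // andbC.
apply: eq_forallb => x; apply: eq_forallb => y; rewrite /cay_adj !E !subr_eq0 (inj_eq perm_inj).
case: (eqVneq y x) => [->|_] /=; first by rewrite !subrr !eqxx.
by do 2!case: (_ \in _).
Qed.

Lemma affine_auts_setC (X : {set A}) :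
  affine_auts (sym (Hf A :\: X)) = affine_auts (sym X).
Proof. by apply: eq_forallb => g; rewrite is_aut_setC. Qed.

Lemma affine_prob_setC (F : realFieldType) (p : F) :
  bprob p (Hf A) (fun X => ~~ affine_auts (sym X)) =
  bprob (1 - p) (Hf A) (fun X => ~~ affine_auts (sym X)).
Proof. by rewrite /bprob bexp_setC; apply: eq_bexp => X _; rewrite affine_auts_setC. Qed.

Lemma empty_prob (F : realFieldType) (p : F) :
  bprob p (Hf A) (fun X => X == set0) = (1 - p) ^+ #|Hf A|.
Proof.
rewrite /bprob /bexp (bigD1 set0) ?sub0set //= eqxx cards0 setD0 expr0 mul1r mulr1.
by rewrite big1 ?addr0 // => X /andP[_ /negbTE ->]; rewrite mulr0.
Qed.

(** [dchromatic_affine] asks for an element of S, hence the term for the empty set. *)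
Lemma dchromatic_prob (p : R) : 0 <= p -> p <= 1 ->
  1 - (bprob p (Hf A) (fun X => ~~ affine_auts (sym X)) + (1 - p) ^+ #|Hf A|) <=
  cay_prob p (fun S : {set A} => (dchromatic S <= (chromatic S).+1)%N).
Proof.
move=> p0 p1; rewrite cay_probE // [X in _ <= X]bprobC lerD2l lerN2 -empty_prob.
apply: le_trans (bprobU p0 p1 _ _ _); apply: ler_bprob => // X sX; apply: contraR.
rewrite negb_or negbK => /andP[aff /set0Pn[x xX]].
apply: (@dchromatic_affine A A6 (sym X) x) => //.
by rewrite mem_sym // (subsetP sX).
Qed.

End Complement.

Theorem mainTheorem6 :
  exists c : R, Rlt 0 c /\
  exists N : nat, forall (A : finZmodType) (p : R),
    (N <= #|A|)%N ->
    coprime #|A| 6 ->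
    Rle (Rdiv (Rmult 25 (pow (log2 (INR #|A|)) 2)) (INR #|A|)) p ->
    Rle p (Rminus 1 (Rpower (Rdiv (Rmult 10 (log2 (INR #|A|))) (INR #|A|))
                            (Rdiv 2 3))) ->
    Rle (Rminus 1 (Rpower (INR #|A|) (Ropp (Rmult c (log2 (INR #|A|))))))
        (cay_prob p (fun S : {set A} => (dchromatic S <= (chromatic S).+1)%N)).
Proof.
have [l1 H1] := affine_prob; have [l2 H2] := codensity_lower_bound.
exists (Rdiv 1 200000); split.
  by apply: Rdiv_lt_0_compat; apply: IZR_lt.
pose l0 := Rmax 400 (Rmax l1 l2).
have [N [_ hN]] := nat_floor (exp l0) (Rlt_le _ _ (exp_pos _)).
exists N.+1 => A p NA A6 hp1 hp2.
have nE := exp_ln_card A; rewrite /log2 in hp1 hp2 *.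
have hl : Rle l0 (ln (INR #|A|)).
  rewrite -[X in Rle X _]ln_exp; case: (Rle_lt_or_eq_dec (exp l0) (INR #|A|)).
  - apply: Rle_trans (Rlt_le _ _ hN) _; rewrite -S_INR; apply: le_INR; exact/ssrnat.leP.
  - by move=> h; left; apply: ln_increasing => //; apply: exp_pos.
  by move=> ->; right.
set l := ln (INR #|A|) in nE hl hp1 hp2 *.
have h400 : Rle 400 l := Rle_trans _ _ _ (Rmax_l _ _) hl.
have {hl}hl := Rle_trans _ _ _ (Rmax_r _ _) hl.
have hl1 := Rle_trans _ _ _ (Rmax_l _ _) hl.
have {hl}hl2 := Rle_trans _ _ _ (Rmax_r _ _) hl.
have l1' : Rle 1 l by apply: Rle_trans h400; apply: IZR_le.
rewrite nE in hp1 hp2 *.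
have hD := density_lower_bound l p hp1; rewrite -nE in hD.
have hq : Rle (Rpower (Rdiv (Rmult 10 (Rdiv l (ln 2))) (exp l)) (Rdiv 2 3)) (Rminus 1 p).
  by move/RleP: hp2 => h2; apply/RleP; move: h2; rewrite !RminusE R1E; set r := Rpower _ _ => h2; lra.
have hDq := H2 _ _ hl2 hq; rewrite -nE in hDq.
have q0 : Rle 0 (Rminus 1 p) by apply: Rle_trans hq; left; apply: exp_pos.
have p0 : Rle 0 p.
  apply: Rle_trans hp1; apply: Rmult_le_pos; last by left; apply: Rinv_0_lt_compat; apply: exp_pos.
  by apply: Rmult_le_pos; [apply: IZR_le | apply: pow2_ge_0].
have p0' : 0 <= p by apply/RleP.
have p1' : p <= 1 by move/RleP: q0; rewrite RminusE R0E R1E subr_ge0.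
have p1 : Rle p 1 by apply/RleP; rewrite R1E.
have aff : Rle (bprob p (Hf A) (fun X => ~~ affine_auts (sym X)))
    (Rmult 3 (exp (Ropp (Rdiv (pow l 2) 40000)))).
  case: (Rle_lt_dec p (Rdiv 1 2)) => [ph|/Rlt_le ph]; first exact: H1.
  rewrite affine_prob_setC //; apply: (H1 A (Rminus 1 p)) => //.
  by move/RleP: ph => ph; apply/RleP; move: ph; rewrite IZR_half RminusE R1E; lra.
have emp := empty_bound _ _ _ _ l1' nE (conj p0 p1) hD (card_Hf A6).
have tot := Rle_trans _ _ _ (Rplus_le_compat _ _ _ _ aff emp) (final_total _ h400).
apply: Rle_trans (_ : Rle _ (1 - (bprob p (Hf A) (fun X => ~~ affine_auts (sym X)) + (1 - p) ^+ #|Hf A|))) _;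
  last by apply/RleP; apply: dchromatic_prob.
by apply/RleP; move/RleP: tot; rewrite RpowE RminusE R1E lerD2l lerN2.
Qed.
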